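(* Let $h_0$ be the standard Gaussian window and let $\Gamma\subset\mathbb{R}^2$ be a $\varphi$-regular trajectory set. Let $1\leq p<\infty$. Then $\Gamma$ is a Gabor sampling trajectory for $M^p(\mathbb{R})$ (with window $h_0$) if and only if there exist $R,m,M>0$ such that $$m\leq\mathcal{H}^1(\Gamma\cap B_R(z))\leq M\quad\text{for every }z\in\mathbb{R}^2.$$
   Context: $h_0(t)=2^{1/4}e^{-\pi t^2}$. For $z=(x,\xi)\in\mathbb{R}^2$, $V_gf(z)=\langle f,\pi(z)g\rangle=\int_{\mathbb{R}}f(t)\overline{g(t-x)}e^{-2\pi i\xi t}dt$ with $\pi(z)g(t)=e^{2\pi i\xi t}g(t-x)$ (duality pairing for distributions $f$). $M^p(\mathbb{R})=\{f\in\mathcal{S}'(\mathbb{R}):V_{h_0}f\in L^p(\mathbb{R}^2)\}$, with norm $\|f\|_{M^p}=\|V_{h_0}f\|_{L^p(\mathbb{R}^2)}$. $\mathcal{H}^1$ is the 1-dimensional Hausdorff measure on $\mathbb{R}^2$, normalized to equal Lebesgue measure on lines; $B_R(z)$ is the ball of radius $R$ centered at $z$. A trajectory is the image of a curve $\gamma:\mathbb{R}\to\mathbb{R}^2$ whose restriction to each finite interval is rectifiable; a trajectory set is a countable collection (union) of trajectories. $\Gamma$ is a Gabor sampling trajectory for $M^p(\mathbb{R})$ with window $g$ if there are $A,B>0$ with $A\|f\|_{M^p}^p\leq\int_\Gamma|V_gf|^p\,d\mathcal{H}^1\leq B\|f\|_{M^p}^p$ for all $f\in M^p(\mathbb{R})$.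 Let $\varphi:[0,1)\to[0,\infty)$ be continuous at $0$. A locally finite Borel measure $\mu$ on $\mathbb{R}^2$ is $\varphi$-regular if $\mu(B_R(z))\leq\pi\varphi(R)R$ for every $z\in\mathbb{R}^2$ and every $R\in(0,1)$; a set $E\subset\mathbb{R}^2$ is $\varphi$-regular if the restriction $\mathcal{H}^1|_E$ is $\varphi$-regular. *)

(* Defs.v *)
From HB Require Import structures.
From mathcomp Require Import all_boot all_order all_algebra.
From mathcomp Require Import zify ring lra.
From mathcomp Require Import all_classical all_reals all_analysis.
From mathcomp Require Import complex.

Set Implicit Arguments.
Unset Strict Implicit.
Unset Printing Implicit Defensive.

Import Order.TTheory GRing.Theory Num.Theory.
Import numFieldNormedType.Exports.

Local Open Scope classical_set_scope.
Local Open Scope ring_scope.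
Local Open Scope complex_scope.

(* The norm of the product R * R in the library is the sup norm, so Euclidean
   distances, balls and diameters on the plane are written out. *)
Definition edist (R : realType) (z w : R * R) : R :=
  Num.sqrt ((z.1 - w.1) ^+ 2 + (z.2 - w.2) ^+ 2).

Definition eball (R : realType) (z : R * R) (r : R) : set (R * R) :=
  [set w | edist z w < r].

(* 0 is adjoined so that the empty set has diameter 0 rather than -oo. *)
Definition ediam (R : realType) (U : set (R * R)) : \bar R :=
  ereal_sup (0%E |` [set (edist z w)%:E | z in U & w in U]).

Definition hausdorff1_delta (R : realType) (delta : R) (E : set (R * R))
    : \bar R :=
  ereal_inf [set (\sum_(k <oo) ediam (U k))%E | U in
    [set U : (set (R * R))^nat |
      (forall k, (ediam (U k) <= delta%:E)%E) /\ E `<=` \bigcup_k U k]].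

(* The supremum over delta is the limit delta -> 0, by monotonicity.  No
   constant in front of the diameter: a segment has measure its length. *)
Definition hausdorff1 (R : realType) (E : set (R * R)) : \bar R :=
  ereal_sup [set hausdorff1_delta delta E | delta in [set delta | 0 < delta]].

Definition hausdorff1_restr (R : realType) (E A : set (R * R)) : \bar R :=
  hausdorff1 (A `&` E).

(* hausdorff1 is a metric outer measure, so Borel sets are Caratheodory
   measurable; hence hausdorff1, and its restriction to an arbitrary set E, are
   measures on the product (that is, Borel) sigma-algebra of R * R. *)
Section hausdorff1_measure.
Context (R : realType).
Local Open Scope ereal_scope.
Implicit Types (A B E X U : set (R * R)) (d : R).

Let ediam_ge0 U : 0 <= ediam U.
Proof. by apply: ereal_sup_ubound; left. Qed.

Let ediam0 : ediam (@set0 (R * R)) = 0.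
Proof.
apply/eqP; rewrite eq_le ediam_ge0 andbT.
by apply: ge_ereal_sup => x [->//|[z []]].
Qed.

Let D := g_sigma_algebraType (@setT (set (R * R))).

Let mD (A : set D) : measurable A.
Proof. exact: sub_sigma_algebra. Qed.

Let trunc_diam d (U : set D) : \bar R :=
  if ediam U <= d%:E then ediam U else +oo.

Let trunc_diam_ge0 d U : 0 <= trunc_diam d U.
Proof. by rewrite /trunc_diam; case: ifP. Qed.

Let trunc_diam0 d : (0 <= d)%R -> trunc_diam d set0 = 0.
Proof. by rewrite /trunc_diam ediam0 lee_fin => ->. Qed.

Let hausdorff1_deltaE d E :
  hausdorff1_delta d E = @mu_ext _ D R (trunc_diam d) E.
Proof.
apply/eqP; rewrite eq_le; apply/andP; split.
  apply: le_ereal_inf_tmp => _ [U [_ EU] <-].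
  have [Ud|] := pselect (forall k, ediam (U k) <= d%:E).
    apply: ereal_inf_lbound; exists U => //.
    by apply: eq_eseriesr => k _; rewrite /trunc_diam Ud.
  move=> /existsNP[k /negP Uk]; rewrite (@eseries_pinfty _ _ _ k) ?leey//.
    by move=> n _; rewrite -ltNye (lt_le_trans _ (trunc_diam_ge0 d (U n))).
  by rewrite /trunc_diam (negbTE Uk).
apply: le_ereal_inf_tmp => _ [U [Ud EU] <-].
apply: ereal_inf_lbound; exists U; first by split.
by apply: eq_eseriesr => k _; rewrite /trunc_diam Ud.
Qed.

Let delta_ge0 d E : 0 <= hausdorff1_delta d E.
Proof. by rewrite hausdorff1_deltaE; exact: mu_ext_ge0. Qed.

Let le_hausdorff1 d E : (0 < d)%R -> hausdorff1_delta d E <= hausdorff1 E.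
Proof. by move=> d0; apply: ereal_sup_ubound; exists d. Qed.

Let delta_anti d d' E : (d' <= d)%R ->
  hausdorff1_delta d E <= hausdorff1_delta d' E.
Proof.
move=> dd; apply: le_ereal_inf_tmp => _ [U [Ud EU] <-].
apply: ereal_inf_lbound; exists U => //; split => // k.
by rewrite (le_trans (Ud k))// lee_fin.
Qed.

Let hausdorff1_set0 : hausdorff1 (@set0 (R * R)) = 0.
Proof.
apply/eqP; rewrite eq_le; apply/andP; split.
  apply: ge_ereal_sup => _ [d /= d0 <-].
  by rewrite hausdorff1_deltaE mu_ext0//; exact/trunc_diam0/ltW.
exact: le_trans (delta_ge0 1 _) (le_hausdorff1 _ ltr01).
Qed.

Let hausdorff1_ge0 E : 0 <= hausdorff1 E.
Proof. exact: le_trans (delta_ge0 1 _) (le_hausdorff1 _ ltr01). Qed.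

Let hausdorff1_le : {homo @hausdorff1 R : A B / A `<=` B >-> A <= B}.
Proof.
move=> A B AB; apply: ge_ereal_sup => _ [d /= d0 <-].
apply: le_trans (le_hausdorff1 _ d0).
by rewrite !hausdorff1_deltaE; exact: le_mu_ext.
Qed.

Let hausdorff1_subadd : sigma_subadditive (@hausdorff1 R).
Proof.
move=> F; apply: ge_ereal_sup => _ [d /= d0 <-].
apply: (@le_trans _ _ (\sum_(i <oo) hausdorff1_delta d (F i))).
  rewrite hausdorff1_deltaE.
  under [leRHS]eq_eseriesr do rewrite hausdorff1_deltaE.
  by apply: mu_ext_sigma_subadditive => //; exact/trunc_diam0/ltW.
by apply: lee_nneseries => // n _; exact: le_hausdorff1.
Qed.

HB.instance Definition _ := isOuterMeasure.Build R (R * R)%type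
  (@hausdorff1 R) hausdorff1_set0 hausdorff1_ge0 hausdorff1_le
  hausdorff1_subadd.

Let delta_metric d A B (c : R) : (0 < d)%R -> (d < c)%R ->
  (forall z w, A z -> B w -> (c <= edist z w)%R) ->
  hausdorff1_delta d A + hausdorff1_delta d B <= hausdorff1_delta d (A `|` B).
Proof.
move=> d0 dc AB; apply: le_ereal_inf_tmp => _ [U [Ud EU] <-].
pose V E k := if `[< U k `&` E !=set0 >] then U k else set0.
have V0 E k : 0 <= ediam (V E k) by [].
have Vd E k : ediam (V E k) <= d%:E.
  by rewrite /V; case: ifP; rewrite // ediam0 lee_fin ltW.
have VE E : E `<=` A `|` B -> E `<=` \bigcup_k V E k.
  move=> EAB z Ez; have [k _ Ukz] := EU _ (EAB _ Ez).
  by exists k => //; rewrite /V ifT//; apply/asboolP; exists z.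
apply: (@le_trans _ _ (\sum_(k <oo) (ediam (V A k) + ediam (V B k)))).
  rewrite nneseriesD//; apply: leeD; apply: ereal_inf_lbound.
    by exists (V A) => //; split => //; apply: VE => z; left.
  by exists (V B) => //; split => //; apply: VE => z; right.
apply: lee_nneseries => [k _ _|k _]; first exact: adde_ge0.
rewrite /V; case: ifPn => [/asboolP[z [Uz Az]]|_]; last first.
  by rewrite ediam0 add0e; case: ifP => // _; rewrite ediam0.
case: ifPn => [/asboolP[w [Uw Bw]]|_]; last by rewrite ediam0 adde0.
have : (edist z w)%:E <= d%:E.
  apply: le_trans (Ud k); apply: ereal_sup_ubound; right.
  by exists z => //; exists w.
by rewrite lee_fin leNgt (lt_le_trans dc (AB _ _ Az Bw)).
Qed.

Let hausdorff1_metric A B (c : R) : (0 < c)%R ->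
  (forall z w, A z -> B w -> (c <= edist z w)%R) ->
  hausdorff1 A + hausdorff1 B <= hausdorff1 (A `|` B).
Proof.
move=> c0 AB; set M := hausdorff1 (_ `|` _).
have [->|Moo] := eqVneq M +oo; first exact: leey.
have Mfin : M \is a fin_num by rewrite ge0_fin_numE ?hausdorff1_ge0// ltey.
have key d1 d2 : (0 < d1)%R -> (0 < d2)%R ->
    hausdorff1_delta d1 A + hausdorff1_delta d2 B <= M.
  move=> d10 d20; pose d := Num.min (Num.min d1 d2) (c / 2)%R.
  have d0 : (0 < d)%R by rewrite !lt_min d10 d20 divr_gt0.
  have dc : (d < c)%R by rewrite gt_min; apply/orP; right; lra.
  apply: le_trans (le_hausdorff1 _ d0).
  apply: le_trans (delta_metric d0 dc AB).
  by apply: leeD; apply: delta_anti; rewrite !ge_min lexx ?orbT.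
have fA d1 : (0 < d1)%R -> hausdorff1_delta d1 A \is a fin_num.
  move=> d10; rewrite ge0_fin_numE//.
  apply: (@le_lt_trans _ _ M); last by rewrite ltey.
  by apply: le_trans (key _ _ d10 ltr01); rewrite leeDl.
have HB d1 : (0 < d1)%R -> hausdorff1_delta d1 A + hausdorff1 B <= M.
  move=> d10; rewrite addeC -leeBrDr ?fA//.
  apply: ge_ereal_sup => _ [d2 /= d20 <-].
  by rewrite leeBrDr ?fA// addeC key.
have fB : hausdorff1 B \is a fin_num.
  rewrite ge0_fin_numE ?hausdorff1_ge0//; apply: (@le_lt_trans _ _ M).
    by apply: le_trans (HB _ ltr01); rewrite leeDr.
  by rewrite ltey.
rewrite -leeBrDr//; apply: ge_ereal_sup => _ [d1 /= d10 <-].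
by rewrite leeBrDr// HB.
Qed.

Let caratheodory_sublevel (f : R * R -> R) (a : R) :
  (forall z w, `|f z - f w| <= edist z w)%R ->
  (@hausdorff1 R).-caratheodory [set z | f z <= a]%R.
Proof.
move=> flip; apply: le_caratheodory_measurable => X /=.
set C := [set z | _].
have [->|Xoo] := eqVneq (hausdorff1 X) +oo; first exact: leey.
have Xfin : hausdorff1 X < +oo by rewrite ltey.
pose L k := X `&` [set z | (k.+2%:R^-1 < f z - a <= k.+1%:R^-1)%R].
pose Q n := X `&` [set z | (n.+1%:R^-1 < f z - a)%R].
pose S b n := if n is 0%N then set0 else
  X `&` [set z | ((n.*2 + b)%:R^-1 < f z - a)%R].
have par b n : \sum_(0 <= i < n) hausdorff1 (L (i.*2 + b)%N) <=
    hausdorff1 (S b n).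
  elim: n => [|n ih]; first by rewrite big_geq.
  rewrite big_nat_recr//=; apply: (le_trans (leeD ih (lexx _))).
  apply: (@le_trans _ _ (hausdorff1 (S b n `|` L (n.*2 + b)%N))).
    case: n {ih} => [|n] /=; first by rewrite outer_measure0 add0e set0U.
    set m := (n.*2.+2 + b)%N.
    have m0 : (0 < m%:R :> R)%R by rewrite ltr0n.
    have m1 : (0 < m.+1%:R :> R)%R by rewrite ltr0n.
    apply: (@hausdorff1_metric _ _ (m%:R^-1 - m.+1%:R^-1)).
      by rewrite subr_gt0 ltf_pV2 ?posrE// ltr_nat.
    move=> z w [_ /= Sz] [_ /= /andP[_ Lw]].
    apply: le_trans (flip z w); apply: le_trans (ler_norm _);
      by move: (m%:R^-1)%R (m.+1%:R^-1)%R Sz Lw => u v; lra.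
  apply: hausdorff1_le; rewrite subUset; split.
    case: n {ih} => [|n] //=; apply: setIS => z /=.
    by apply: lt_trans; rewrite ltf_pV2 ?posrE ?ltr0n// ltr_nat; lia.
  by apply: setIS => z /= /andP[]; rewrite doubleS.
have SX b n : hausdorff1 (S b n) <= hausdorff1 X.
  by apply: hausdorff1_le; case: n => [|n] //=; exact: subIsetl.
have Loo : \sum_(0 <= k <oo) hausdorff1 (L k) < +oo.
  apply: (@le_lt_trans _ _ (hausdorff1 X + hausdorff1 X)); last first.
    by rewrite lte_add_pinfty.
  apply: lime_le; first exact: is_cvg_nneseries.
  apply: nearW => n.
  apply: (@le_trans _ _ (\sum_(0 <= k < n.*2) hausdorff1 (L k))).
    rewrite [leRHS](@big_cat_nat _ _ _ n)//=; last by lia.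
    by rewrite leeDl// sume_ge0.
  have -> : \sum_(0 <= k < n.*2) hausdorff1 (L k) =
      \sum_(0 <= i < n) hausdorff1 (L (i.*2 + 0)%N) +
      \sum_(0 <= i < n) hausdorff1 (L (i.*2 + 1)%N).
    elim: n => [|n ih]; first by rewrite !big_geq// adde0.
    rewrite doubleS !big_nat_recr//= ih addn0 addn1.
    by rewrite -!addeA; congr (_ + _); rewrite addeCA.
  by apply: leeD; [exact: le_trans (par 0%N n) _|exact: le_trans (par 1%N n) _].
have tail n : hausdorff1 (X `&` C) + hausdorff1 (X `&` ~` C) <=
    hausdorff1 X + \sum_(n <= k <oo) hausdorff1 (L k).
  apply: (@le_trans _ _ (hausdorff1 (X `&` C) +
      (hausdorff1 (Q n) + \sum_(n <= k <oo) hausdorff1 (L k)))).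
    apply: leeD => //.
    apply: (@le_trans _ _
        (hausdorff1 (Q n `|` \bigcup_(k in ~` `I_n) L k))).
      apply: hausdorff1_le => z [Xz /= /negP]; rewrite -ltNge => az.
      have d0 : (0 < f z - a)%R by rewrite subr_gt0.
      have [Qz|Qz] := ltP (n.+1%:R^-1)%R (f z - a)%R; [by left|right].
      have dn : (n.+1%:R <= (f z - a)^-1)%R.
        by rewrite -[leLHS]invrK lef_pV2 ?posrE ?invr_gt0 ?ltr0n.
      have i0 : (0 <= (f z - a)^-1)%R by rewrite invr_ge0 ltW.
      have /andP[] := truncn_itv i0.
      set t := Num.truncn _ => t1 t2.
      have nt : (n < t)%N.
        by rewrite -ltnS -(ltr_nat R); exact: le_lt_trans dn t2.
      exists t.-1 => /=; first by apply/negP; lia.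
      split => //=; rewrite prednK; last by lia.
      apply/andP; split.
        by rewrite -[ltRHS]invrK ltf_pV2 ?posrE ?invr_gt0 ?ltr0n.
      rewrite -[leLHS]invrK lef_pV2 ?posrE ?invr_gt0//.
      by rewrite ltr0n; lia.
    apply: le_trans (outer_measureU2 _ _ _) _ => /=; apply: leeD => //.
    exact: outer_measure_sigma_subadditive_tail.
  rewrite addeA leeD2r//.
  apply: (@le_trans _ _ (hausdorff1 ((X `&` C) `|` Q n))); last first.
    by apply: hausdorff1_le; rewrite subUset; split; exact: subIsetl.
  have n0 : (0 < n.+1%:R^-1 :> R)%R by rewrite invr_gt0 ltr0n.
  apply: (hausdorff1_metric n0) => z w [_ /= Cz] [_ /= Qw].
  apply: le_trans (flip z w); rewrite distrC.
  apply: le_trans (ler_norm _).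
  by move: (n.+1%:R^-1)%R Qw Cz; rewrite /C /= => u; lra.
have tail0 : \sum_(n <= k <oo) hausdorff1 (L k) @[n --> \oo] --> 0.
  exact: nneseries_tail_cvg.
have lim_tail : hausdorff1 X + \sum_(n <= k <oo) hausdorff1 (L k)
    @[n --> \oo] --> hausdorff1 X.
  rewrite -[X in _ --> X]adde0; apply: cvgeD => //; last exact: cvg_cst.
  by rewrite fin_num_adde_defl.
rewrite -(cvg_lim _ lim_tail)//; apply: lime_ge; first exact: cvgP lim_tail.
exact: nearW.
Qed.

Let caratheodory_borel A : measurable A -> (@hausdorff1 R).-caratheodory A.
Proof.
have mlip (f : caratheodory_type (@hausdorff1 R) -> R) :
    (forall z w, `|f z - f w| <= @edist R z w)%R -> measurable_fun setT f.
  move=> flip; apply: (measurability _ (measurable_realfun.RGenOInfty.measurableE R)).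
  move=> _ [_ [x ->] <-]; rewrite setTI.
  rewrite (_ : f @^-1` _ = ~` [set z | f z <= x]%R).
    by apply: measurableC; exact: caratheodory_sublevel.
  apply/seteqP; split => z /=; rewrite in_itv /= andbT ltNge => /negP//.
have mid : measurable_fun setT
    (fun z : caratheodory_type (@hausdorff1 R) => ((z.1, z.2) : R * R)).
  apply: measurable_fun_pair; apply: mlip => z w; rewrite -sqrtr_sqr ler_wsqrtr//.
    by rewrite lerDl sqr_ge0.
  by rewrite lerDr sqr_ge0.
move=> mA; have := mid measurableT A mA; rewrite setTI.
by rewrite (_ : _ @^-1` _ = A)//; apply/seteqP; split => -[].
Qed.

Let hausdorff1_sigma_additive : semi_sigma_additive (@hausdorff1 R).
Proof.
move=> F mF tF mUF.
apply: (@caratheodory_measure_sigma_additive _ _ (@hausdorff1 R)) => //.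
  by move=> i; exact: caratheodory_borel.
exact: caratheodory_borel.
Qed.

HB.instance Definition _ := isMeasure.Build _ (R * R)%type R
  (@hausdorff1 R) hausdorff1_set0 hausdorff1_ge0 hausdorff1_sigma_additive.

Variable E : set (R * R).

Let hausdorff1_restr0 : hausdorff1_restr E set0 = 0.
Proof. by rewrite /hausdorff1_restr set0I hausdorff1_set0. Qed.

Let hausdorff1_restr_ge0 A : 0 <= hausdorff1_restr E A.
Proof. exact: hausdorff1_ge0. Qed.

Let hausdorff1_restr_sigma_additive : semi_sigma_additive (hausdorff1_restr E).
Proof.
move=> F mF tF mUF.
have cF n : (@hausdorff1 R).-caratheodory (F n) by exact: caratheodory_borel.
have -> : hausdorff1_restr E (\bigcup_n F n) =
    \sum_(k <oo) hausdorff1_restr E (F k).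
  under eq_eseriesr do rewrite /hausdorff1_restr setIC.
  rewrite /hausdorff1_restr setIC; apply/eqP; rewrite eq_le.
  rewrite outer_measure_bigcup_lim/=.
  have := caratheodory_lime_le cF tF (E `&` \bigcup_n F n).
  rewrite -setIA setICr setI0 outer_measure0 adde0.
  under eq_eseriesr => k _.
    rewrite -setIA (setIidr (bigcup_sup _))//.
    over.
  by [].
by apply: is_cvg_nneseries => n _ _; exact: hausdorff1_ge0.
Qed.

HB.instance Definition _ := isMeasure.Build _ (R * R)%type R
  (hausdorff1_restr E) hausdorff1_restr0 hausdorff1_restr_ge0
  hausdorff1_restr_sigma_additive.

End hausdorff1_measure.

Definition locally_finite (R : realType) (mu : set (R * R) -> \bar R) : Prop :=
  forall z, exists U, [/\ open U, U z & (mu U < +oo)%E].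

Definition phi_regular_measure (R : realType) (phi : R -> R)
    (mu : {measure set (R * R) -> \bar R}) : Prop :=
  locally_finite mu /\
  forall (z : R * R) (r : R), 0 < r < 1 ->
    (mu (eball z r) <= (pi * phi r * r)%:E)%E.

Definition phi_regular (R : realType) (phi : R -> R) (E : set (R * R)) : Prop :=
  phi_regular_measure phi (hausdorff1_restr E).

(* s lists the points a < s_0 < ... < s_n = b of a subdivision of [a, b]. *)
Definition polygonal_length (R : realType) (gamma : R -> R * R) (a b : R)
    (s : seq R) : R :=
  let F := gamma \o nth b (a :: s) in
  \sum_(0 <= n < size s) edist (F n.+1) (F n).

Definition rectifiable (R : realType) (gamma : R -> R * R) (a b : R) : Prop :=
  has_ubound [set polygonal_length gamma a b s | s in itv_partition a b].

Definition trajectory (R : realType) (T : set (R * R)) : Prop :=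
  exists gamma : R -> R * R,
    [/\ continuous gamma,
        forall a b, a < b -> rectifiable gamma a b &
        T = range gamma].

Definition trajectory_set (R : realType) (Gamma : set (R * R)) : Prop :=
  exists C : set (set (R * R)),
    [/\ countable C,
        forall T, C T -> trajectory T &
        Gamma = \bigcup_(T in C) T].

Definition cderive1 (R : realType) (g : R -> R[i]) : R -> R[i] :=
  fun t => derive1 (fun s => complex.Re (g s)) t
        +i* derive1 (fun s => complex.Im (g s)) t.

Definition smooth (R : realType) (g : R -> R[i]) : Prop :=
  forall (n : nat) (t : R),
    derivable (fun s => complex.Re (iter n (@cderive1 R) g s)) t 1 /\
    derivable (fun s => complex.Im (iter n (@cderive1 R) g s)) t 1.

Definition schwartz_seminorm (R : realType) (k n : nat) (g : R -> R[i])
    : \bar R :=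
  ereal_sup (range (fun t : R =>
    (`|t| ^+ k * Normc.normc (iter n (@cderive1 R) g t))%:E)).

Definition schwartz (R : realType) (g : R -> R[i]) : Prop :=
  smooth g /\ forall k n : nat, (schwartz_seminorm k n g < +oo)%E.

(* A tempered distribution is a complex-linear functional on the Schwartz
   space, continuous for the topology generated by the seminorms above.  It is
   represented by a function on all of R -> R[i]; its values outside the
   Schwartz space are irrelevant and never used. *)
Definition tempered_distribution (R : realType)
    (f : (R -> R[i]) -> R[i]) : Prop :=
  (forall (a : R[i]) (g h : R -> R[i]), schwartz g -> schwartz h ->
     f (fun t => a * g t + h t) = a * f g + f h) /\
  (forall g : R -> R[i], schwartz g -> forall e : R, 0 < e ->
     exists (N : nat) (d : R), 0 < d /\
       forall h : R -> R[i], schwartz h ->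
         (forall k n : nat, (k <= N)%N -> (n <= N)%N ->
            (schwartz_seminorm k n (fun t => (h t - g t)%R) < d%:E)%E) ->
         Normc.normc (f h - f g) < e).

(* tf_shift (x, xi) g t = e^{2 pi i xi t} g (t - x) *)
Definition tf_shift (R : realType) (z : R * R) (g : R -> R[i]) : R -> R[i] :=
  fun t => (cos (2 * pi * z.2 * t) +i* sin (2 * pi * z.2 * t)) * g (t - z.1).

(* The pairing <f, u> of a distribution f with a test function u extends
   \int f \bar u, i.e. it is f applied to the complex conjugate of u. *)
Definition stft (R : realType) (g : R -> R[i]) (f : (R -> R[i]) -> R[i])
    (z : R * R) : R[i] :=
  f (fun t => conjc (tf_shift z g t)).

Definition gaussian (R : realType) : R -> R[i] :=
  fun t => (2 `^ 4^-1 * expR (- (pi * t ^+ 2)))%:C.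

Definition modulation_norm (R : realType) (p : R) (f : (R -> R[i]) -> R[i])
    : \bar R :=
  Lnorm (@lebesgue_measure R \x @lebesgue_measure R)%E p%:E
    (fun z => (Normc.normc (stft (@gaussian R) f z))%:E).

Definition modulation_space (R : realType) (p : R) (f : (R -> R[i]) -> R[i])
    : Prop :=
  [/\ tempered_distribution f,
      measurable_fun [set: R * R]
        (fun z => complex.Re (stft (@gaussian R) f z)),
      measurable_fun [set: R * R]
        (fun z => complex.Im (stft (@gaussian R) f z)) &
      (modulation_norm p f < +oo)%E].

Definition gabor_sampling_trajectory (R : realType) (p : R) (g : R -> R[i])
    (Gamma : set (R * R)) : Prop :=
  exists A B : R, [/\ 0 < A, 0 < B &
    forall f : (R -> R[i]) -> R[i], modulation_space p f ->
      (A%:E * modulation_norm p f `^ p <=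
         \int[@hausdorff1 R]_(z in Gamma) (Normc.normc (stft g f z) `^ p)%:E <=
       B%:E * modulation_norm p f `^ p)%E].

(* Main.v *)
(* Up to the factor e^{-pi y^2} and a phase, V f (z + (y, eta)) is a function of
   zeta = y - i eta which is, on each disc, a uniform limit of polynomials,
   because f is continuous for the Schwartz topology.  Newton interpolation at k
   well separated points w_j near z bounds such a polynomial at z by 2^-k times
   its size on a larger disc plus a constant times max_j |V f (w_j)|; its size on
   the disc is controlled by averages over n-th roots of unity (a discrete Cauchy
   estimate).  Since mu = H^1 restricted to Gamma has mass at least m on the ball
   B_r(z) and, by regularity, small mass on small balls, Chebyshev's inequality
   provides such points with |V f (w_j)|^p at most a constant times the integral
   of |V f|^p over B_r(z) for mu.  Hence
     |V f (z)|^p <= theta * liminf_n (circle means of |V f|^p around z)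
                    + C * \int_{B_r(z)} |V f|^p d mu
   with theta <= 1/2.  Integrating in z, with Fatou, translation invariance and
   Tonelli, the first term is absorbed: this is the lower sampling bound.  The
   upper bound is the same estimate with k = 0, integrated for mu.
   Conversely, V of a time-frequency shift of h_0 by z has modulus
   e^{-pi |w - z|^2 / 2} at w, so the sampling inequalities bound the integrals of
   Gaussian bumps for mu uniformly in their centre z; the upper bound yields a
   bound on the masses of balls, which makes the tails of the bumps uniformly
   small and so yields a lower bound for balls of large radius. *)

From HB Require Import structures.
Require Import Defs.
From mathcomp Require Import all_boot all_order all_algebra.
From mathcomp Require Import zify ring lra.
From mathcomp Require Import all_classical all_reals all_analysis.
From mathcomp Require Import measurable_realfun cyclic cyclotomic separable complex.

Set Implicit Arguments.
Unset Strict Implicit.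
Unset Printing Implicit Defensive.

Import Order.TTheory GRing.Theory Num.Theory.
Import numFieldNormedType.Exports.
Import Normc.

Local Open Scope classical_set_scope.
Local Open Scope ring_scope.
Local Open Scope complex_scope.

(* The library uses this name for the extended distance. *)
Local Notation edist := Defs.edist.

(** * Polynomial interpolation over the complex numbers *)

(** The degree of that polynomial depends on z, on f and on the error, without any uniform bound.
    Hence the circle means can be compared only for n large depending on z, and the lower limit in n
    removes this dependence. The order of the choices matters. The factor of the circle means is 3^p
    (2^-k 2 E)^p with E depending on the radius r alone, so k is chosen first, to make it at most
    1/2. Then the mass m/(2(k+1)) allowed to a small ball fixes the separation d, and d fixes the
    interpolation constant, which may be huge since it only multiplies the sampled integral.
    Absorption requires the integral of |V f|^p to be finite, which is membership in M^p; p >= 1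
    gives the convexity used for the discrete means. *)

Section complex_modulus.
Context {R : realType}.
Implicit Types (x y z : R[i]).

Lemma normc_ge0 x : 0 <= normc x.
Proof. by case: x => a b; exact: sqrtr_ge0. Qed.

Lemma normcX x n : normc (x ^+ n) = normc x ^+ n.
Proof.
elim: n => [|n ih]; first by rewrite !expr0 normc1.
by rewrite !exprS normcM ih.
Qed.

Lemma normcB x y : normc (x - y) <= normc x + normc y.
Proof. by rewrite -(normcN y) le_normcD. Qed.

Lemma normcBC x y : normc (x - y) = normc (y - x).
Proof. by rewrite -normcN opprB. Qed.

Lemma normc_real (a : R) : normc a%:C = `|a|.
Proof. by rewrite /normc /= expr0n addr0 sqrtr_sqr. Qed.

Lemma normc_conjc x : normc (conjc x) = normc x.
Proof. by case: x => a b; rewrite /normc /= sqrrN. Qed.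

Lemma normc_sum I (r : seq I) (P : pred I) (F : I -> R[i]) :
  normc (\sum_(i <- r | P i) F i) <= \sum_(i <- r | P i) normc (F i).
Proof.
elim/big_ind2: _ => [|x1 x2 y1 y2 h1 h2|//]; first by rewrite normc0.
exact: le_trans (le_normcD _ _) (lerD h1 h2).
Qed.

Lemma Re_le_normc x : complex.Re x <= normc x.
Proof.
case: x => a b /=; apply: le_trans (ler_norm a) _.
by rewrite -sqrtr_sqr ler_wsqrtr// lerDl sqr_ge0.
Qed.

Lemma normc_le_ReIm x : normc x <= `|complex.Re x| + `|complex.Im x|.
Proof.
case: x => a b /=; rewrite -(ger0_norm (addr_ge0 (normr_ge0 a) (normr_ge0 b))).
rewrite -sqrtr_sqr ler_wsqrtr// -(real_normK (num_real a)).
rewrite -(real_normK (num_real b)) sqrrD lerD2r lerDl.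
by rewrite mulrn_wge0// mulr_ge0.
Qed.

End complex_modulus.

Section poly_norm.
Context {R : realType}.
Implicit Types (P Q : {poly R[i]}) (s : R) (w z : R[i]).

(** A weighted l1 norm of the coefficients. It dominates |P| on the disc of radius s, and both
    division by X - w and control by values at roots of unity are elementary for it. *)
Definition pnorm s P : R := \sum_(k < size P) normc P`_k * s ^+ k.

Lemma pnormE s P n : (size P <= n)%N ->
  pnorm s P = \sum_(k < n) normc P`_k * s ^+ k.
Proof.
move=> Pn; rewrite /pnorm (big_ord_widen n (fun k => normc P`_k * s ^+ k))//.
rewrite big_mkcond /=; apply: eq_bigr => k _; case: ifPn => //.
by rewrite -leqNgt => Pk; rewrite nth_default// normc0 mul0r.
Qed.

Lemma pnorm_ge0 s P : 0 <= s -> 0 <= pnorm s P.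
Proof.
by move=> s0; apply: sumr_ge0 => k _; rewrite mulr_ge0 ?normc_ge0 ?exprn_ge0.
Qed.

Lemma normc_horner_le s P z : normc z <= s -> normc P.[z] <= pnorm s P.
Proof.
move=> zs; rewrite horner_coef; apply: le_trans (normc_sum _ _ _) _.
apply: ler_sum => k _; rewrite normcM normcX ler_wpM2l ?normc_ge0//.
by apply: lerXn2r; rewrite ?nnegrE ?normc_ge0// (le_trans _ zs) ?normc_ge0.
Qed.

Lemma pnormD s P Q : 0 <= s -> pnorm s (P + Q) <= pnorm s P + pnorm s Q.
Proof.
move=> s0; set n := maxn (size P) (size Q).
rewrite (pnormE s (size_polyD P Q)) !(@pnormE _ _ n) ?leq_maxl ?leq_maxr//.
rewrite -big_split; apply: ler_sum => k _ /=.
by rewrite coefD -mulrDl ler_wpM2r ?exprn_ge0// le_normcD.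
Qed.

Lemma pnormMC s P c : pnorm s (P * c%:P) = pnorm s P * normc c.
Proof.
rewrite (@pnormE s (P * c%:P) (size P)).
  rewrite /pnorm mulr_suml; apply: eq_bigr => k _.
  by rewrite coefMC normcM mulrAC.
by rewrite mulrC mul_polyC size_scale_leq.
Qed.

Lemma pnormN s P : pnorm s (- P) = pnorm s P.
Proof.
by rewrite /pnorm size_polyN; apply: eq_bigr => k _; rewrite coefN normcN.
Qed.

Lemma pnormC s c : pnorm s c%:P = normc c.
Proof.
by rewrite (@pnormE _ _ 1%N) ?size_polyC_leq1// big_ord1 coefC expr0 mulr1.
Qed.

Lemma pnormMX s P : pnorm s (P * 'X) = s * pnorm s P.
Proof.
rewrite (@pnormE _ _ (size P).+1).
  rewrite big_ord_recl coefMX eqxx normc0 mul0r add0r /pnorm mulr_sumr.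
  by apply: eq_bigr => k _; rewrite coefMX /= exprS mulrCA.
have [->|P0] := eqVneq P 0; first by rewrite mul0r size_poly0.
by rewrite size_mulX.
Qed.

(** Dividing out a root costs at most 1/(s - |w|): P X is P (X - w) plus w P, and multiplication by
    X scales [pnorm] by exactly s. *)
Lemma pnorm_mulXsubC s P w : 0 <= s ->
  (s - normc w) * pnorm s P <= pnorm s (P * ('X - w%:P)).
Proof.
move=> s0; rewrite mulrBl lerBlDr -pnormMX (mulrC (normc w)) -pnormMC.
apply: le_trans (pnormD _ _ s0).
by rewrite -mulrDr subrK.
Qed.

Lemma poly_difference_quotient P w : exists Q, P = P.[w]%:P + Q * ('X - w%:P).
Proof.
have /factor_theorem[Q PQ] : root (P - P.[w]%:P) w.
  by rewrite /root hornerD hornerN hornerC subrr.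
by exists Q; rewrite -PQ addrC subrK.
Qed.

(** One Newton step: 1 pays for P(w); the quotient is at most 2m/d at the remaining points and gets
    multiplied by |z - w| <= 2r, whence 4r/d. *)
Fixpoint interp_const (r d : R) (n : nat) : R :=
  if n is n'.+1 then 1 + 4 * r * interp_const r d n' / d else 0.

Lemma interp_const_ge0 r d n : 0 < r -> 0 < d -> 0 <= interp_const r d n.
Proof.
move=> r0 d0; elim: n => //= n ih.
by rewrite addr_ge0// divr_ge0 ?(ltW d0)// !mulr_ge0// ltW.
Qed.

(* Newton interpolation with quantitative remainder: each of the points of ws
   gains a factor 1/2, since dividing by X - w costs 1/(4r) in norm while
   |z - w| <= 2r. *)
Lemma interpolation_bound (r d m : R) (ws : seq R[i]) P :
  0 < r -> 0 < d ->
  (forall w, w \in ws -> normc w <= r /\ normc P.[w] <= m) ->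
  pairwise (fun v w => d <= normc (v - w)) ws ->
  forall z, normc z <= r ->
    normc P.[z] <= 2^-1 ^+ size ws * pnorm (9 * r) P +
      interp_const r d (size ws) * m.
Proof.
move=> r0 d0; elim: ws m P => [|w ws ih] m P hP hws z zr.
  rewrite mul0r addr0 mul1r; apply: normc_horner_le.
  by apply: le_trans zr _; lra.
have [wr Pw] := hP _ (mem_head _ _).
have m0 : 0 <= m by apply: le_trans Pw; exact: normc_ge0.
have [Q PQ] := poly_difference_quotient P w.
have hornP v : P.[v] = P.[w] + Q.[v] * (v - w).
  by rewrite {1}PQ hornerD hornerM !hornerE.
move: hws => /=/andP[/allP wws hws].
have s0 : 0 <= 9 * r by lra.
(* The radius 9r leaves 9r - |w| >= 8r, and subtracting P(w) at most doubles the norm: hence 4r. *)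
have Qn : 4 * r * pnorm (9 * r) Q <= pnorm (9 * r) P.
  have h1 := pnorm_mulXsubC Q w s0.
  have h2 : pnorm (9 * r) (Q * ('X - w%:P)) <= 2 * pnorm (9 * r) P.
    have -> : Q * ('X - w%:P) = P + - (P.[w]%:P) by rewrite [X in _ = X - _]PQ addrAC subrr add0r.
    apply: le_trans (pnormD _ _ s0) _; rewrite pnormN pnormC.
    have : normc P.[w] <= pnorm (9 * r) P.
      by apply: normc_horner_le; apply: le_trans wr _; lra.
    lra.
  have h3 := pnorm_ge0 Q s0.
  have : 8 * r * pnorm (9 * r) Q <= (9 * r - normc w) * pnorm (9 * r) Q.
    by rewrite ler_wpM2r//; lra.
  lra.
have hQ : normc Q.[z] <= 2^-1 ^+ size ws * pnorm (9 * r) Q +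
    interp_const r d (size ws) * (2 * m / d).
  apply: ih => // v vws.
  have [vr Pv] := hP v (mem_behead (s := w :: ws) vws).
  split=> //; rewrite ler_pdivlMr//.
  apply: (@le_trans _ _ (normc (Q.[v] * (v - w)))).
    rewrite normcM ler_wpM2l ?normc_ge0// normcBC; exact: wws.
  have -> : Q.[v] * (v - w) = P.[v] - P.[w] by rewrite hornP addrAC subrr add0r.
  by apply: le_trans (normcB _ _) _; lra.
rewrite hornP; apply: le_trans (le_normcD _ _) _; rewrite normcM.
have zw : normc (z - w) <= 2 * r by apply: le_trans (normcB _ _) _; lra.
have : normc Q.[z] * normc (z - w) <=
    (2^-1 ^+ size ws * pnorm (9 * r) Q +
      interp_const r d (size ws) * (2 * m / d)) * (2 * r).
  by apply: ler_pM; rewrite ?normc_ge0.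
move/le_trans => /(_ ((2^-1) ^+ size ws * (pnorm (9 * r) P / 2) +
  4 * r * interp_const r d (size ws) / d * m)) h.
change (size (w :: ws)) with (size ws).+1; rewrite exprS.
change (interp_const r d (size ws).+1) with
  (1 + 4 * r * interp_const r d (size ws) / d).
apply: (@le_trans _ _ (m + ((2^-1) ^+ size ws * (pnorm (9 * r) P / 2) +
  4 * r * interp_const r d (size ws) / d * m))).
  apply: lerD => //; apply: h.
  have : 2^-1 ^+ size ws * (4 * r * pnorm (9 * r) Q) <=
      2^-1 ^+ size ws * pnorm (9 * r) P.
    by rewrite ler_wpM2l// exprn_ge0// invr_ge0.
  set A := 2^-1 ^+ _; set I := interp_const _ _ _; set p := pnorm _ _.
  set q := pnorm _ _ => h4.
  have -> : (A * p + I * (2 * m / d)) * (2 * r) =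
    A * (4 * r * p) / 2 + 4 * r * I / d * m.
    by field; rewrite gt_eqF.
  by rewrite lerD2r mulrA; lra.
move: (_ ^+ _) (interp_const _ _ _) => A I.
by rewrite le_eqVlt; apply/orP; left; apply/eqP; field; rewrite gt_eqF.
Qed.

(** X^n - 1 splits and is separable, so it has n distinct roots, enough for one of them to be
    primitive. *)
Lemma prim_root_complex n : (0 < n)%N -> exists w : R[i], n.-primitive_root w.
Proof.
move=> n_gt0; pose p : {poly R[i]} := 'X^n - 1.
have [r Dp] := closed_field_poly_normal p.
rewrite (monicP _) ?monicXnsubC // scale1r in Dp.
have rn1 : all n.-unity_root r by apply/allP=> z; rewrite -root_prod_XsubC -Dp.
have sz_r : (n < (size r).+1)%N.
  by rewrite -(size_prod_XsubC r id) -Dp size_XnsubC.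
have [|z] := hasP (cyclic.has_prim_root n_gt0 rn1 _ sz_r); last by exists z.
by rewrite -separable_prod_XsubC -Dp separable_Xn_sub_1 // pnatr_eq0 -lt0n.
Qed.

Lemma normc_prim_root n w : (0 < n)%N -> n.-primitive_root w -> normc w = 1.
Proof.
move=> n0 /prim_expr_order /(congr1 (@normc R)); rewrite normcX normc1 => /eqP.
by rewrite pexpr_eq1 ?normc_ge0// => /eqP.
Qed.

Lemma sum_prim_root n (w : R[i]) m : (0 < n)%N -> n.-primitive_root w ->
  \sum_(j < n) w ^+ (j * m) = if (n %| m)%N then n%:R else 0.
Proof.
move=> n0 pw; under eq_bigr do rewrite mulnC exprM.
case: ifPn => nm.
  move: nm; rewrite (prim_order_dvd pw) => /eqP ->.
  by under eq_bigr do rewrite expr1n; rewrite sumr_const card_ord.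
rewrite (prim_order_dvd pw) -subr_eq0 in nm.
by apply: (mulfI nm); rewrite -subrX1 exprAC (prim_expr_order pw) expr1n subrr mulr0.
Qed.

(** Averaging P(s w^j) against w^(-jk) isolates the k-th coefficient. The exponent is written n - k
    to stay a natural number, and size P <= n excludes aliasing. *)
Lemma cauchy_estimate n (w : R[i]) s P (k : 'I_n) : (0 < n)%N ->
  n.-primitive_root w -> 0 <= s -> (size P <= n)%N ->
  normc P`_k * s ^+ k <= n%:R^-1 * \sum_(j < n) normc P.[s%:C * w ^+ j].
Proof.
move=> n0 pw s0 Pn.
have E : \sum_(j < n) P.[s%:C * w ^+ j] * w ^+ (j * (n - k)) =
    n%:R * (P`_k * s%:C ^+ k).
  under eq_bigr => j _.
    rewrite (horner_coef_wide _ Pn) mulr_suml.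
    under eq_bigr => l _ do
      rewrite exprMn -exprM -mulrA -mulrA -exprD -mulnDr (mulrA P`_l).
    over.
  rewrite exchange_big /=.
  under eq_bigr => l _ do rewrite -mulr_sumr (sum_prim_root _ n0 pw).
  rewrite (bigD1 k)//= big1 ?addr0.
    by rewrite subnKC ?dvdnn 1?mulrC// ltnW.
  move=> l /eqP lk; rewrite ifF ?mulr0//; apply/negP => /dvdnP[q].
  have := ltn_ord l; have := ltn_ord k => kn ln e; apply: lk; apply: val_inj => /=.
  (* n divides l + n - k with l, k < n: the quotient 0 or at least 2 is out of range, and 1 means l
     = k. *)
  case: q e => [|[|q]]; nia.
have n1 : 0 < n%:R :> R by rewrite ltr0n.
rewrite -(ler_pM2l n1) mulVKf ?gt_eqF//.
have -> : n%:R * (normc P`_k * s ^+ k) = normc (n%:R * (P`_k * s%:C ^+ k)).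
  rewrite !normcM normcX normc_real ger0_norm//.
  by rewrite -(rmorph_nat (real_complex R)) normc_real ger0_norm// ltW.
rewrite -E; apply: le_trans (normc_sum _ _ _) _; apply: ler_sum => j _.
by rewrite normcM normcX (normc_prim_root n0 pw) expr1n mulr1.
Qed.

Lemma sum_half_le n : \sum_(k < n) (2^-1 : R) ^+ k <= 2.
Proof.
suff -> : \sum_(k < n) (2^-1 : R) ^+ k = 2 - 2 * 2^-1 ^+ n.
  by rewrite lerBlDr lerDl mulr_ge0// exprn_ge0.
elim: n => [|n ih]; first by rewrite big_ord0 expr0 mulr1 subrr.
by rewrite big_ord_recr /= ih exprS; field.
Qed.

(** Halving the radius turns the uniform coefficient bound into a geometric series. This is why
    circle means are taken at 18r while the interpolation uses 9r. *)
Lemma pnorm_half_le n (w : R[i]) s P : (0 < n)%N ->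
  n.-primitive_root w -> 0 <= s -> (size P <= n)%N ->
  pnorm (s / 2) P <= 2 * (n%:R^-1 * \sum_(j < n) normc P.[s%:C * w ^+ j]).
Proof.
move=> n0 pw s0 Pn; rewrite (pnormE _ Pn).
set A := n%:R^-1 * _.
have A0 : 0 <= A.
  by rewrite mulr_ge0 ?invr_ge0// sumr_ge0// => j _; rewrite normc_ge0.
apply: (@le_trans _ _ (\sum_(k < n) A * 2^-1 ^+ k)).
  apply: ler_sum => k _; rewrite exprMn mulrA ler_wpM2r ?exprn_ge0//.
  exact: cauchy_estimate.
by rewrite -mulr_sumr mulrC ler_wpM2r// sum_half_le.
Qed.

End poly_norm.

(** * Schwartz functions built from Gaussians and exponentials *)

Section complex_derivative.
Context {R : realType}.
Implicit Types (f g : R -> R[i]).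

(** A relation, so that derivatives can be given in closed form; [cderive1E] returns to the operator
    of the Schwartz seminorms. *)
Definition cder f g := forall t : R,
  is_derive t 1 (fun s => complex.Re (f s)) (complex.Re (g t)) /\
  is_derive t 1 (fun s => complex.Im (f s)) (complex.Im (g t)).

Lemma cderive1E f g : cder f g -> cderive1 f = g.
Proof.
move=> fg; apply/funext => t; have [[dr er] [di ei]] := fg t.
by rewrite /cderive1 !derive1E er ei; case: (g t).
Qed.

Lemma cder_eq f g h : cder f g -> (forall t, g t = h t) -> cder f h.
Proof. by move=> fg gh; have <- : g = h by exact/funext. Qed.

Lemma cderD f f' g g' : cder f f' -> cder g g' ->
  cder (fun t => f t + g t) (fun t => f' t + g' t).
Proof.
move=> df dg t; have [fr fi] := df t; have [gr gi] := dg t.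
have ReD (x y : R[i]) : complex.Re (x + y) = complex.Re x + complex.Re y.
  by case: x y => [? ?] [].
have ImD (x y : R[i]) : complex.Im (x + y) = complex.Im x + complex.Im y.
  by case: x y => [? ?] [].
split.
  under eq_fun do rewrite ReD.
  by rewrite ReD; exact: is_deriveD.
under eq_fun do rewrite ImD.
by rewrite ImD; exact: is_deriveD.
Qed.

Lemma cderM f f' g g' : cder f f' -> cder g g' ->
  cder (fun t => f t * g t) (fun t => f' t * g t + f t * g' t).
Proof.
move=> df dg t; have [fr fi] := df t; have [gr gi] := dg t.
have ReM (x y : R[i]) : complex.Re (x * y) =
    complex.Re x * complex.Re y - complex.Im x * complex.Im y.
  by case: x y => [? ?] [].
have ImM (x y : R[i]) : complex.Im (x * y) =
    complex.Re x * complex.Im y + complex.Im x * complex.Re y.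
  by case: x y => [? ?] [].
split.
  under eq_fun do rewrite ReM.
  apply: is_derive_eq; case: (f t) (f' t) (g t) (g' t).
  by move=> a b [a' b'] [c d] [c' d'] /=; rewrite /GRing.scale /=; ring.
under eq_fun do rewrite ImM.
apply: is_derive_eq; case: (f t) (f' t) (g t) (g' t).
by move=> a b [a' b'] [c d] [c' d'] /=; rewrite /GRing.scale /=; ring.
Qed.

Lemma cder_cst (c : R[i]) : cder (fun=> c) (fun=> 0).
Proof. by move=> t; split; exact: is_derive_cst. Qed.

Lemma cderZ c f f' : cder f f' -> cder (fun t => c * f t) (fun t => c * f' t).
Proof.
move=> /(cderM (cder_cst c)) df; apply: cder_eq df _ => t.
by rewrite mul0r add0r.
Qed.

Lemma cder_id : cder (fun t => t%:C) (fun=> 1).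
Proof. by move=> t; split; [exact: is_derive_id | exact: is_derive_cst]. Qed.

Lemma cder_shift f f' (x : R) : cder f f' ->
  cder (fun t => f (t - x)) (fun t => f' (t - x)).
Proof.
move=> df t; have [fr fi] := df (t - x).
have dx : is_derive t 1 (fun s : R => s - x) 1.
  by apply: is_derive_eq; rewrite subr0.
split.
  have := @is_derive1_comp _ (fun s => complex.Re (f s)) (fun s => s - x) t _ _ fr dx.
  by rewrite mulr1.
have := @is_derive1_comp _ (fun s => complex.Im (f s)) (fun s => s - x) t _ _ fi dx.
by rewrite mulr1.
Qed.

Lemma cder_horner (p : {poly R[i]}) :
  cder (fun t => p.[t%:C]) (fun t => p^`().[t%:C]).
Proof.
elim/poly_ind: p => [|p c ih].
  have -> : (fun t : R => (0 : {poly R[i]}).[t%:C]) = (fun=> 0).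
    by apply/funext => t; rewrite horner0.
  by apply: cder_eq (cder_cst 0) _ => t; rewrite deriv0 horner0.
have -> : (fun t : R => (p * 'X + c%:P).[t%:C]) =
    (fun t => p.[t%:C] * t%:C + c).
  by apply/funext => t; rewrite hornerD hornerMX hornerC.
apply: cder_eq (cderD (cderM ih cder_id) (cder_cst c)) _ => t.
by rewrite derivD derivM derivX derivC !addr0 !mulr1 hornerD hornerMX.
Qed.

Definition cis (a : R) : R[i] := cos a +i* sin a.

Definition cexp (c : R[i]) (t : R) : R[i] :=
  (expR (complex.Re c * t))%:C * cis (complex.Im c * t).

Lemma normc_cis a : normc (cis a) = 1.
Proof. by rewrite /normc /cis cos2Dsin2 sqrtr1. Qed.

Lemma normc_cexp c t : normc (cexp c t) = expR (complex.Re c * t).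
Proof.
by rewrite normcM normc_cis mulr1 normc_real ger0_norm// expR_ge0.
Qed.

Lemma cisD a b : cis (a + b) = cis a * cis b.
Proof.
rewrite /cis cosD sinD; apply/eqP; rewrite eq_complex /= eqxx /=.
by apply/eqP; ring.
Qed.

Lemma cder_cexp c : cder (cexp c) (fun t => c * cexp c t).
Proof.
case: c => a b t; rewrite /cexp /cis.
have da : is_derive t 1 (fun s : R => a * s) a.
  by apply: is_derive_eq; rewrite /GRing.scale /= mulr1.
have db : is_derive t 1 (fun s : R => b * s) b.
  by apply: is_derive_eq; rewrite /GRing.scale /= mulr1.
have de : is_derive t 1 (fun s : R => expR (a * s)) (expR (a * t) * a).
  exact: (@is_derive1_comp _ expR _ t _ _ (is_derive_expR (a * t)) da).
have dc : is_derive t 1 (fun s : R => cos (b * s)) (- sin (b * t) * b).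
  exact: (@is_derive1_comp _ cos _ t _ _ (is_derive_cos (b * t)) db).
have ds : is_derive t 1 (fun s : R => sin (b * s)) (cos (b * t) * b).
  exact: (@is_derive1_comp _ sin _ t _ _ (is_derive_sin (b * t)) db).
split.
  rewrite [X in is_derive _ _ X _](_ : _ =
      (fun s => expR (a * s)) * (fun s => cos (b * s))).
    by apply: is_derive_eq; rewrite /GRing.scale /=; ring.
  by apply/funext => s /=; rewrite mul0r subr0.
rewrite [X in is_derive _ _ X _](_ : _ =
    (fun s => expR (a * s)) * (fun s => sin (b * s))).
  by apply: is_derive_eq; rewrite /GRing.scale /=; ring.
by apply/funext => s /=; rewrite mul0r addr0.
Qed.

(** A mean value inequality for complex values: f(t) is rotated onto the positive half-line by a
    unimodular u, and the real mean value theorem is applied to B - Re(u f). *)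
Lemma cder_growth_le f f' (B B' : R -> R) : cder f f' ->
  (forall t : R, is_derive t 1 B (B' t)) -> normc (f 0) <= B 0 ->
  (forall t, 0 <= t -> normc (f' t) <= B' t) ->
  forall t, 0 <= t -> normc (f t) <= B t.
Proof.
move=> df dB f0 f'B t; rewrite le_eqVlt => /predU1P[<-//|t0].
(* At a zero of f there is no phase to rotate by; it remains to see that B stays nonnegative. *)
have [ft0|ftN0] := eqVneq (f t) 0.
  rewrite ft0 normc0.
  have cB : {within `[0, t], continuous B}.
    apply: derivable_within_continuous => s _.
    exact: (@ex_derive _ _ _ _ _ _ _ (dB s)).
  have [c c0t] := @MVT _ B B' 0 t t0 (fun x _ => dB x) cB.
  move/eqP; rewrite subr_eq => /eqP ->; rewrite addr_ge0//.
    rewrite subr0 mulr_ge0 ?(ltW t0)//.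
    apply: le_trans (f'B _ _); first exact: normc_ge0.
    by move: c0t; rewrite in_itv /= => /andP[/ltW].
  by apply: le_trans f0; exact: normc_ge0.
pose u := conjc (f t) / (normc (f t))%:C.
have nf0 : normc (f t) != 0 by apply: contra ftN0 => /eqP/eq0_normc ->.
have nu : normc u = 1.
  rewrite normcM normc_conjc normcV normc_real ger0_norm ?normc_ge0//.
  by rewrite divff.
have uft : complex.Re (u * f t) = normc (f t).
  rewrite /u mulrAC (mulrC (conjc _)).
  have -> : f t * conjc (f t) = (normc (f t) ^+ 2)%:C.
    case: (f t) => a b; rewrite /normc /= sqr_sqrtr ?addr_ge0 ?sqr_ge0//.
    by apply/eqP; rewrite eq_complex /=; apply/andP; split; apply/eqP; ring.
  by rewrite -fmorphV -rmorphM /= expr2 mulfK.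
pose h (s : R) := B s - complex.Re (u * f s).
have dh (s : R) : is_derive s 1 h (B' s - complex.Re (u * f' s)).
  have [hr _] := cderZ u df s.
  exact: is_deriveB.
have ch : {within `[0, t], continuous h}.
  apply: derivable_within_continuous => s _.
  exact: (@ex_derive _ _ _ _ _ _ _ (dh s)).
have [c c0t] := @MVT _ h _ 0 t t0 (fun x _ => dh x) ch.
rewrite subr0 => e.
have c0 : 0 <= c by move: c0t; rewrite in_itv /= => /andP[/ltW].
have : 0 <= h t - h 0.
  rewrite e mulr_ge0 ?(ltW t0)// subr_ge0.
  apply: le_trans (f'B _ c0); apply: le_trans (Re_le_normc _) _.
  by rewrite normcM nu mul1r.
rewrite /h uft subr_ge0 => h1.
have : complex.Re (u * f 0) <= B 0.
  by apply: le_trans f0; apply: le_trans (Re_le_normc _) _; rewrite normcM nu mul1r.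
lra.
Qed.

Definition exp_taylor (c : R[i]) (n : nat) : {poly R[i]} :=
  \poly_(k < n) (c ^+ k / k`!%:R).

Definition cexp_tail (n : nat) (c : R[i]) (t : R) : R[i] :=
  cexp c t - (exp_taylor c n).[t%:C].

Lemma exp_taylorS c n : exp_taylor c n.+1 =
  exp_taylor c n + (c ^+ n / n`!%:R) *: 'X^n.
Proof. by rewrite /exp_taylor !poly_def big_ord_recr. Qed.

Lemma cexp_tail0 c t : cexp_tail 0 c t = cexp c t.
Proof. by rewrite /cexp_tail /exp_taylor poly_def big_ord0 horner0 subr0. Qed.

Lemma cexp_tailS n c t :
  cexp_tail n c t = c ^+ n * (t%:C ^+ n / n`!%:R) + cexp_tail n.+1 c t.
Proof.
rewrite /cexp_tail exp_taylorS hornerD hornerZ hornerXn.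
rewrite (mulrC (t%:C ^+ n)) mulrA opprD addrA [RHS]addrC.
by rewrite (addrC _ (cexp c t)) addrACA addNr addr0 addrC.
Qed.

Lemma deriv_exp_taylor c n : (exp_taylor c n)^`() = c *: exp_taylor c n.-1.
Proof.
apply/polyP => k; rewrite coef_deriv coefZ !coef_poly.
case: n => [|n] /=; first by rewrite mul0rn mulr0.
rewrite ltnS; case: ifP => _; last by rewrite mul0rn mulr0.
rewrite factS exprS -[LHS]mulr_natr natrM invfM -!mulrA; do 2 congr (_ * _).
by rewrite mulrCA mulVf ?mulr1// pnatr_eq0.
Qed.

Lemma cder_cexp_tail n c :
  cder (cexp_tail n c) (fun t => c * cexp_tail n.-1 c t).
Proof.
have := cderD (cder_cexp c) (cderZ (-1) (cder_horner (exp_taylor c n))).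
rewrite (_ : (fun t => _ + _) = cexp_tail n c); last first.
  by apply/funext => t; rewrite mulN1r.
move/cder_eq; apply => t.
by rewrite deriv_exp_taylor hornerZ mulN1r -mulrBr.
Qed.

Lemma cexp0 c : cexp c 0 = 1.
Proof. by rewrite /cexp /cis !mulr0 expR0 cos0 sin0 mul1r. Qed.

Lemma cexp_tail_at0 n c : (0 < n)%N -> cexp_tail n c 0 = 0.
Proof.
case: n => // n _; rewrite /cexp_tail cexp0.
rewrite horner_coef0 /exp_taylor coef_poly /= expr0 fact0 invr1 mulr1.
by rewrite subrr.
Qed.

(** Induction on n: the derivative of a tail is c times the tail of the preceding order. The rate
    2|c|, twice the natural one, makes each integration gain a factor 1/2. *)
Lemma normc_cexp_tail_le n c t :
  normc (cexp_tail n c t) <= 2^-1 ^+ n * expR (2 * normc c * `|t|).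
Proof.
(* The tail depends only on the product c t, so both signs can be flipped. *)
wlog t0 : c t / 0 <= t.
  move=> wh; have [|t0] := leP 0 t; first exact: wh.
  have -> : cexp_tail n c t = cexp_tail n (- c) (- t).
    rewrite /cexp_tail; congr (_ - _).
      by case: c => a b; rewrite /cexp /= !mulrNN.
    rewrite /exp_taylor !horner_poly; apply: eq_bigr => k _.
    by rewrite rmorphN /= ![_ / _ * _]mulrAC -!exprMn mulrNN.
  by rewrite -(normcN c) -(normrN t); apply: wh; rewrite oppr_ge0 ltW.
rewrite ger0_norm//; elim: n t t0 => [|n ih] t t0.
  rewrite expr0 mul1r cexp_tail0 normc_cexp ler_expR ler_wpM2r//.
  have := Re_le_normc c; have := normc_ge0 c; lra.
pose B (t : R) := 2^-1 ^+ n.+1 * expR (2 * normc c * t).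
pose B' (t : R) := 2^-1 ^+ n * normc c * expR (2 * normc c * t).
apply: (@cder_growth_le _ _ B B' (cder_cexp_tail n.+1 c)) => //.
- move=> s; have ds : is_derive s 1 (fun s : R => 2 * normc c * s) (2 * normc c).
    by apply: is_derive_eq; rewrite /GRing.scale /= mulr1.
  have de := @is_derive1_comp _ expR _ s _ _ (is_derive_expR (2 * normc c * s)) ds.
  have := @is_deriveZ _ _ _ _ (2^-1 ^+ n.+1) _ _ _ de.
  move/is_derive_eq; apply; rewrite /B' exprS /GRing.scale /=; lra.
- by rewrite cexp_tail_at0// normc0 mulr_ge0 ?exprn_ge0 ?expR_ge0.
- move=> s s0 /=; rewrite normcM /B' mulrAC mulrC ler_wpM2r ?normc_ge0//.
  exact: ih.
Qed.

End complex_derivative.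

Section schwartz_classes.
Context {R : realType}.
Implicit Types (u v g : R -> R[i]) (K : (R -> R[i]) -> Prop).

Lemma iter_cderive1_class K :
  (forall u, K u -> exists2 v, K v & cder u v) ->
  forall n u, K u -> K (iter n (@cderive1 R) u).
Proof.
move=> Kd; elim=> [//|n ih] u Ku /=.
by have [v Kv /cderive1E ->] := Kd _ (ih _ Ku).
Qed.

Lemma smooth_class K :
  (forall u, K u -> exists2 v, K v & cder u v) -> forall u, K u -> smooth u.
Proof.
move=> Kd u Ku n t.
have [v Kv uv] := Kd _ (iter_cderive1_class Kd n Ku).
by have [[? _] [? _]] := uv t.
Qed.

Lemma schwartz_seminorm_le k n g (C : R) :
  (forall t, `|t| ^+ k * normc (iter n (@cderive1 R) g t) <= C) ->
  (schwartz_seminorm k n g <= C%:E)%E.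
Proof. by move=> gC; apply: ge_ereal_sup => _ [t _ <-]; rewrite lee_fin. Qed.

(** Iterated derivatives of members of K stay in K, so every Schwartz seminorm is a moment bound for
    some member of K. *)
Lemma schwartz_class K :
  (forall u, K u -> exists2 v, K v & cder u v) ->
  (forall u, K u -> forall a, exists C : R, forall t, `|t| ^+ a * normc (u t) <= C) ->
  forall u, K u -> schwartz u.
Proof.
move=> Kd Kb u Ku; split; first exact: smooth_class Ku.
move=> k n; have [C uC] := Kb _ (iter_cderive1_class Kd n Ku) k.
by apply: le_lt_trans (schwartz_seminorm_le uC) _; rewrite ltry.
Qed.

End schwartz_classes.

(** * Taylor tails of exponentials against shifted Gaussians *)

Section gaussian_shift.
Context {R : realType}.
Implicit Types (z : R * R) (c : R[i]) (p : {poly R[i]}).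

(** The conjugate of [tf_shift z] applied to the Gaussian, that is, the test function that [stft]
    feeds to the distribution. *)
Definition gauss_shift z (t : R) : R[i] :=
  cexp (0 -i* (2 * pi * z.2)) t * gaussian (t - z.1).

Lemma normc_gaussian t : normc (gaussian t) = 2 `^ 4^-1 * expR (- (pi * t ^+ 2)) :> R.
Proof.
by rewrite normc_real ger0_norm// mulr_ge0 ?powR_ge0 ?expR_ge0.
Qed.

Lemma normc_gauss_shift z t : normc (gauss_shift z t) =
  2 `^ 4^-1 * expR (- (pi * (t - z.1) ^+ 2)).
Proof. by rewrite /gauss_shift normcM normc_cexp normc_gaussian /= mul0r expR0 mul1r. Qed.

Lemma cder_gaussian :
  cder (@gaussian R) (fun t => (- (2 * pi * t))%:C * gaussian t).
Proof.
move=> t; rewrite /gaussian; split; last first.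
  by rewrite /= mulr0 mul0r addr0; exact: is_derive_cst.
rewrite /= mul0r subr0.
have d2 : is_derive t 1 (fun s : R => - (pi * s ^+ 2)) (- (2 * pi * t)).
  apply: is_derive_eq; rewrite /GRing.scale /= !mulr1; ring.
have de := @is_derive1_comp _ expR _ t _ _ (is_derive_expR (- (pi * t ^+ 2))) d2.
have := @is_deriveZ _ _ _ _ (2 `^ 4^-1 : R) _ _ _ de.
move/is_derive_eq; apply; rewrite /GRing.scale /=; ring.
Qed.

(** The logarithmic derivative of [gauss_shift z]. *)
Definition gauss_shift_log z : {poly R[i]} :=
  (0 -i* (2 * pi * z.2))%:P - (2 * pi)%:C *: ('X - (z.1)%:C%:P).

Lemma cder_gauss_shift z :
  cder (gauss_shift z) (fun t => (gauss_shift_log z).[t%:C] * gauss_shift z t).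
Proof.
have := cderM (cder_cexp (0 -i* (2 * pi * z.2))) (cder_shift z.1 cder_gaussian).
move/cder_eq; apply => t.
rewrite /gauss_shift_log hornerD hornerN hornerZ hornerD hornerN !hornerC hornerX.
rewrite -rmorphB /= /gauss_shift.
set a := (_ -i* _); set e := cexp _ _; set g := gaussian _.
have -> : (- (2 * pi * (t - z.1)))%:C = - ((2 * pi)%:C * (t - z.1)%:C).
  by apply/eqP; rewrite eq_complex /=; apply/andP; split; apply/eqP; ring.
by ring.
Qed.

Lemma pow_le_expR (x : R) n : 0 <= x -> x ^+ n <= n`!%:R * expR x.
Proof.
move=> x0; rewrite -ler_pdivrMl ?ltr0n ?fact_gt0// mulrC.
case: n => [|n]; first by rewrite expr0 fact0 divr1 -expR0 ler_expR.
by apply: le_trans (expR_ge1Dxn n x0); rewrite lerDr.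
Qed.

Lemma poly_le_expR p a : exists2 C : R, 0 <= C &
  forall t : R, `|t| ^+ a * normc p.[t%:C] <= C * expR `|t|.
Proof.
exists (\sum_(k < size p) normc p`_k * (a + k)`!%:R).
  by apply: sumr_ge0 => k _; rewrite mulr_ge0 ?normc_ge0.
move=> t; rewrite horner_coef; apply: (@le_trans _ _
    (`|t| ^+ a * \sum_(k < size p) normc (p`_k * t%:C ^+ k))).
  by rewrite ler_wpM2l ?exprn_ge0// normc_sum.
rewrite mulr_sumr mulr_suml; apply: ler_sum => k _.
rewrite normcM normcX normc_real mulrCA -exprD -mulrA.
by rewrite ler_wpM2l ?normc_ge0// pow_le_expR.
Qed.

(** With y = |t - x| and |t| <= |x| + y, completing the square in (1 + b) y - pi y^2, where pi >= 1,
    gives the bound. *)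
Lemma gauss_absorb (b x t : R) : 0 <= b ->
  expR `|t| * (expR (b * `|t - x|) * expR (- (pi * (t - x) ^+ 2))) <=
    expR (`|x| + (1 + b) ^+ 2).
Proof.
move=> b0; rewrite -!expRD ler_expR.
have h1 : `|t| <= `|t - x| + `|x| by rewrite -{1}(subrK x t) ler_normD.
rewrite -[(t - x) ^+ 2]real_normK ?num_real//.
move: h1; set y := `|t - x| => h1.
have pi1 := @pi_ge2 R.
have : 0 <= (pi - 1) * y ^+ 2 by rewrite mulr_ge0 ?sqr_ge0//; lra.
have : 0 <= (y - (1 + b) / 2) ^+ 2 by exact: sqr_ge0.
have : 0 <= (1 + b) ^+ 2 by exact: sqr_ge0.
nra.
Qed.

(* Families indexed by the order n of the Taylor tail and the exponent c: stable
   under differentiation in t, and tending to 0 with all derivatives, uniformly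
   for bounded c, as n grows. *)
Inductive tail_span z : (nat -> R[i] -> R -> R[i]) -> Prop :=
| tail_span_base p i : tail_span z (fun n c t =>
    p.[t%:C] * (cexp_tail (n - i) c (t - z.1) * gauss_shift z t))
| tail_span_add U V : tail_span z U -> tail_span z V ->
    tail_span z (fun n c t => U n c t + V n c t)
| tail_span_scale U : tail_span z U ->
    tail_span z (fun n c t => c * U n c t).

(** Differentiating a tail lowers its order by one and brings out a factor c: this is the origin of
    the index i and of the closure under multiplication by c in [tail_span]. *)
Lemma tail_span_cder z U : tail_span z U ->
  exists2 V, tail_span z V & forall n c, cder (U n c) (V n c).
Proof.
elim=> [p i|U1 U2 _ [V1 s1 d1] _ [V2 s2 d2]|U1 _ [V1 s1 d1]].
- exists (fun n c t => (p^`() + p * gauss_shift_log z).[t%:C] *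
      (cexp_tail (n - i) c (t - z.1) * gauss_shift z t) +
      c * (p.[t%:C] * (cexp_tail (n - i.+1) c (t - z.1) * gauss_shift z t))).
    apply: tail_span_add; first exact: tail_span_base.
    by apply: tail_span_scale; exact: tail_span_base.
  move=> n c; have := cderM (cder_horner p)
    (cderM (cder_shift z.1 (cder_cexp_tail (n - i) c)) (cder_gauss_shift z)).
  move/cder_eq; apply => t; rewrite -subnS hornerD hornerM.
  set P := p.[_]; set P' := p^`().[_]; set L := (gauss_shift_log z).[_].
  by move: (cexp_tail _ _ _) (cexp_tail _ _ _) (gauss_shift _ _) => A B G; ring.
- exists (fun n c t => V1 n c t + V2 n c t); first exact: tail_span_add.
  by move=> n c; exact: cderD.
- exists (fun n c t => c * V1 n c t); first exact: tail_span_scale.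
  by move=> n c; exact: cderZ.
Qed.

Lemma tail_span_bound z U (s : R) a : tail_span z U ->
  exists2 C : R, 0 <= C & forall n c t, normc c <= s ->
    `|t| ^+ a * normc (U n c t) <= C * 2^-1 ^+ n.
Proof.
have [s0 _|s0] := ltP s 0.
  exists 0 => // n c t cs; have := lt_le_trans s0 (normc_ge0 c).
  by move/(le_lt_trans cs); rewrite ltxx.
elim=> [p i|U1 U2 _ [C1 c10 h1] _ [C2 c20 h2]|U1 _ [C1 c10 h1]].
- have [C C0 hC] := poly_le_expR p a.
  set D : R := 2 `^ 4^-1 * expR (`|z.1| + (1 + 2 * s) ^+ 2).
  have D0 : 0 <= D by rewrite mulr_ge0 ?powR_ge0 ?expR_ge0.
  (* 2^i pays for the lowered order n - i; it also covers n < i, where the truncated difference is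
     0. *)
  exists (C * D * 2 ^+ i).
    by rewrite !mulr_ge0 ?exprn_ge0.
  move=> n c t cs; rewrite normcM mulrA.
  apply: (@le_trans _ _ (C * expR `|t| * (2^-1 ^+ (n - i) *
      expR (2 * s * `|t - z.1|) *
      (2 `^ 4^-1 * expR (- (pi * (t - z.1) ^+ 2)))))).
    apply: ler_pM; rewrite ?normc_ge0 ?mulr_ge0 ?exprn_ge0 ?normc_ge0//.
    rewrite normcM normc_gauss_shift ler_wpM2r ?mulr_ge0 ?powR_ge0 ?expR_ge0//.
    apply: le_trans (normc_cexp_tail_le _ _ _) _.
    rewrite ler_wpM2l ?exprn_ge0// ler_expR ler_wpM2r//.
    by rewrite ler_wpM2l.
  have -> : C * expR `|t| * (2^-1 ^+ (n - i) *
      expR (2 * s * `|t - z.1|) *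
      (2 `^ 4^-1 * expR (- (pi * (t - z.1) ^+ 2)))) =
    (C * 2^-1 ^+ (n - i)) * (2 `^ 4^-1 * (expR `|t| *
      (expR (2 * s * `|t - z.1|) * expR (- (pi * (t - z.1) ^+ 2))))).
    move: (_ ^+ (n - i)) (expR _) (expR _) (expR _) (2 `^ _) => ? ? ? ? ?; ring.
  have -> : C * D * 2 ^+ i * 2^-1 ^+ n = C * (2 ^+ i * 2^-1 ^+ n) * D by ring.
  apply: ler_pM; rewrite ?mulr_ge0 ?exprn_ge0 ?powR_ge0 ?expR_ge0//.
    rewrite ler_wpM2l// exprVn; have [ni|ni] := leqP n i.
      rewrite (eqP ni) expr0 invr1 -(subnKC ni) exprD mulrAC.
      by rewrite exprVn divff ?mul1r ?expf_neq0// exprn_ege1// ler1n.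
    have nE : n = (i + (n - i))%N by rewrite subnKC// ltnW.
    by rewrite {2}nE exprVn exprD invfM mulrA divff ?mul1r// expf_neq0.
  rewrite ler_wpM2l ?powR_ge0//; apply: gauss_absorb.
  by rewrite mulr_ge0.
- exists (C1 + C2); first exact: addr_ge0.
  move=> n c t cs; rewrite mulrDl; apply: le_trans (lerD (h1 n c t cs) (h2 n c t cs)).
  by rewrite -mulrDr ler_wpM2l ?exprn_ge0// le_normcD.
- exists (s * C1); first exact: mulr_ge0.
  move=> n c t cs; rewrite normcM mulrCA -mulrA; apply: ler_pM.
  - exact: normc_ge0.
  - by rewrite mulr_ge0 ?exprn_ge0 ?normc_ge0.
  - exact: cs.
  - exact: h1.
Qed.

Lemma tail_span_iter z U k : tail_span z U ->
  exists2 V, tail_span z V &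
    forall n c, iter k (@cderive1 R) (U n c) = V n c.
Proof.
move=> sU; elim: k => [|k [V sV UV]]; first by exists U.
have [W sW VW] := tail_span_cder sV.
by exists W => // n c; rewrite iterS UV (cderive1E (VW n c)).
Qed.

Lemma tail_span_schwartz z U n c : tail_span z U -> schwartz (U n c).
Proof.
move=> sU; apply: (@schwartz_class _ (fun u => exists2 U, tail_span z U & u = U n c)).
- move=> _ [V sV ->]; have [W sW VW] := tail_span_cder sV.
  by exists (W n c) => //; exists W.
- move=> _ [V sV ->] a; have [C C0 hC] := tail_span_bound (normc c) a sV.
  by exists (C * 2^-1 ^+ n) => t; exact: hC.
- by exists U.
Qed.

Lemma schwartz_cexp_tail z n c :
  schwartz (fun t => cexp_tail n c (t - z.1) * gauss_shift z t).
Proof.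
have := tail_span_schwartz n c (tail_span_base z 1 0).
by under eq_fun do rewrite hornerC mul1r subn0.
Qed.

Lemma schwartz_poly_gauss z p : schwartz (fun t => p.[t%:C] * gauss_shift z t).
Proof.
have := tail_span_schwartz 0 0 (tail_span_base z p 0).
under eq_fun do rewrite cexp_tail0 /cexp /cis !mul0r expR0 cos0 sin0 !mul1r.
by [].
Qed.

End gaussian_shift.

(** * Pointwise estimates for the Gabor transform *)

Section tempered.
Context {R : realType} (f : (R -> R[i]) -> R[i]).
Hypothesis f_tempered : tempered_distribution f.
Implicit Types (z : R * R) (c : R[i]).

Lemma tempered_scale (a : R[i]) g : schwartz g -> f (fun t => a * g t) = a * f g.
Proof.
(* Linearity comes in the form a g + h; writing a g as (a - 1) g + g avoids evaluating f at 0
   first. *)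
move=> sg; have := f_tempered.1 (a - 1) g g sg sg.
under eq_fun do rewrite mulrBl mul1r subrK.
by rewrite mulrBl mul1r subrK.
Qed.

Lemma tempered_add (a : R[i]) g h : schwartz g -> schwartz h ->
  f (fun t => a * g t + h t) = a * f g + f h.
Proof. exact: f_tempered.1. Qed.

(** Continuity of f at 0 involves finitely many seminorms, and in each of them the tails decay like
    2^-n uniformly for |c| <= s. *)
Lemma tempered_tail_cvg0 z (s e : R) : 0 < e -> exists n : nat,
  forall c, normc c <= s ->
    normc (f (fun t => cexp_tail n c (t - z.1) * gauss_shift z t)) <= e.
Proof.
move=> e0; have s0 := schwartz_poly_gauss z 0.
have z0 : (fun t : R => (0 : {poly R[i]}).[t%:C] * gauss_shift z t) = (fun=> 0).
  by apply/funext => t; rewrite horner0 mul0r.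
rewrite z0 in s0; have f0 : f (fun=> 0) = 0.
  have := tempered_scale 0 s0; under eq_fun do rewrite mul0r.
  by rewrite mul0r.
have [N [d [d0 hd]]] := f_tempered.2 _ s0 e e0.
pose U := (fun n c t => (1 : {poly R[i]}).[t%:C] *
    (cexp_tail (n - 0) c (t - z.1) * gauss_shift z t)).
have sU : tail_span z U by exact: tail_span_base.
have [C C0 hC] : exists2 C : R, 0 <= C & forall k j, (k <= N)%N -> (j <= N)%N ->
    forall n c t, normc c <= s ->
    `|t| ^+ k * normc (iter j (@cderive1 R) (U n c) t) <= C * 2^-1 ^+ n.
  have B k j : exists2 C : R, 0 <= C & forall n c t, normc c <= s ->
      `|t| ^+ k * normc (iter j (@cderive1 R) (U n c) t) <= C * 2^-1 ^+ n.
    have [V sV UV] := tail_span_iter j sU.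
    have [C C0 hC] := tail_span_bound s k sV.
    by exists C => // n c t cs; rewrite UV; exact: hC.
  pose b k j := projT1 (cid2 (B k j)).
  have b0 k j : 0 <= b k j by rewrite /b; case: cid2.
  have hb k j : forall n c t, normc c <= s ->
      `|t| ^+ k * normc (iter j (@cderive1 R) (U n c) t) <= b k j * 2^-1 ^+ n.
    by rewrite /b; case: cid2.
  (* The sum dominates each of the finitely many nonnegative constants. *)
  exists (\sum_(k < N.+1) \sum_(j < N.+1) b k j).
    by apply: sumr_ge0 => k _; apply: sumr_ge0.
  move=> k j kN jN n c t cs; apply: le_trans (hb k j n c t cs) _.
  rewrite ler_wpM2r ?exprn_ge0//.
  have kN1 : (k < N.+1)%N by []. have jN1 : (j < N.+1)%N by [].
  rewrite (bigD1 (Ordinal kN1))//= (bigD1 (Ordinal jN1))//= -addrA lerDl.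
  by rewrite addr_ge0// sumr_ge0// => i _; exact: sumr_ge0.
have [n hn] : exists n : nat, C * 2^-1 ^+ n < d.
  exists (Num.bound (C / d)); rewrite exprVn ltr_pdivrMr ?exprn_gt0//.
  rewrite mulrC -ltr_pdivrMr//; apply: (lt_trans (archi_boundP _)).
    by rewrite divr_ge0// ltW.
  by rewrite -natrX ltr_nat ltn_expl.
exists n => c cs; have -> : (fun t => cexp_tail n c (t - z.1) * gauss_shift z t) = U n c.
  by apply/funext => t; rewrite /U hornerC mul1r subn0.
apply: ltW; rewrite -[f (U n c)]subr0 -f0; apply: hd.
  exact: tail_span_schwartz sU.
move=> k j kN jN; under eq_fun do rewrite subr0.
apply: le_lt_trans (_ : _ <= (C * 2^-1 ^+ n)%:E)%E _; last by rewrite lte_fin.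
by apply: schwartz_seminorm_le => t; exact: hC.
Qed.

(** Linearity carries f through the truncated exponential series, leaving a polynomial in c whose
    coefficients are values of f. *)
Lemma tempered_cexp_poly z n c :
  f (fun t => cexp c (t - z.1) * gauss_shift z t) =
  (\poly_(k < n) f (fun t => ((t - z.1)%:C ^+ k / k`!%:R) * gauss_shift z t)).[c] +
  f (fun t => cexp_tail n c (t - z.1) * gauss_shift z t).
Proof.
rewrite horner_poly; elim: n => [|n ih].
  rewrite big_ord0 add0r; congr f.
  by apply/funext => t; rewrite cexp_tail0.
rewrite big_ord_recr ih -addrA; congr (_ + _).
rewrite mulrC -tempered_add; last exact: schwartz_cexp_tail.
  congr f; apply/funext => t.
  by rewrite [in LHS]cexp_tailS mulrDl -(mulrA (c ^+ n)).
pose p : {poly R[i]} := (n`!%:R)^-1 *: ('X - (z.1)%:C%:P) ^+ n.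
rewrite (_ : (fun t => _) = (fun t => p.[t%:C] * gauss_shift z t)).
  exact: schwartz_poly_gauss.
apply/funext => t; rewrite /p hornerZ horner_exp hornerXsubC.
by rewrite -rmorphB /= (mulrC _^-1).
Qed.

Lemma tempered_cexp_approx z (s e : R) : 0 < e ->
  exists P : {poly R[i]}, forall c, normc c <= s ->
    normc (f (fun t => cexp c (t - z.1) * gauss_shift z t) - P.[c]) <= e.
Proof.
move=> e0; have [n hn] := tempered_tail_cvg0 z s e0.
exists (\poly_(k < n)
  f (fun t => ((t - z.1)%:C ^+ k / k`!%:R) * gauss_shift z t)) => c cs.
rewrite (tempered_cexp_poly z n) addrAC subrr add0r.
exact: hn.
Qed.

(** Expanding the square, h_0(t - x - y) = e^(-pi y^2) e^(2 pi y (t - x)) h_0(t - x). Up to a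
    scalar, moving the window by (y, eta) is thus multiplication by the exponential of c (t - x)
    with c = 2 pi (y - i eta). *)
Lemma stft_gaussianD z (y eta : R) :
  stft (@gaussian R) f (z.1 + y, z.2 + eta) =
  (cis (- (2 * pi * eta * z.1)) * (expR (- (pi * y ^+ 2)))%:C) *
  f (fun t => cexp ((2 * pi * y) -i* (2 * pi * eta)) (t - z.1) * gauss_shift z t).
Proof.
rewrite /stft -tempered_scale; last first.
  have := schwartz_cexp_tail z 0 ((2 * pi * y) -i* (2 * pi * eta)).
  by under eq_fun do rewrite cexp_tail0.
congr f; apply/funext => t; have conjM (x y' : R[i]) : conjc (x * y') = conjc x * conjc y'.
  exact: rmorphM.
rewrite /tf_shift conjM [(_, _).1]/= [(_, _).2]/= [X in X * _]/=.
have -> : cos (2 * pi * (z.2 + eta) * t) -i* sin (2 * pi * (z.2 + eta) * t) =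
    cis (- (2 * pi * eta * z.1)) * (cis (- (2 * pi * eta) * (t - z.1)) *
      cis (- (2 * pi * z.2) * t)).
  rewrite -!cisD.
  rewrite (_ : - (2 * pi * eta * z.1) + (- (2 * pi * eta) * (t - z.1) +
    - (2 * pi * z.2) * t) = - (2 * pi * (z.2 + eta) * t)); last by ring.
  by rewrite /cis cosN sinN.
have -> : conjc (gaussian (t - (z.1 + y))) = (expR (- (pi * y ^+ 2)))%:C *
    (expR (2 * pi * y * (t - z.1)))%:C * gaussian (t - z.1).
  rewrite /gaussian conjc_real -!rmorphM /=; congr (_%:C).
  rewrite [RHS]mulrCA -!expRD; congr (_ * expR _); ring.
rewrite /cexp /gauss_shift /= /cexp /= mul0r expR0 mul1r.
by move: (cis _) (cis _) (cis _) (gaussian _) ((expR _)%:C) ((expR _)%:C) => a b c d e g; ring.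
Qed.

Lemma normc_stft_gaussianD z (y eta : R) :
  normc (stft (@gaussian R) f (z.1 + y, z.2 + eta)) =
  expR (- (pi * y ^+ 2)) *
  normc (f (fun t => cexp ((2 * pi * y) -i* (2 * pi * eta)) (t - z.1) *
    gauss_shift z t)).
Proof.
rewrite stft_gaussianD normcM normcM normc_cis mul1r normc_real.
by rewrite ger0_norm ?expR_ge0.
Qed.

End tempered.

(** * Powers, means and lower limits *)

Section real_powers.
Context {R : realType}.
Implicit Types (p : R).

Lemma powR_add3_le p (a b c : R) : 0 <= p -> 0 <= a -> 0 <= b -> 0 <= c ->
  (a + b + c) `^ p <= 3 `^ p * (a `^ p + b `^ p + c `^ p).
Proof.
move=> p0 a0 b0 c0; set m := Num.max a (Num.max b c).
have am : a <= m by rewrite le_max lexx.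
have bm : b <= m by rewrite !le_max lexx orbT.
have cm : c <= m by rewrite !le_max lexx !orbT.
have m0 : 0 <= m by exact: le_trans am.
apply: (@le_trans _ _ ((3 * m) `^ p)).
  by rewrite ge0_ler_powR// ?nnegrE ?mulr_ge0 ?addr_ge0//; lra.
rewrite powRM// ler_wpM2l ?powR_ge0//.
have h1 := powR_ge0 a p; have h2 := powR_ge0 b p; have h3 := powR_ge0 c p.
have : [\/ m = a, m = b | m = c].
  rewrite /m /Num.max; case: ifP => _; last by constructor 1.
  by case: ifP => _; [constructor 3 | constructor 2].
by case=> ->; lra.
Qed.

(** With a the mean, Young's inequality for x_i a^(p-1) averages to a^p <= (mean of x_i^p)/p +
    a^p/q, and 1 - 1/q = 1/p absorbs the last term. *)
Lemma powR_mean_le p n (x : 'I_n -> R) : 1 <= p -> (0 < n)%N ->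
  (forall i, 0 <= x i) ->
  (n%:R^-1 * \sum_(i < n) x i) `^ p <= n%:R^-1 * \sum_(i < n) x i `^ p.
Proof.
move=> p1 n0 x0.
have n1 : 0 < n%:R :> R by rewrite ltr0n.
set a := n%:R^-1 * _.
have a0 : 0 <= a by rewrite mulr_ge0 ?invr_ge0 ?(ltW n1)// sumr_ge0.
move: p1; rewrite le_eqVlt => /predU1P[<-|p1].
  by rewrite powRr1//; under eq_bigr do rewrite powRr1//.
have p0 : 0 < p by lra.
pose q := p / (p - 1).
have q0 : 0 < q by rewrite divr_gt0//; lra.
have pq : p^-1 + q^-1 = 1 by rewrite /q invf_div; field; rewrite gt_eqF.
have aq : (a `^ (p - 1)) `^ q = a `^ p.
  by rewrite -powRrM /q mulrCA divff ?mulr1// subr_eq0 gt_eqF.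
have E : a `^ p = n%:R^-1 * \sum_(i < n) x i * a `^ (p - 1).
  by rewrite -mulr_suml mulrA mulr_powRB1.
have : a `^ p <= n%:R^-1 * \sum_(i < n) (x i `^ p / p + a `^ p / q).
  rewrite [leLHS]E ler_wpM2l ?invr_ge0 ?(ltW n1)//.
  apply: ler_sum => i _; rewrite -aq.
  by apply: conjugate_powR => //; exact: powR_ge0.
rewrite big_split /= -mulr_suml sumr_const card_ord mulrDr -[(_ / q) *+ n]mulr_natl.
rewrite mulKf ?gt_eqF// mulrA -lerBlDr.
have -> : a `^ p - a `^ p / q = a `^ p / p.
  have -> : p^-1 = 1 - q^-1 by rewrite -pq addrK.
  by rewrite mulrBr mulr1.
by rewrite ler_pM2r ?invr_gt0.
Qed.

Lemma le_limn_einf (t x : R) (a : R^nat) : 0 < t ->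
  (forall e, 0 < e -> exists n0 : nat, forall n, (n0 <= n)%N ->
     x <= t * a n + e) ->
  (x%:E <= t%:E * limn_einf (EFin \o a))%E.
Proof.
move=> t0 xa.
suff : ((x / t)%:E <= limn_einf (EFin \o a))%E.
  move/(lee_wpmul2l (_ : 0 <= t%:E)%E) => /(_ (ltW t0)).
  by rewrite -EFinM mulrC divfK ?gt_eqF.
rewrite limn_einf_lim (cvg_lim _ (@cvg_einfs_sup _ _))//.
apply/lee_addgt0Pr => e e0.
have [n0 hn0] := xa (t * e) (mulr_gt0 t0 e0).
rewrite -leeBlDr//; apply: le_trans (ereal_sup_ubound _); last by exists n0.
apply: le_ereal_inf_tmp => _ [n /= n0n <-]; rewrite -EFinB lee_fin.
by rewrite lerBlDr ler_pdivrMr// mulrDl mulrC (mulrC e) hn0.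
Qed.

End real_powers.

(** * Interpolation transferred to the time-frequency plane *)

Section pointwise_estimate.
Context {R : realType}.
Implicit Types (z v w : R * R) (c : R[i]).

(** The exponent c of [stft_gaussianD] for the displacement v - z; it multiplies distances by 2
    pi. *)
Definition plane_to_complex z v : R[i] :=
  (2 * pi * (v.1 - z.1)) -i* (2 * pi * (v.2 - z.2)).

Lemma eucl_distC z w : edist z w = edist w z.
Proof. by rewrite /edist -sqrrN opprB -(sqrrN (z.2 - _)) opprB. Qed.

Lemma eucl_dist_ge0 z w : 0 <= edist z w.
Proof. exact: sqrtr_ge0. Qed.

Lemma eucl_dist_normc z w : edist z w = normc ((z.1 - w.1) +i* (z.2 - w.2)).
Proof. by []. Qed.

Lemma eucl_dist_triangle v z w : edist z w <= edist z v + edist v w.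
Proof.
rewrite !eucl_dist_normc; apply: le_trans (le_normcD _ _).
by rewrite le_eqVlt; apply/orP; left; apply/eqP; congr (normc (_ +i* _)); ring.
Qed.

Lemma normc_plane_to_complexB z v w :
  normc (plane_to_complex z v - plane_to_complex z w) = 2 * pi * edist v w.
Proof.
have -> : plane_to_complex z v - plane_to_complex z w =
    (2 * pi)%:C * conjc ((v.1 - w.1) +i* (v.2 - w.2)).
  by apply/eqP; rewrite eq_complex /=; apply/andP; split; apply/eqP; ring.
rewrite normcM normc_conjc normc_real ger0_norm ?eucl_dist_normc//.
by rewrite mulr_ge0// pi_ge0.
Qed.

Lemma normc_plane_to_complex z v :
  normc (plane_to_complex z v) = 2 * pi * edist v z.
Proof.
rewrite -(normc_plane_to_complexB z v z) /plane_to_complex !subrr !mulr0.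
by rewrite oppr0 (_ : 0 +i* 0 = 0) ?subr0.
Qed.

Definition unity_root (n : nat) : R[i] := xget 1 [set w | n.-primitive_root w].

Lemma unity_rootP n : (0 < n)%N -> n.-primitive_root (unity_root n).
Proof.
move=> n0; have [w pw] := @prim_root_complex R n n0.
exact: (@xgetPex _ 1 [set w | n.-primitive_root w] (ex_intro _ w pw)).
Qed.

(** The minus sign undoes the conjugation in [plane_to_complex], so that these points go to
    multiples of roots of unity. *)
Definition circle_point (s : R) (n j : nat) : R * R :=
  (s * complex.Re (unity_root n ^+ j), - (s * complex.Im (unity_root n ^+ j))).

Lemma plane_to_complex_circle z s n j :
  plane_to_complex z (z.1 + (circle_point s n j).1, z.2 + (circle_point s n j).2) =
  (2 * pi * s)%:C * unity_root n ^+ j.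
Proof.
rewrite /plane_to_complex /circle_point /=; case: (_ ^+ j) => a b /=.
by apply/eqP; rewrite eq_complex /=; apply/andP; split; apply/eqP; ring.
Qed.

Definition circle_mean (p s : R) (H : R * R -> R) (n : nat) z : R :=
  n.+1%:R^-1 * \sum_(j < n.+1)
    H (z.1 + (circle_point s n.+1 j).1, z.2 + (circle_point s n.+1 j).2) `^ p.

Context (f : (R -> R[i]) -> R[i]).
Hypothesis f_tempered : tempered_distribution f.

Let H z := normc (stft (@gaussian R) f z).
Let Phi z c := f (fun t => cexp c (t - z.1) * gauss_shift z t).

Let normc_Phi z v :
  normc (Phi z (plane_to_complex z v)) = expR (pi * (v.1 - z.1) ^+ 2) * H v.
Proof.
have := normc_stft_gaussianD f_tempered z (v.1 - z.1) (v.2 - z.2).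
rewrite !subrKC -surjective_pairing /H => ->.
by rewrite mulrA -expRD subrr expR0 mul1r.
Qed.

Let normc_Phi_le z v (s : R) : edist v z <= s ->
  normc (Phi z (plane_to_complex z v)) <= expR (pi * s ^+ 2) * H v.
Proof.
move=> vs; rewrite normc_Phi ler_wpM2r ?normc_ge0// ler_expR.
rewrite ler_wpM2l ?pi_ge0//.
have s0 : 0 <= s by apply: le_trans vs; exact: eucl_dist_ge0.
rewrite -ler_sqrt ?sqr_ge0// sqrtr_sqr sqrtr_sqr (ger0_norm s0).
apply: le_trans vs; rewrite /edist -sqrtr_sqr ler_wsqrtr//.
by rewrite lerDl sqr_ge0.
Qed.

(** Interpolation is applied to a polynomial P close to [Phi z]. Passing from |V f| to P costs E, a
    bound for the Gaussian factor on the disc of radius 18r. The threshold n0 is the size of P,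
    hence independent of the nodes and of w. *)
Lemma interpolation_local (k : nat) (r d m e : R) z :
  0 < r -> 0 < d -> 0 < e -> 0 <= m ->
  exists n0 : nat, forall n, (n0 <= n)%N -> forall vs : seq (R * R),
    size vs = k ->
    (forall v, v \in vs -> edist v z <= r /\ H v <= m) ->
    pairwise (fun v w => d <= edist v w) vs ->
    forall w, edist w z <= r ->
    H w <= 2^-1 ^+ k * 2 * expR (pi * (18 * r) ^+ 2) *
        (n.+1%:R^-1 * \sum_(j < n.+1) H (z.1 + (circle_point (18 * r) n.+1 j).1,
                                  z.2 + (circle_point (18 * r) n.+1 j).2)) +
      interp_const (2 * pi * r) (2 * pi * d) k *
        expR (pi * (18 * r) ^+ 2) * m + e.
Proof.
move=> r0 d0 e0 m0; set E := expR _; set C := interp_const _ _ _.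
have pi0 := @pi_gt0 R.
have rho0 : 0 < 2 * pi * r by rewrite !mulr_gt0.
have dd0 : 0 < 2 * pi * d by rewrite !mulr_gt0.
have C0 : 0 <= C by exact: interp_const_ge0.
have E1 : 0 < E by exact: expR_gt0.
(* Error budget: C e' from the values at the nodes, 2 e' from the circle mean, e' from the return to
   f. *)
have e'0 : 0 < e / (C + 3) by rewrite divr_gt0//; lra.
set e' := e / (C + 3) in e'0.
have [P hP] := tempered_cexp_approx f_tempered z (2 * pi * (18 * r)) e'0.
have PPhi c : normc c <= 2 * pi * (18 * r) -> normc P.[c] <= normc (Phi z c) + e'.
  move=> /hP; rewrite -/(Phi z c) => h.
  rewrite -[P.[c]](subKr (Phi z c)); apply: le_trans (normcB _ _) _.
  by rewrite lerD2l.
have PhiP c : normc c <= 2 * pi * (18 * r) -> normc (Phi z c) <= normc P.[c] + e'.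
  move=> /hP; rewrite -/(Phi z c) => h.
  rewrite -[Phi z c](subrK P.[c]); apply: le_trans (le_normcD _ _) _.
  by rewrite addrC lerD2l.
have far v s : edist v z <= s -> normc (plane_to_complex z v) <= 2 * pi * s.
  by move=> vs; rewrite normc_plane_to_complex ler_wpM2l// mulr_ge0// ltW.
exists (size P) => n Pn vs vsk hvs sepvs w wr.
have r18 : r <= 18 * r by lra.
have PE v : edist v z <= 18 * r -> normc P.[plane_to_complex z v] <= E * H v + e'.
  move=> vr; apply: le_trans (PPhi _ (far _ _ vr)) _.
  by rewrite lerD2r; exact: normc_Phi_le.
have := @interpolation_bound R (2 * pi * r) (2 * pi * d) (E * m + e')
  [seq plane_to_complex z v | v <- vs] P rho0 dd0.
rewrite size_map vsk => hI.
have {hI} : normc P.[plane_to_complex z w] <=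
    2^-1 ^+ k * pnorm (9 * (2 * pi * r)) P + C * (E * m + e').
  apply: hI.
  - move=> c /mapP[v vvs ->]; have [vr Hv] := hvs _ vvs; split; first exact: far.
    apply: le_trans (PE _ (le_trans vr r18)) _.
    by rewrite lerD2r ler_pM2l.
  - rewrite pairwise_map; apply: sub_pairwise sepvs => v1 v2 h.
    change (2 * pi * d <= normc (plane_to_complex z v1 - plane_to_complex z v2)).
    by rewrite normc_plane_to_complexB ler_pM2l// mulr_gt0.
  - exact: far.
have := @pnorm_half_le R n.+1 (unity_root n.+1) (2 * pi * (18 * r)) P
  (ltn0Sn n) (unity_rootP (ltn0Sn n)).
have -> : 2 * pi * (18 * r) / 2 = 9 * (2 * pi * r) by field.
set S := \sum_(j < _) H _.
have n1 : 0 < n.+1%:R :> R by rewrite ltr0n.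
have hS : n.+1%:R^-1 * \sum_(j < n.+1)
     normc P.[(2 * pi * (18 * r))%:C * unity_root n.+1 ^+ j] <=
     E * (n.+1%:R^-1 * S) + e'.
  have -> : E * (n.+1%:R^-1 * S) + e' = n.+1%:R^-1 * (E * S + n.+1%:R * e').
    by rewrite mulrDr mulKf ?gt_eqF// mulrCA.
  have -> : n.+1%:R * e' = \sum_(j < n.+1) e'.
    by rewrite sumr_const card_ord mulr_natl.
  rewrite ler_pM2l ?invr_gt0// /S mulr_sumr -big_split.
  apply: ler_sum => j _ /=.
  rewrite -(plane_to_complex_circle z).
  apply: PE; rewrite -(@ler_pM2l _ (2 * pi)) ?mulr_gt0//.
  rewrite -normc_plane_to_complex plane_to_complex_circle normcM normcX.
  rewrite (normc_prim_root (ltn0Sn n) (unity_rootP _))// expr1n mulr1.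
  by rewrite normc_real ger0_norm// !mulr_ge0// ltW.
have s0 : 0 <= 2 * pi * (18 * r) by rewrite !mulr_ge0// ltW.
move=> /(_ s0 (leq_trans Pn (leqnSn n))) h1 h2.
have wr18 := le_trans wr r18.
have h3 : H w <= normc (Phi z (plane_to_complex z w)).
  rewrite normc_Phi ler_peMl ?normc_ge0// -expR0 ler_expR mulr_ge0 ?sqr_ge0//.
  exact: ltW.
have h4 := PhiP _ (far _ _ wr18).
have k1 : 2^-1 ^+ k <= 1 :> R by apply: exprn_ile1; lra.
have k0 : 0 <= 2^-1 ^+ k :> R by rewrite exprn_ge0.
have h5 : 2^-1 ^+ k * pnorm (9 * (2 * pi * r)) P <=
    2^-1 ^+ k * (2 * (E * (n.+1%:R^-1 * S) + e')).
  by rewrite ler_wpM2l//; apply: le_trans h1 _; rewrite ler_pM2l.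
have h6 : 2^-1 ^+ k * e' <= e' by rewrite ler_piMl// ltW.
have ee : e = C * e' + 3 * e' by rewrite -mulrDl /e' mulrC divfK// gt_eqF//; lra.
rewrite [X in _ <= _ + X]ee; move: h2 h3 h4 h5 h6; set A := _ ^+ k; set M := n.+1%:R^-1 * S.
set x := normc P.[_]; set y := normc (Phi _ _); set q := pnorm _ _.
move=> h2 h3 h4 h5 h6.
have -> : A * 2 * E * M = A * (2 * (E * M)) by ring.
rewrite mulrDr mulrA in h2; rewrite mulrDr mulrDr in h5; lra.
Qed.

Lemma interpolation_local_powR (p : R) (k : nat) (r d m e : R) z :
  1 <= p -> 0 < r -> 0 < d -> 0 < e -> 0 <= m ->
  exists n0 : nat, forall n, (n0 <= n)%N -> forall vs : seq (R * R),
    size vs = k ->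
    (forall v, v \in vs -> edist v z <= r /\ H v `^ p <= m) ->
    pairwise (fun v w => d <= edist v w) vs ->
    forall w, edist w z <= r ->
    H w `^ p <= 3 `^ p * (2^-1 ^+ k * 2 * expR (pi * (18 * r) ^+ 2)) `^ p *
        circle_mean p (18 * r) H n z +
      3 `^ p * (interp_const (2 * pi * r) (2 * pi * d) k *
        expR (pi * (18 * r) ^+ 2)) `^ p * m + e.
Proof.
move=> p1 r0 d0 e0 m0.
have p0 : 0 < p by lra.
have pi0 := @pi_gt0 R.
set E := expR _; set C := interp_const _ _ _.
have C0 : 0 <= C by apply: interp_const_ge0; rewrite ?mulr_gt0.
have E1 : 0 <= E by exact: expR_ge0.
have t0 : 0 < 3 `^ p :> R by rewrite powR_gt0.
(* After the power p and the factor 3^p due to three summands, this error becomes exactly e. *)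
have e'0 : 0 < (e / 3 `^ p) `^ p^-1 by rewrite powR_gt0// divr_gt0.
have m'0 : 0 <= m `^ p^-1 by exact: powR_ge0.
have [n0 hn0] := interpolation_local k z r0 d0 e'0 m'0.
exists n0 => n nn0 vs vsk hvs sep w wr.
have hvs' v : v \in vs -> edist v z <= r /\ H v <= m `^ p^-1.
  move=> /hvs[vr vm]; split=> //.
  have -> : H v = (H v `^ p) `^ p^-1.
    by rewrite -powRrM divff ?gt_eqF// powRr1// normc_ge0.
  by rewrite ge0_ler_powR ?invr_ge0 ?(ltW p0)// nnegrE powR_ge0.
have := hn0 n nn0 vs vsk hvs' sep w wr.
rewrite -/E -/C.
set M := n.+1%:R^-1 * _ => h.
have M0 : 0 <= M.
  by rewrite mulr_ge0 ?invr_ge0// sumr_ge0// => j _; exact: normc_ge0.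
have MA : M `^ p <= circle_mean p (18 * r) H n z.
  rewrite /M; apply: (@powR_mean_le _ p n.+1 (fun j => H _)) => //.
  by move=> j; exact: normc_ge0.
have A0 : 0 <= 2^-1 ^+ k * 2 * E by rewrite !mulr_ge0 ?exprn_ge0.
apply: (@le_trans _ _ ((2^-1 ^+ k * 2 * E * M + C * E * m `^ p^-1 +
    (e / 3 `^ p) `^ p^-1) `^ p)).
  rewrite ge0_ler_powR ?(ltW p0)// nnegrE ?normc_ge0//.
  by rewrite addr_ge0 ?(ltW e'0)// addr_ge0// mulr_ge0// mulr_ge0.
apply: le_trans (powR_add3_le _ _ _ _) _; rewrite ?(ltW p0) ?(ltW e'0)//.
- exact: mulr_ge0.
- by rewrite mulr_ge0// mulr_ge0.
rewrite (powRM _ A0 M0) (powRM _ (mulr_ge0 C0 E1) m'0).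
rewrite -!powRrM mulVf ?gt_eqF// !powRr1// ?divr_ge0 ?(ltW e0) ?(ltW t0)//.
rewrite !mulrDr (_ : 3 `^ p * (e / 3 `^ p) = e); last first.
  by rewrite mulrC divfK ?gt_eqF.
by rewrite -!mulrA !lerD2r ler_pM2l// ler_wpM2l// powR_ge0.
Qed.

End pointwise_estimate.

(** * Integrals over balls of the plane *)

Section plane_measure.
Context {R : realType}.
Local Open Scope ereal_scope.

Let leb := @lebesgue_measure R.
Let leb2 := (leb \x leb)%E.

(** The translated measure agrees with Lebesgue measure on half-open intervals, which determine
    it. *)
Lemma pushforward_lebesgue_translation (a : R) (A : set R) : measurable A ->
  pushforward leb (fun x : R => (x + a)%R) A = leb A.
Proof.
move=> mA; pose phi (x : measurableTypeR R) : measurableTypeR R := (x + a)%R.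
have mphi : measurable_fun [set: measurableTypeR R] phi.
  exact: measurable_funD.
apply/esym; apply: (@lebesgue_measure_unique _ (pushforward leb phi)) => //.
move=> _ [[x y] _ <-] /=; rewrite /pushforward.
have -> : phi @^-1` `]x, y] = `](x - a)%R, (y - a)%R]%classic.
  apply/seteqP; split => t /=; rewrite !in_itv /= /phi.
    by rewrite ltrBlDr lerBrDr.
  by rewrite ltrBlDr lerBrDr.
rewrite /leb !lebesgue_measure_itv /= !lte_fin ltrD2r.
by case: ifP => // _; rewrite -!EFinB opprB addrA subrK.
Qed.

Lemma ge0_integral_translation (a : R) (f : R -> \bar R) :
  measurable_fun setT f -> (forall x, 0 <= f x) ->
  \int[leb]_x f (x + a)%R = \int[leb]_x f x.
Proof.
move=> mf f0; pose phi (x : measurableTypeR R) : measurableTypeR R := (x + a)%R.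
have mphi : measurable_fun [set: measurableTypeR R] phi.
  exact: measurable_funD.
rewrite -[LHS](ge0_integral_pushforward mphi leb measurableT mf)//.
by apply: eq_measure_integral => A mA _; exact: pushforward_lebesgue_translation.
Qed.

Lemma ge0_integral_translation2 (v : R * R) (f : R * R -> \bar R) :
  measurable_fun setT f -> (forall x, 0 <= f x) ->
  \int[leb2]_z f (z.1 + v.1, z.2 + v.2)%R = \int[leb2]_z f z.
Proof.
move=> mf f0.
have ms : measurable_fun setT (fun z : R * R => (z.1 + v.1, z.2 + v.2)%R).
  by apply: measurable_fun_pair; apply: measurable_funD.
pose h (z : R * R) := f (z.1 + v.1, z.2 + v.2)%R.
have mh : measurable_fun setT h by exact: measurableT_comp mf ms.
have h0 z : 0 <= h z by exact: f0.
transitivity (\int[leb]_x \int[leb]_y h (x, y)).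
  exact: (@fubini_tonelli1 _ _ _ _ R leb leb h mh h0).
transitivity (\int[leb]_x \int[leb]_y f (x, y)); last first.
  by apply/esym; exact: (@fubini_tonelli1 _ _ _ _ R leb leb f mf f0).
transitivity (\int[leb]_x \int[leb]_y f (x + v.1, y)%R).
  apply: eq_integral => x _.
  apply: (ge0_integral_translation v.2 (f := fun y => f (x + v.1, y)%R)) => //.
  exact: measurableT_comp mf (measurable_pair1 _).
apply: (ge0_integral_translation v.1 (f := fun x => \int[leb]_y f (x, y))).
  exact: (@measurable_fun_fubini_tonelli_F _ _ _ _ R leb f mf f0).
by move=> x; exact: integral_ge0.
Qed.

Lemma measurable_edist d (T : measurableType d) (f g : T -> R * R) :
  measurable_fun setT f -> measurable_fun setT g ->
  measurable_fun setT (fun t => edist (f t) (g t)).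
Proof.
move=> mf mg; have msqrt : measurable_fun [set: R] (@Num.sqrt R).
  by apply: continuous_measurable_fun; exact: sqrt_continuous.
apply: (measurableT_comp msqrt).
by apply: measurable_funD; apply: measurable_funX; apply: measurable_funB;
  apply: measurableT_comp.
Qed.

Lemma measurable_edist_lt d (T : measurableType d) (f g : T -> R * R) (r : R) :
  measurable_fun setT f -> measurable_fun setT g ->
  measurable [set t | (edist (f t) (g t) < r)%R].
Proof.
move=> mf mg; have := measurable_edist mf mg measurableT (measurable_itv `]-oo, r[).
by rewrite setTI; congr measurable; apply/seteqP; split => u /=; rewrite in_itv.
Qed.

Lemma measurable_eball z (r : R) : measurable (eball z r).
Proof. exact: (measurable_edist_lt r (measurable_cst z) (@measurable_id _ _ _)). Qed.

Lemma ge0_integral_section_swap d1 d2 (T1 : measurableType d1)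
    (T2 : measurableType d2) (m1 : {sigma_finite_measure set T1 -> \bar R})
    (m2 : {sigma_finite_measure set T2 -> \bar R})
    (B : set (T1 * T2)) (G : T2 -> \bar R) :
  measurable B -> measurable_fun setT G -> (forall w, 0 <= G w) ->
  \int[m1]_z \int[m2]_(w in [set w | B (z, w)]) G w =
  \int[m2]_w (G w * m1 [set z | B (z, w)]).
Proof.
move=> mB mG G0; pose h u := (\1_B u)%:E * G u.2.
have mh : measurable_fun setT h.
  apply: emeasurable_funM; last exact: measurableT_comp mG measurable_snd.
  exact/measurable_EFinP/measurable_indic.
have h0 u : 0 <= h u by rewrite mule_ge0// lee_fin.
have := @fubini_tonelli _ _ _ _ _ m1 m2 h mh h0.
have -> : \int[m1]_x \int[m2]_y h (x, y) =
    \int[m1]_z \int[m2]_(w in [set w | B (z, w)]) G w.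
  apply: eq_integral => z _; rewrite [RHS]integral_mkcond.
  apply: eq_integral => w _; rewrite /h patchE /= indicE.
  have -> : ((z, w) \in B) = (w \in [set w | B (z, w)]).
    by apply/idP/idP; rewrite !inE.
  by case: ifP => _; rewrite ?mul1e ?mul0e.
move=> ->; apply: eq_integral => w _.
have mBw : measurable [set z | B (z, w)].
  have := measurable_ysection w mB.
  by congr measurable; apply/seteqP; split => z; rewrite /ysection /= inE.
have -> : m1 [set z | B (z, w)] = \int[m1]_z (\1_[set z | B (z, w)] z)%:E.
  by rewrite integral_indic ?setIT.
rewrite (muleC (G w)) -ge0_integralZr//.
by apply/measurable_EFinP; apply: measurable_indic.
Qed.

Lemma measurable_section_integral d1 d2 (T1 : measurableType d1)
    (T2 : measurableType d2) (m2 : {sigma_finite_measure set T2 -> \bar R})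
    (B : set (T1 * T2)) (G : T2 -> \bar R) :
  measurable B -> measurable_fun setT G -> (forall w, 0 <= G w) ->
  measurable_fun setT (fun z => \int[m2]_(w in [set w | B (z, w)]) G w).
Proof.
move=> mB mG G0; pose h u := (\1_B u)%:E * G u.2.
have mh : measurable_fun setT h.
  apply: emeasurable_funM; last exact: measurableT_comp mG measurable_snd.
  exact/measurable_EFinP/measurable_indic.
have h0 u : 0 <= h u by rewrite mule_ge0// lee_fin.
have := @measurable_fun_fubini_tonelli_F _ _ _ _ _ m2 h mh h0.
congr (measurable_fun setT _); apply/funext => z.
rewrite [RHS]integral_mkcond.
apply: eq_integral => w _; rewrite /h patchE /= indicE.
have -> : ((z, w) \in B) = (w \in [set w | B (z, w)]).
  by apply/idP/idP; rewrite !inE.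
by case: ifP => _; rewrite ?mul1e ?mul0e.
Qed.

Lemma lebesgue_rectangle (a b c d : R) : (a <= b)%R -> (c <= d)%R ->
  leb2 (`[a, b] `*` `[c, d]) = ((b - a) * (d - c))%:E.
Proof.
move=> ab cd; have I x y : (x <= y)%R -> leb `[x, y]%classic = (y - x)%:E.
  move=> xy; rewrite /leb lebesgue_measure_itv /= lte_fin.
  case: ltP => // yx; have -> : x = y by apply/eqP; rewrite eq_le xy yx.
  by rewrite subrr.
transitivity (leb `[a, b]%classic * leb `[c, d]%classic).
  exact: product_measure1E.
by rewrite !I.
Qed.

Lemma lebesgue_eball_le (w : R * R) (r : R) : (0 < r)%R ->
  leb2 (eball w r) <= (4 * r ^+ 2)%:E.
Proof.
move=> r0.
apply: (@le_trans _ _ (leb2 (`[(w.1 - r)%R, (w.1 + r)%R] `*` `[(w.2 - r)%R, (w.2 + r)%R]))).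
  apply: le_measure; rewrite ?inE.
  - exact: measurable_eball.
  - exact: measurableX.
  move=> z; rewrite /eball /= => wz.
  have h1 : (`|w.1 - z.1| < r)%R.
    apply: le_lt_trans wz; rewrite -sqrtr_sqr /edist ler_wsqrtr//.
    by rewrite lerDl sqr_ge0.
  have h2 : (`|w.2 - z.2| < r)%R.
    apply: le_lt_trans wz; rewrite -sqrtr_sqr /edist ler_wsqrtr//.
    by rewrite lerDr sqr_ge0.
  move: h1 h2; rewrite !ltr_norml /= !in_itv /= => /andP[? ?] /andP[? ?].
  by split; apply/andP; split; lra.
by rewrite lebesgue_rectangle ?lee_fin; lra.
Qed.

Lemma lebesgue_eball_ge (w : R * R) (r : R) : (0 < r)%R ->
  (r ^+ 2)%:E <= leb2 (eball w r).
Proof.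
move=> r0.
apply: (@le_trans _ _ (leb2 (`[(w.1 - r / 2)%R, (w.1 + r / 2)%R] `*`
    `[(w.2 - r / 2)%R, (w.2 + r / 2)%R]))).
  by rewrite lebesgue_rectangle ?lee_fin; lra.
apply: le_measure; rewrite ?inE.
- exact: measurableX.
- exact: measurable_eball.
move=> z /=; rewrite !in_itv /= => -[/andP[a1 a2] /andP[b1 b2]].
rewrite /eball /= /edist -[ltRHS]ger0_norm ?(ltW r0)// -sqrtr_sqr ltr_sqrt ?exprn_gt0//.
nra.
Qed.

End plane_measure.

(** * Exchange of integrals over balls *)

Section ball_averages.
Context {R : realType}.
Local Open Scope ereal_scope.

Let leb2 := (@lebesgue_measure R \x @lebesgue_measure R)%E.

(** Balls centred on a grid of mesh r/2, enumerated through [pickle]; every point is within r/sqrt 2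
    of a centre, so they cover the plane. *)
Definition grid_ball (r : R) (n : nat) : set (R * R) :=
  if unpickle n is Some (i, j) then
    eball ((i : int)%:~R * (r / 2), (j : int)%:~R * (r / 2))%R r
  else set0.

Lemma measurable_grid_ball r n : measurable (grid_ball r n).
Proof.
by rewrite /grid_ball; case: unpickle => [[i j]|//]; exact: measurable_eball.
Qed.

Lemma bigcup_grid_ball (r : R) : (0 < r)%R -> \bigcup_n grid_ball r n = setT.
Proof.
move=> r0; apply/seteqP; split=> // z _.
have r2 : (0 < r / 2)%R by rewrite divr_gt0.
have fl (x : R) : exists i : int, (0 <= x - i%:~R * (r / 2) <= r / 2)%R.
  exists (Num.floor (x / (r / 2))%R).
  have /andP[h1 h2] := @real_floor_itv R (x / (r / 2))%R (num_real _).
  rewrite ler_pdivlMr// in h1.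
  rewrite ltr_pdivrMr// in h2.
  rewrite subr_ge0 h1 /=; move: h2; rewrite intrD mulrDl mul1r.
  by rewrite lerBlDr addrC => /ltW.
have [i hi] := fl z.1; have [j hj] := fl z.2.
exists (pickle (i, j)) => //; rewrite /grid_ball pickleK /eball /= /edist /=.
rewrite -[ltRHS]ger0_norm ?(ltW r0)// -sqrtr_sqr ltr_sqrt ?exprn_gt0//.
move: hi hj; move: (i%:~R * _)%R (j%:~R * _)%R => a b /andP[? ?] /andP[? ?].
nra.
Qed.

Lemma sigma_finite_of_balls (mu : {measure set (R * R)%type -> \bar R}) (r M : R) :
  (0 < r)%R -> (forall z, mu (eball z r) <= M%:E) -> sigma_finite setT mu.
Proof.
move=> r0 muM; exists (grid_ball r); first by rewrite bigcup_grid_ball.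
move=> n; split; first exact: measurable_grid_ball.
rewrite /grid_ball; case: unpickle => [[i j]|]; last by rewrite measure0.
by apply: le_lt_trans (muM _) _; rewrite ltry.
Qed.

Lemma sigma_finite_plane : sigma_finite setT leb2.
Proof.
exists (grid_ball 1); first by rewrite bigcup_grid_ball.
move=> n; split; first exact: measurable_grid_ball.
rewrite /grid_ball; case: unpickle => [[i j]|]; last first.
  by have -> : leb2 set0 = 0 by exact: measure0.
by apply: le_lt_trans (lebesgue_eball_le _ _) _; rewrite ?ltry.
Qed.

(* The library's product measure has no sigma-finite structure that unification
   finds (it is shadowed by the one for subprobabilities), hence this alias. *)
Definition sigma_finite_sort d (T : measurableType d)
  (mu : {measure set T -> \bar R}) of sigma_finite setT mu := (mu : set _ -> \bar R).

Section sigma_finite_sort.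
Context d (T : measurableType d) (mu : {measure set T -> \bar R}).
Hypothesis mu_sf : sigma_finite setT mu.
HB.instance Definition _ := Measure.on (sigma_finite_sort mu_sf).
HB.instance Definition _ :=
  Measure_isSigmaFinite.Build _ _ _ (sigma_finite_sort mu_sf) mu_sf.
End sigma_finite_sort.

Section swap.
Variables (mu : {measure set (R * R)%type -> \bar R}).
Hypothesis mu_sf : sigma_finite setT mu.
Let mu' : {sigma_finite_measure set (R * R)%type -> \bar R} :=
  sigma_finite_sort mu_sf.

Let plane : measurableType _ := (measurableTypeR R * measurableTypeR R)%type.
Let leb2' : {sigma_finite_measure set plane -> \bar R} :=
  sigma_finite_sort sigma_finite_plane.

Lemma integral_ball_swap_l (r : R) (G : R * R -> \bar R) :
  measurable_fun setT G -> (forall w, 0 <= G w) ->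
  \int[leb2]_z \int[mu]_(w in eball z r) G w =
  \int[mu]_w (G w * leb2 (eball w r)).
Proof.
move=> mG G0.
pose B := [set u : plane * (R * R) | edist (u.1 : R * R) u.2 < r]%R.
have mB : measurable B.
  apply: measurable_edist_lt; last exact: measurable_snd.
  exact: measurable_fst.
transitivity (\int[mu]_w (G w * leb2' [set z | B (z, w)])).
  exact: (@ge0_integral_section_swap R _ _ plane _ leb2' mu' B G mB mG G0).
apply: eq_integral => w _; congr (_ * leb2 _).
by apply/seteqP; split => z; rewrite /B /eball /= eucl_distC.
Qed.

Lemma integral_ball_swap_r (r : R) (G : R * R -> \bar R) :
  measurable_fun setT G -> (forall w, 0 <= G w) ->
  \int[mu]_z \int[leb2]_(w in eball z r) G w =
  \int[leb2]_w (G w * mu (eball w r)).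
Proof.
move=> mG G0.
pose B := [set u : (R * R) * plane | edist u.1 (u.2 : R * R) < r]%R.
have mB : measurable B.
  apply: measurable_edist_lt; first exact: measurable_fst.
  exact: measurable_snd.
transitivity (\int[leb2']_w (G w * mu [set z | B (z, w)])).
  exact: (@ge0_integral_section_swap R _ _ _ plane mu' leb2' B G mB mG G0).
apply: eq_integral => w _; congr (_ * mu _).
by apply/seteqP; split => z; rewrite /B /eball /= eucl_distC.
Qed.

Lemma measurable_ball_integral (r : R) (G : R * R -> \bar R) :
  measurable_fun setT G -> (forall w, 0 <= G w) ->
  measurable_fun setT (fun z : R * R => \int[mu]_(w in eball z r) G w).
Proof.
move=> mG G0.
pose B := [set u : (R * R) * (R * R) | edist u.1 u.2 < r]%R.
have mB : measurable B.
  apply: measurable_edist_lt; first exact: measurable_fst.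
  exact: measurable_snd.
exact: (measurable_section_integral mu' mB mG G0).
Qed.

End swap.

End ball_averages.

Section ball_inequalities.
Context {R : realType}.
Local Open Scope ereal_scope.

Let leb2 := (@lebesgue_measure R \x @lebesgue_measure R)%E.

(** The integral of a nonnegative function is a supremum over the simple functions below it, so the
    pointwise order passes to the integrals directly. *)
Lemma ge0_integral_mono d (T : measurableType d) (mu : {measure set T -> \bar R})
    (D : set T) (f g : T -> \bar R) :
  (forall x, D x -> 0 <= f x) -> (forall x, D x -> f x <= g x) ->
  \int[mu]_(x in D) f x <= \int[mu]_(x in D) g x.
Proof.
move=> f0 fg.
have g0 x : D x -> 0 <= g x by move=> Dx; exact: le_trans (f0 _ Dx) (fg _ Dx).
rewrite !ge0_integralE//; apply: ereal_sup_le => _ [h /= hf <-].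
exists h => // x; apply: le_trans (hf x) _; rewrite !patchE.
by case: ifPn => //; rewrite inE => /fg.
Qed.

Lemma measurable_circle_mean (p s : R) (H : R * R -> R) n :
  measurable_fun setT H -> measurable_fun setT (circle_mean p s H n).
Proof.
move=> mH; apply: measurable_funM; first exact: measurable_cst.
pose g j (z : R * R) : R := (H (z.1 + (circle_point s n.+1 j).1,
    z.2 + (circle_point s n.+1 j).2) `^ p)%R.
have mg j : measurable_fun setT (g j).
  apply: (measurableT_comp (measurable_powR p)).
  apply: (measurableT_comp mH).
  by apply: measurable_fun_pair; exact: measurable_funD.
exact: (@measurable_sum _ _ R setT 'I_n.+1 (index_enum _) (fun j => g j)).
Qed.

Lemma circle_mean_fatou (p s : R) (H : R * R -> R) :
  measurable_fun setT H -> (forall z, 0 <= H z)%R ->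
  \int[leb2]_z limn_einf (EFin \o (circle_mean p s H ^~ z)) <=
  \int[leb2]_z (H z `^ p)%:E.
Proof.
move=> mH H0; pose h (z : R * R) := (H z `^ p)%:E.
have mh : measurable_fun setT h.
  by apply/measurable_EFinP; exact: measurableT_comp (measurable_powR p) mH.
have h0 z : 0 <= h z by rewrite lee_fin powR_ge0.
pose sh n j (z : R * R) := (z.1 + (circle_point s n.+1 j).1,
    z.2 + (circle_point s n.+1 j).2)%R.
have msh n j : measurable_fun setT (h \o sh n j).
  by apply: (measurableT_comp mh); apply: measurable_fun_pair; exact: measurable_funD.
have sumc n (c : \bar R) : \sum_(j < n.+1) c = n.+1%:R%:E * c.
  transitivity (\sum_(j < n.+1) (1%:E * c)).
    by apply: eq_bigr => j _; rewrite mul1e.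
  rewrite -ge0_sume_distrl; last by move=> j _; rewrite lee_fin.
  by rewrite sumEFin sumr_const card_ord.
have mS n : measurable_fun setT (fun z => \sum_(j < n.+1) h (sh n j z)).
  have := @emeasurable_sum _ _ R setT 'I_n.+1 (index_enum _)
    (fun j => h \o sh n j) (fun j => msh n j).
  exact.
have E n : (fun z => (circle_mean p s H n z)%:E) =
    (fun z => n.+1%:R^-1%:E * \sum_(j < n.+1) h (sh n j z)).
  apply/funext => z; rewrite /circle_mean EFinM; congr (_ * _).
  by rewrite -sumEFin.
have mE n : measurable_fun setT (fun z => (circle_mean p s H n z)%:E).
  by apply/measurable_EFinP; exact: measurable_circle_mean.
have := @fatou _ _ _ leb2 setT measurableT
  (fun n z => (circle_mean p s H n z)%:E) mE.
move=> /(_ _)/le_trans; apply.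
  by move=> n z _; rewrite lee_fin mulr_ge0 ?invr_ge0// sumr_ge0// => j _; exact: powR_ge0.
have I n : \int[leb2]_z (circle_mean p s H n z)%:E = \int[leb2]_z h z.
  under eq_integral do rewrite (congr1 (@^~ _) (E n)).
  rewrite ge0_integralZl//; last 2 first.
  - exact: mS.
  - by move=> z _; apply: sume_ge0 => j _; exact: h0.
  transitivity (n.+1%:R^-1%:E * \sum_(j < n.+1) \int[leb2]_z h (sh n j z)).
    congr (_ * _); exact: (@ge0_integral_sum _ _ R leb2 setT measurableT 'I_n.+1
      (fun j => h \o sh n j) (fun j => msh n j) (fun j z _ => h0 _) (index_enum _)).
  under eq_bigr => j _ do rewrite (ge0_integral_translation2 _ mh h0).
  by rewrite sumc muleA -EFinM mulVf ?mul1e// pnatr_eq0.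
(* All the integrals being equal, each tail infimum is bounded by its first term. *)
rewrite limn_einf_lim (cvg_lim _ (@cvg_einfs_sup _ _))//.
apply: ge_ereal_sup => _ [n _ <-].
by apply: ereal_inf_lbound; exists n => //=; exact: leqnn.
Qed.

(** Exchanging the integrals over |w - z| < r trades mu for Lebesgue measure: r^2 bounds the area of
    a ball from below, M its mass from above. This serves both the upper sampling bound, with K a
    multiple of the lower limit of circle means, and the uniform tails of Gaussian bumps. *)
Lemma ball_majorant (mu : {measure set (R * R)%type -> \bar R}) (r M : R)
    (G K : R * R -> \bar R) :
  (0 < r)%R -> (forall z, mu (eball z r) <= M%:E) ->
  measurable_fun setT G -> (forall w, 0 <= G w) ->
  measurable_fun setT K -> (forall w, 0 <= K w) ->
  (forall w z, (edist w z < r)%R -> G w <= K z) ->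
  (r ^+ 2)%:E * \int[mu]_w G w <= M%:E * \int[leb2]_z K z.
Proof.
move=> r0 muM mG G0 mK K0 GK.
have mu_sf := sigma_finite_of_balls r0 muM.
have M0 : 0 <= M%:E by apply: le_trans (muM (0, 0)%R); exact: measure_ge0.
rewrite -!ge0_integralZl//; last by rewrite lee_fin sqr_ge0.
apply: (@le_trans _ _ (\int[leb2]_z (K z * mu (eball z r)))); last first.
  apply: ge0_integral_mono => z _; first exact: mule_ge0.
  by rewrite muleC lee_wpmul2r.
rewrite -(integral_ball_swap_r mu_sf r mK K0).
apply: ge0_integral_mono.
  by move=> w _; rewrite mule_ge0// lee_fin sqr_ge0.
move=> w _; apply: (@le_trans _ _ (\int[leb2]_(z in eball w r) G w)).
  rewrite integral_cst; last exact: measurable_eball.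
  by rewrite muleC lee_wpmul2l// lebesgue_eball_ge.
by apply: ge0_integral_mono => // z /= wz; exact: GK.
Qed.

Lemma local_integral_bound (mu : {measure set (R * R)%type -> \bar R}) (r : R)
    (G : R * R -> \bar R) : sigma_finite setT mu ->
  (0 < r)%R -> measurable_fun setT G -> (forall w, 0 <= G w) ->
  \int[leb2]_z \int[mu]_(w in eball z r) G w <=
  (4 * r ^+ 2)%:E * \int[mu]_w G w.
Proof.
move=> mu_sf r0 mG G0; rewrite (integral_ball_swap_l mu_sf r mG G0).
rewrite -ge0_integralZl//; last by rewrite lee_fin mulr_ge0// sqr_ge0.
apply: ge0_integral_mono => w _; first exact: mule_ge0.
by rewrite muleC lee_wpmul2r// lebesgue_eball_le.
Qed.

End ball_inequalities.

(** * Sampling inequalities from mass bounds *)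

Section separated_points.
Context {R : realType}.
Local Open Scope ereal_scope.
Variable mu : {measure set (R * R)%type -> \bar R}.

Definition remove_balls (d : R) (vs : seq (R * R)) (A : set (R * R)) : set (R * R) :=
  foldr (fun v X => X `\` eball v d) A vs.

Lemma measurable_remove_balls d vs A :
  measurable A -> measurable (remove_balls d vs A).
Proof.
move=> mA; elim: vs => //= v vs ih.
by apply: measurableD => //; exact: measurable_eball.
Qed.

Lemma remove_ballsP d vs A w : remove_balls d vs A w ->
  A w /\ forall v, v \in vs -> (d <= edist v w)%R.
Proof.
elim: vs => [|v vs ih] //= [/ih[Aw hvs] vw]; split=> // u.
rewrite inE => /predU1P[->|/hvs//].
by rewrite leNgt; apply/negP.
Qed.

Lemma measure_remove_balls d vs A (e : R) : measurable A ->
  (forall v, mu (eball v d) <= e%:E) ->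
  mu A <= mu (remove_balls d vs A) + ((size vs)%:R * e)%:E.
Proof.
move=> mA mue; elim: vs => [|v vs ih] /=; first by rewrite mul0r adde0.
apply: le_trans ih _; set B := remove_balls d vs A.
have mB : measurable B by exact: measurable_remove_balls.
have : mu B <= mu (B `\` eball v d) + mu (eball v d).
  apply: le_trans (measureU2 _ _ _).
  - apply: le_measure; rewrite ?inE//.
      apply: measurableU; last exact: measurable_eball.
      by apply: measurableD => //; exact: measurable_eball.
    by move=> w Bw; have [?|?] := pselect (eball v d w); [right|left].
  - by apply: measurableD => //; exact: measurable_eball.
  - exact: measurable_eball.
move=> h; apply: (@le_trans _ _ (mu (B `\` eball v d) + e%:E + ((size vs)%:R * e)%:E)).
  by rewrite leeD2r//; apply: le_trans h _; rewrite leeD2l.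
by rewrite -addeA -EFinD -[in leRHS]natr1 mulrDl mul1r (addrC _ e).
Qed.

(** Greedy choice: the balls removed so far leave mass at least m/2, on which G cannot exceed the
    threshold everywhere, since its integral would be at least I + eta. The slack eta > 0 makes this
    an immediate contradiction. *)
Lemma separated_points (A : set (R * R)) (G : R * R -> R) (m e d I eta : R) (k : nat) :
  measurable A -> measurable_fun setT G -> (forall w, 0 <= G w)%R ->
  (0 < m)%R -> (0 <= e)%R -> m%:E <= mu A -> (forall v, mu (eball v d) <= e%:E) ->
  (k%:R * e <= m / 2)%R -> \int[mu]_(w in A) (G w)%:E <= I%:E -> (0 < eta)%R ->
  exists vs : seq (R * R), [/\ size vs = k,
    forall v, v \in vs -> A v /\ (G v <= 2 / m * (I + eta))%R &
    pairwise (fun v w => d <= edist v w)%R vs].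
Proof.
move=> mA mG G0 m0 e0 mAm mue + GI eta0; elim: k => [_|k ih ke]; first by exists [::].
have ke' : (k%:R * e <= m / 2)%R.
  by apply: le_trans ke; rewrite ler_wpM2r// ler_nat.
have [vs [vsk hvs sep]] := ih ke'.
set B := remove_balls d vs A.
have mB : measurable B by exact: measurable_remove_balls.
have muB : (m / 2)%:E <= mu B.
  have := measure_remove_balls vs mA mue; rewrite vsk -/B.
  move=> /(le_trans mAm) h; rewrite -(leeD2rE _ _ (_ : (k%:R * e)%:E \is a fin_num))//.
  apply: le_trans h; rewrite -EFinD lee_fin; lra.
have I0 : (0 <= I)%R.
  rewrite -lee_fin; apply: le_trans GI.
  by apply: integral_ge0 => w _; rewrite lee_fin.
have [[w [Bw Gw]]|noB] :=
    pselect (exists w, B w /\ (G w <= 2 / m * (I + eta))%R).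
  have [Aw sepw] := remove_ballsP Bw.
  exists (w :: vs); split => /=; first by rewrite vsk.
    by move=> v; rewrite inE => /predU1P[->|/hvs].
  by rewrite sep andbT; apply/allP => v /sepw; rewrite eucl_distC.
exfalso; have : (I + eta)%:E <= I%:E; last by rewrite lee_fin; lra.
apply: le_trans GI.
apply: (@le_trans _ _ (\int[mu]_(w in B) (G w)%:E)); last first.
  apply: ge0_subset_integral => //.
  - apply: measurable_funTS; exact/measurable_EFinP.
  - by move=> w _; rewrite lee_fin.
  - by move=> w /remove_ballsP[].
apply: (@le_trans _ _ (\int[mu]_(w in B) (2 / m * (I + eta))%:E)).
  rewrite integral_cst//.
  apply: (@le_trans _ _ ((2 / m * (I + eta))%:E * (m / 2)%:E)).
    rewrite -EFinM lee_fin le_eqVlt; apply/orP; left; apply/eqP.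
    by field; rewrite gt_eqF.
  rewrite lee_wpmul2l// lee_fin mulr_ge0 ?addr_ge0 ?(ltW eta0)//.
  by rewrite divr_ge0 ?(ltW m0).
apply: ge0_integral_mono => w Bw.
  rewrite lee_fin mulr_ge0 ?addr_ge0 ?(ltW eta0)//.
  by rewrite divr_ge0 ?(ltW m0).
rewrite lee_fin leNgt; apply/negP => Gw; apply: noB; exists w; split => //.
exact: ltW.
Qed.

End separated_points.

Section sampling_measure.
Context {R : realType}.
Local Open Scope ereal_scope.
Let leb2 := (@lebesgue_measure R \x @lebesgue_measure R)%E.

(** For an arbitrary measure: regularity is represented by the last hypothesis, that small balls
    have uniformly small mass. *)
Lemma sampling_measure_bounds (mu : {measure set (R * R)%type -> \bar R})
    (p r m M : R) :
  (1 <= p)%R -> (0 < r)%R -> (0 < m)%R ->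
  (forall z, m%:E <= mu (eball z r) <= M%:E) ->
  (forall e, (0 < e)%R -> exists2 d, (0 < d)%R & forall z, mu (eball z d) <= e%:E) ->
  exists A B : R, [/\ (0 < A)%R, (0 < B)%R &
    forall f, tempered_distribution f ->
      let H z := normc (stft (@gaussian R) f z) in
      measurable_fun setT H ->
      \int[leb2]_z (H z `^ p)%:E < +oo ->
      A%:E * \int[leb2]_z (H z `^ p)%:E <= \int[mu]_z (H z `^ p)%:E <=
      B%:E * \int[leb2]_z (H z `^ p)%:E].
Proof.
move=> p1 r0 m0 muM conc.
have p0 : (0 < p)%R by lra.
have pi0 := @pi_gt0 R.
have muM' z : mu (eball z r) <= M%:E by have /andP[] := muM z.
have mum z : m%:E <= mu (eball z r) by have /andP[] := muM z.
have M0 : (0 < M)%R.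
  rewrite -lte_fin; apply: lt_le_trans (muM' (0, 0)%R).
  by apply: lt_le_trans (mum (0, 0)%R); rewrite lte_fin.
have mu_sf := sigma_finite_of_balls r0 muM'.
set E := expR (pi * (18 * r) ^+ 2).
have E0 : (0 < E)%R by exact: expR_gt0.
pose theta k := (3 `^ p * (2^-1 ^+ k * 2 * E) `^ p)%R.
have theta0 k : (0 < theta k)%R.
  by rewrite mulr_gt0 ?powR_gt0// !mulr_gt0// exprn_gt0.
have [k hk] : exists k, (theta k <= 2^-1)%R.
  (* 12 E < 2^k makes 3 (2^-k 2 E) at most 1/2, and a power p >= 1 of a number in (0, 1] does not
     increase it. *)
  exists (Num.bound (12 * E)); rewrite /theta; set k := Num.bound _.
  have hE : (12 * E < 2 ^+ k)%R.
    apply: lt_trans (archi_boundP _) _; first by rewrite mulr_ge0// ltW.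
    by rewrite -natrX ltr_nat ltn_expl.
  have h3 : (0 < 2^-1 ^+ k * 2 * E :> R)%R by rewrite !mulr_gt0 ?exprn_gt0.
  have h4 : (3 * (2^-1 ^+ k * 2 * E) <= 2^-1)%R.
    have -> : (3 * (2^-1 ^+ k * 2 * E) = (12 * E) / 2 ^+ k / 2)%R.
      by rewrite exprVn; move: (_ ^-1)%R => u; lra.
    rewrite -[leRHS]mul1r ler_pM2r ?invr_gt0//.
    by rewrite ler_pdivrMr ?exprn_gt0// mul1r ltW.
  rewrite -powRM ?(ltW h3)//; apply: (le_trans _ h4); apply: ge1r_powR => //.
  rewrite mulr_gt0//=; apply: (le_trans h4); lra.
(* k removed balls take at most half of m together; k + 1 keeps the quotient meaningful for k =
   0. *)
have e0 : (0 < m / 2 / k.+1%:R)%R by rewrite !divr_gt0// ltr0n.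
have [d d0 mud] := conc _ e0.
pose D := (3 `^ p * (interp_const (2 * pi * r) (2 * pi * d) k * E) `^ p)%R.
have D0 : (0 <= D)%R by rewrite mulr_ge0 ?powR_ge0.
(* 2/m is the Chebyshev threshold of [separated_points]; adding 1 keeps C positive even if D is
   0. *)
pose C := (D * (2 / m) + 1)%R.
have C0 : (0 < C)%R by rewrite ltr_wpDl// mulr_ge0// divr_ge0// ltW.
pose A := ((2 * (C * (4 * r ^+ 2) + 1))^-1)%R.
have A0 : (0 < A)%R.
  by rewrite invr_gt0 mulr_gt0// ltr_wpDl// mulr_ge0 ?(ltW C0)// mulr_ge0// sqr_ge0.
pose B := (M * theta 0%N / r ^+ 2)%R.
have B0 : (0 < B)%R by rewrite divr_gt0 ?exprn_gt0// mulr_gt0.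
exists A, B; split => // f f_tempered H mH Hoo.
have H0 z : (0 <= H z)%R by exact: normc_ge0.
pose G z := (H z `^ p)%:E.
have mHp : measurable_fun setT (fun z => H z `^ p)%R.
  exact: measurableT_comp (measurable_powR p) mH.
have mG : measurable_fun setT G by exact/measurable_EFinP.
have G0 z : 0 <= G z by rewrite lee_fin powR_ge0.
pose S z := limn_einf (EFin \o (circle_mean p (18 * r) H ^~ z)).
have SI := circle_mean_fatou p (18 * r) mH H0.
have S0 z : 0 <= S z.
  rewrite /S limn_einf_lim (cvg_lim _ (@cvg_einfs_sup _ _))//.
  apply: le_trans (ereal_sup_ubound _); last by exists 0%N.
  apply: le_ereal_inf_tmp => _ [n _ <-] /=; rewrite lee_fin mulr_ge0 ?invr_ge0//.
  by apply: sumr_ge0 => j _; exact: powR_ge0.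
have mS : measurable_fun setT S.
  apply: measurableT_comp; first exact: oppe_measurable.
  apply: (measurable_fun_limn_esup (f := fun n z =>
    - (circle_mean p (18 * r) H n z)%:E)) => n.
  apply: measurableT_comp; first exact: oppe_measurable.
  by apply/measurable_EFinP; exact: measurable_circle_mean.
(* With k = 0 there are no nodes: separation 1 and bound 0 are dummies, and the estimate holds at
   every w of the ball. *)
have upper w z : (edist w z < r)%R -> G w <= (theta 0%N)%:E * S z.
  move=> wz; apply: le_limn_einf => // e e1.
  have [n0 hn0] := @interpolation_local_powR R f f_tempered p 0 r 1 0 e z
    p1 r0 ltr01 e1 (lexx _).
  exists n0 => n nn0.
  have := hn0 n nn0 [::] erefl _ _ w (ltW wz).
  by rewrite mulr0 addr0; exact.
have lower z : G z <= (theta k)%:E * S z + C%:E * \int[mu]_(w in eball z r) G w.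
  have J0 : 0 <= \int[mu]_(w in eball z r) G w by exact: integral_ge0.
  have [Joo|Jfin] := eqVneq (\int[mu]_(w in eball z r) G w) +oo.
    rewrite Joo gt0_muley ?lte_fin// addey ?leey// -ltNye.
    by apply: lt_le_trans (mule_ge0 _ (S0 z)); rewrite ?ltNy0// lee_fin ltW.
  set J := \int[mu]_(w in _) _ in J0 Jfin *.
  have Jf : J \is a fin_num by rewrite ge0_fin_numE// ltey.
  rewrite -(fineK Jf) -EFinM -leeBlDr// -EFinB.
  apply: le_limn_einf => // e e1.
  (* C eta is at most e/2; the other half of e is the interpolation error. *)
  have eta0 : (0 < e / 2 / (C + 1))%R by rewrite !divr_gt0//; lra.
  set eta := (e / 2 / (C + 1))%R in eta0.
  have km : (k%:R * (m / 2 / k.+1%:R) <= m / 2)%R.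
    rewrite mulrCA ler_piMr ?divr_ge0 ?(ltW m0)// ler_pdivrMr ?ltr0n// mul1r.
    by rewrite ler_nat.
  have JJ : \int[mu]_(w in eball z r) (H w `^ p)%:E <= (fine J)%:E.
    by rewrite fineK.
  have [vs [vsk hvs sep]] := @separated_points R mu (eball z r) (fun w => H w `^ p)%R
    m (m / 2 / k.+1%:R) d (fine J) eta k (measurable_eball z r) mHp
    (fun w => powR_ge0 _ _) m0 (ltW e0) (mum z) mud
    km JJ eta0.
  have e2 : (0 < e / 2)%R by rewrite divr_gt0.
  have m'0 : (0 <= 2 / m * (fine J + eta))%R.
    by rewrite mulr_ge0// ?divr_ge0 ?(ltW m0)// addr_ge0 ?fine_ge0// ltW.
  have [n0 hn0] := @interpolation_local_powR R f f_tempered p k r d _ _ z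
    p1 r0 d0 e2 m'0.
  exists n0 => n nn0.
  have hvs' v : v \in vs -> (edist v z <= r)%R /\ (H v `^ p <= 2 / m * (fine J + eta))%R.
    by move=> /hvs[vr ?]; split=> //; rewrite eucl_distC ltW.
  have zz : (edist z z <= r)%R.
    by rewrite /edist !subrr expr0n addr0 sqrtr0 ltW.
  have := hn0 n nn0 vs vsk hvs' sep z zz.
  rewrite -/E -/(theta k) -/D -/H.
  set P := (H z `^ p)%R; set Q := circle_mean _ _ _ _ _ => h.
  rewrite lerBlDr; apply: le_trans h _.
  have : (D * (2 / m * (fine J + eta)) <= C * fine J + C * eta)%R.
    rewrite mulrA -mulrDr ler_wpM2r ?addr_ge0 ?fine_ge0 ?(ltW eta0)//.
    by rewrite /C lerDl.
  have : (C * eta <= e / 2)%R.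
    rewrite /eta mulrCA ler_piMr ?(ltW e2)// ler_pdivrMr ?mul1r; lra.
  lra.
set I := \int[leb2]_z G z in Hoo SI *; set K := \int[mu]_z G z.
have I0 : 0 <= I by exact: integral_ge0.
apply/andP; split.
  have h1 : I <= (theta k)%:E * \int[leb2]_z S z +
      C%:E * \int[leb2]_z \int[mu]_(w in eball z r) G w.
    have mJ := measurable_ball_integral mu_sf r mG G0.
    have J0 z : 0 <= \int[mu]_(w in eball z r) G w by exact: integral_ge0.
    have tS0 z : 0 <= (theta k)%:E * S z by rewrite mule_ge0// lee_fin ltW.
    have CJ0 z : 0 <= C%:E * \int[mu]_(w in eball z r) G w.
      by rewrite mule_ge0// lee_fin ltW.
    rewrite -ge0_integralZl//; last by rewrite lee_fin ltW.
    rewrite -ge0_integralZl//; last by rewrite lee_fin ltW.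
    rewrite -ge0_integralD//.
    - by apply: ge0_integral_mono => z _; [exact: G0|exact: lower].
    - exact: measurable_funeM.
    - exact: measurable_funeM.
  have h2 := local_integral_bound mu_sf r0 mG G0.
  have h3 : I <= 2^-1%:E * I + (C * (4 * r ^+ 2))%:E * K.
    apply: le_trans h1 _; apply: leeD.
      apply: (@le_trans _ _ ((theta k)%:E * I)).
        by rewrite lee_wpmul2l// lee_fin ltW.
      by rewrite lee_wpmul2r// lee_fin.
    by rewrite EFinM -muleA lee_wpmul2l// lee_fin ltW.
  have [->|Kfin] := eqVneq K +oo; first exact: leey.
  have K0 : 0 <= K by exact: integral_ge0.
  have Kf : K \is a fin_num by rewrite ge0_fin_numE// ltey.
  (* Finiteness of I is what allows I/2 to be moved to the left-hand side. *)
  have If : I \is a fin_num by rewrite ge0_fin_numE.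
  move: h3 K0; rewrite -(fineK Kf) -(fineK If) -!EFinM -EFinD !lee_fin => h3 K0.
  have c0 : (0 <= C * (4 * r ^+ 2))%R.
    by rewrite mulr_ge0 ?(ltW C0)// mulr_ge0// sqr_ge0.
  rewrite /A mulrC ler_pdivrMr; last by lra.
  move: h3 c0; move: (C * (4 * r ^+ 2))%R => c h3 c0; nra.
have K1 : (r ^+ 2)%:E * K <= M%:E * \int[leb2]_z ((theta 0%N)%:E * S z).
  apply: (ball_majorant r0 muM' mG G0) => //.
  - exact: measurable_funeM.
  - by move=> z; rewrite mule_ge0// lee_fin ltW.
have r20 : (0 < r ^+ 2)%R by rewrite exprn_gt0.
have K2 : M%:E * \int[leb2]_z ((theta 0%N)%:E * S z) <= (M * theta 0%N)%:E * I.
  rewrite ge0_integralZl//; last by rewrite lee_fin ltW.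
  have M0' : 0 <= M%:E by rewrite lee_fin ltW.
  have t0' : 0 <= (theta 0%N)%:E by rewrite lee_fin ltW.
  rewrite [in leRHS]EFinM -[leRHS]muleA.
  exact: (lee_wpmul2l M0' (lee_wpmul2l t0' SI)).
have q0 : 0 <= ((r ^+ 2)^-1)%R%:E by rewrite lee_fin invr_ge0 ltW.
have := lee_wpmul2l q0 (le_trans K1 K2).
by rewrite !muleA -!EFinM mulVf ?gt_eqF// mul1e /B [in leRHS]mulrC.
Qed.

End sampling_measure.

(** * Gabor transform of time-frequency shifts of the Gaussian *)

Section gaussian_fourier.
Context {R : realType}.
Let leb := @lebesgue_measure R.

Lemma integrable_le_EFin (f g : R -> R) : measurable_fun setT f ->
  (forall t, `|f t| <= g t) -> leb.-integrable setT (EFin \o g) ->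
  leb.-integrable setT (EFin \o f).
Proof.
move=> mf fg; apply: le_integrable => //; first exact/measurable_EFinP.
by move=> t _; rewrite /= lee_fin (le_trans (fg t))// ler_norm.
Qed.

Lemma integrable_EFinZ (c : R) (f : R -> R) :
  leb.-integrable setT (EFin \o f) ->
  leb.-integrable setT (EFin \o (fun t => c * f t)).
Proof. by move=> If; exact: (integrableZl measurableT c If). Qed.

Lemma integrable_EFinD (f g : R -> R) : leb.-integrable setT (EFin \o f) ->
  leb.-integrable setT (EFin \o g) ->
  leb.-integrable setT (EFin \o (fun t => f t + g t)).
Proof. by move=> If Ig; exact: (integrableD measurableT If Ig). Qed.

Lemma integrable_EFinB (f g : R -> R) : leb.-integrable setT (EFin \o f) ->
  leb.-integrable setT (EFin \o g) ->
  leb.-integrable setT (EFin \o (fun t => f t - g t)).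
Proof. by move=> If Ig; exact: (integrableB measurableT If Ig). Qed.

Lemma integrable_gauss (a : R) (x : R) : 0 < a ->
  leb.-integrable setT (EFin \o (fun t => expR (- (a * (t - x) ^+ 2)))).
Proof.
move=> a0; pose s := Num.sqrt (2 * a)^-1.
have s0 : s != 0 by rewrite gt_eqF// sqrtr_gt0 invr_gt0 mulr_gt0.
have := integrable_EFinZ (normal_peak s)^-1 (integrable_normal_pdf x s).
congr (integrable _ _ _); apply/funext => t /=; congr (_%:E).
rewrite normal_pdfE// mulKf ?gt_eqF ?normal_peak_gt0//.
rewrite /normal_fun sqr_sqrtr ?invr_ge0 ?mulr_ge0 ?(ltW a0)//.
by congr expR; rewrite -mulr_natr; field; rewrite gt_eqF.
Qed.

Lemma Rintegral_gauss (a : R) (x : R) : 0 < a ->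
  \int[leb]_t expR (- (a * (t - x) ^+ 2)) = Num.sqrt (pi / a).
Proof.
(* The normal density of variance 1/(2a) is a multiple of this Gaussian, and its total mass is 1. *)
move=> a0; pose s := Num.sqrt (2 * a)^-1.
have s0 : s != 0 by rewrite gt_eqF// sqrtr_gt0 invr_gt0 mulr_gt0.
have E t : normal_pdf x s t = normal_peak s * expR (- (a * (t - x) ^+ 2)).
  rewrite normal_pdfE//; congr (_ * _).
  rewrite /normal_fun sqr_sqrtr ?invr_ge0 ?mulr_ge0 ?(ltW a0)//.
  by congr expR; rewrite -mulr_natr; field; rewrite gt_eqF.
have : \int[leb]_t normal_pdf x s t = 1 by rewrite /Rintegral integral_normal_pdf.
under eq_Rintegral do rewrite E.
rewrite RintegralZl//; last exact: integrable_gauss.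
rewrite /normal_peak sqr_sqrtr ?invr_ge0 ?mulr_ge0 ?(ltW a0)//.
have -> : (2 * a)^-1 * pi *+ 2 = pi / a by rewrite -mulr_natr; field; rewrite gt_eqF.
move=> /(congr1 (fun y => Num.sqrt (pi / a) * y)).
by rewrite mulr1 mulVKf// gt_eqF// sqrtr_gt0 divr_gt0// pi_gt0.
Qed.

Lemma Rintegral_translation (a : R) (f : R -> R) : measurable_fun setT f ->
  \int[leb]_t f (t + a) = \int[leb]_t f t.
Proof.
move=> mf; rewrite /Rintegral; congr fine.
have mE : measurable_fun setT (EFin \o f) by exact/measurable_EFinP.
rewrite integralE [RHS]integralE; congr (_ - _)%E.
  have H := @ge0_integral_translation R a _ (measurable_funepos mE) (funepos_ge0 _).
  by rewrite -[RHS]H; apply: eq_integral => x _; rewrite unlock.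
have H := @ge0_integral_translation R a _ (measurable_funeneg mE) (funeneg_ge0 _).
by rewrite -[RHS]H; apply: eq_integral => x _; rewrite unlock.
Qed.

Lemma norm_le_gauss (s : R) : `|s| * expR (- (pi * s ^+ 2)) <= 1.
Proof.
rewrite expRN ler_pdivrMr ?expR_gt0// mul1r.
apply: le_trans (expR_ge1Dx _).
have pi2 := @pi_ge2 R; rewrite -[s ^+ 2]real_normK ?num_real//.
have := sqr_ge0 (`|s| - 1); have := sqr_ge0 `|s|; nra.
Qed.

(** The phase th treats cosine and sine at once: sin x = cos (x - pi/2), so derivatives stay within
    the family. The rate 2 pi is that of a product of two copies of h_0. *)
Definition gauss_wave (b th t : R) : R := expR (- (2 * pi * t ^+ 2)) * cos (b * t + th).

Lemma is_derive_gauss (c t : R) :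
  is_derive t 1 (fun s : R => expR (- (c * s ^+ 2))) (- (2 * c * t) * expR (- (c * t ^+ 2))).
Proof.
have d2 : is_derive t 1 (fun s : R => - (c * s ^+ 2)) (- (2 * c * t)).
  by apply: is_derive_eq; rewrite /GRing.scale /= !mulr1; ring.
have := @is_derive1_comp _ expR _ t _ _ (is_derive_expR (- (c * t ^+ 2))) d2.
by move/is_derive_eq; apply; rewrite mulrC.
Qed.

Lemma is_derive_cos_affine (b th t : R) :
  is_derive t 1 (fun s : R => cos (b * s + th)) (- b * sin (b * t + th)).
Proof.
have d1 : is_derive t 1 (fun s : R => b * s + th) b.
  by apply: is_derive_eq; rewrite /GRing.scale /= mulr1 addr0.
have := @is_derive1_comp _ cos _ t _ _ (is_derive_cos (b * t + th)) d1.
by move/is_derive_eq; apply; rewrite mulrC mulrN mulNr.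
Qed.

Lemma is_derive_gauss_wave (b th t : R) : is_derive t 1 (gauss_wave b th)
  (- (4 * pi * t) * gauss_wave b th t - b * gauss_wave b (th - pi / 2) t).
Proof.
have := is_deriveM (is_derive_gauss (2 * pi) t) (is_derive_cos_affine b th t).
move/is_derive_eq; apply; rewrite /gauss_wave /GRing.scale /=.
by rewrite addrA cosBpihalf; ring.
Qed.

Lemma is_derive_gauss_wave_freq (b th t : R) :
  is_derive b 1 (fun b => gauss_wave b th t) (- (t * gauss_wave b (th - pi / 2) t)).
Proof.
have d1 := is_derive_cos_affine t th b.
have := is_deriveZ (expR (- (2 * pi * t ^+ 2))) d1.
rewrite (_ : _ \*: _ = (fun b => gauss_wave b th t)); last first.
  by apply/funext => s; rewrite /gauss_wave /= mulrC (mulrC s).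
move/is_derive_eq; apply; rewrite /gauss_wave /GRing.scale /=.
by rewrite addrA cosBpihalf (mulrC b); ring.
Qed.

Lemma norm_gauss_wave b th t : `|gauss_wave b th t| <= expR (- (2 * pi * t ^+ 2)).
Proof.
by rewrite normrM ger0_norm ?expR_ge0// ler_piMr ?expR_ge0// cos_max.
Qed.

Lemma norm_mul_gauss_wave b th t : `|t * gauss_wave b th t| <= expR (- (pi * t ^+ 2)).
Proof.
rewrite normrM; apply: (@le_trans _ _ (`|t| * expR (- (2 * pi * t ^+ 2)))).
  by rewrite ler_wpM2l// norm_gauss_wave.
have -> : - (2 * pi * t ^+ 2) = - (pi * t ^+ 2) + - (pi * t ^+ 2) by ring.
by rewrite expRD mulrA ler_piMl ?expR_ge0// norm_le_gauss.
Qed.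

Lemma continuous_gauss_wave b th : continuous (gauss_wave b th).
Proof.
move=> t; apply/differentiable_continuous/derivable1_diffP.
exact: (@ex_derive _ _ _ _ _ _ _ (is_derive_gauss_wave b th t)).
Qed.

Lemma measurable_gauss_wave b th : measurable_fun setT (gauss_wave b th).
Proof. by apply: continuous_measurable_fun; exact: continuous_gauss_wave. Qed.

Lemma integrable_expR_gauss (a : R) : 0 < a ->
  leb.-integrable setT (EFin \o (fun t => expR (- (a * t ^+ 2)))).
Proof.
move=> a0; have := @integrable_gauss a 0 a0.
by under eq_fun do rewrite subr0.
Qed.

Lemma integrable_gauss_wave b th : leb.-integrable setT (EFin \o gauss_wave b th).
Proof.
apply: (@integrable_le_EFin _ (fun t => expR (- (2 * pi * t ^+ 2)))).
- exact: measurable_gauss_wave.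
- by move=> t; exact: norm_gauss_wave.
- by apply: integrable_expR_gauss; rewrite mulr_gt0// pi_gt0.
Qed.

Lemma integrable_mul_gauss_wave b th :
  leb.-integrable setT (EFin \o (fun t => t * gauss_wave b th t)).
Proof.
apply: (@integrable_le_EFin _ (fun t => expR (- (pi * t ^+ 2)))).
- by apply: measurable_funM => //; exact: measurable_gauss_wave.
- by move=> t; exact: norm_mul_gauss_wave.
- by apply: integrable_expR_gauss; exact: pi_gt0.
Qed.

(* Integration by parts over the line, in the form: the derivative at a = 0 of
   the constant function a |-> \int gauss_wave (t + a) dt vanishes. *)
Lemma gauss_wave_parts b th :
  4 * pi * \int[leb]_t (t * gauss_wave b th t) =
  - b * \int[leb]_t gauss_wave b (th - pi / 2) t.
Proof.
pose f (a t : R) := gauss_wave b th (t + a).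
have df (a t : R) : is_derive a 1 (f ^~ t)
    (- (4 * pi * (t + a)) * gauss_wave b th (t + a) -
      b * gauss_wave b (th - pi / 2) (t + a)).
  have d1 : is_derive a 1 (fun a : R => t + a) 1.
    have := @is_deriveD _ _ _ _ _ a 1 _ _ (is_derive_cst t a 1) (is_derive_id a 1).
    by rewrite add0r.
  have := @is_derive1_comp _ (gauss_wave b th) (fun a => t + a) a _ _
    (is_derive_gauss_wave b th (t + a)) d1.
  by rewrite mulr1.
have d1f a t : partial1of2 f a t = - (4 * pi * (t + a)) * gauss_wave b th (t + a) -
      b * gauss_wave b (th - pi / 2) (t + a).
  by rewrite partial1of2E; exact: (@derive_val _ _ _ _ _ _ _ (df a t)).
(* For |a| < 1, t^2 <= 2 (t + a)^2 + 2, so e^(-pi (t + a)^2) is at most e^pi e^(-pi t^2 / 2),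
   whatever a. *)
pose G (t : R) := (4 * pi + `|b|) * expR pi * expR (- (pi / 2 * t ^+ 2)).
have pi0 := @pi_gt0 R.
have I0 : `](-1)%R, 1%R[%classic (0 : R) by rewrite /= in_itv /= ltrN10 ltr01.
have J0 := @differentiation_under_integral R _ _ leb f setT measurableT 0 (-1) 1 I0.
have {J0} : derive1 (fun a => \int[leb]_t f a t) 0 = \int[leb]_t partial1of2 f 0 t.
  apply: (J0 _ _ G).
  - move=> a _; apply: (@integrable_le_EFin _
        (fun t => expR (- (2 * pi * (t - (- a)) ^+ 2)))).
    + by apply: (measurableT_comp (measurable_gauss_wave b th)); exact: measurable_funD.
    + by move=> t; rewrite opprK; exact: norm_gauss_wave.
    + by apply: integrable_gauss; rewrite mulr_gt0.
  - by move=> a t _ _; exact: (@ex_derive _ _ _ _ _ _ _ (df a t)).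
  - by move=> t; rewrite !mulr_ge0 ?expR_ge0// addr_ge0// mulr_ge0// ltW.
  - apply: integrable_EFinZ; apply: integrable_expR_gauss.
    by rewrite divr_gt0.
  - move=> a t /=; rewrite in_itv /= => /andP[a1 a2] _; rewrite d1f.
    have -> : - (4 * pi * (t + a)) * gauss_wave b th (t + a) =
      - (4 * pi * ((t + a) * gauss_wave b th (t + a))) by ring.
    apply: le_trans (ler_normB _ _) _; rewrite normrN.
    have h1 : `|(t + a) * gauss_wave b th (t + a)| <= expR (- (pi * (t + a) ^+ 2)).
      exact: norm_mul_gauss_wave.
    have h2 : `|gauss_wave b (th - pi / 2) (t + a)| <= expR (- (pi * (t + a) ^+ 2)).
      apply: le_trans (norm_gauss_wave _ _ _) _; rewrite ler_expR.
      by have := sqr_ge0 (t + a); nra.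
    have h3 : expR (- (pi * (t + a) ^+ 2)) <= expR pi * expR (- (pi / 2 * t ^+ 2)).
      rewrite -expRD ler_expR.
      have : 0 <= pi * (2 * (t + a) ^+ 2 + 2 - t ^+ 2).
        rewrite mulr_ge0 ?(ltW pi0)//.
        have := sqr_ge0 (t + 2 * a); nra.
      lra.
    have -> : G t = 4 * pi * (expR pi * expR (- (pi / 2 * t ^+ 2))) +
        `|b| * (expR pi * expR (- (pi / 2 * t ^+ 2))) by rewrite /G; ring.
    rewrite (normrM (4 * pi)) (normrM b) [`|4 * pi|]ger0_norm ?mulr_ge0 ?(ltW pi0)//.
    apply: lerD; apply: ler_wpM2l => //.
    - by rewrite mulr_ge0// ltW.
    - exact: le_trans h1 h3.
    - exact: le_trans h2 h3.
have -> : (fun a => \int[leb]_t f a t) = cst (\int[leb]_t gauss_wave b th t).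
  apply/funext => a; exact: Rintegral_translation (measurable_gauss_wave b th).
rewrite derive1_cst => E.
have {E} : 0 = \int[leb]_t (- (4 * pi) * (t * gauss_wave b th t) -
      b * gauss_wave b (th - pi / 2) t).
  rewrite [LHS]E; apply: eq_Rintegral => t _; rewrite d1f addr0; ring.
have I1 := integrable_mul_gauss_wave b th.
have I2 := integrable_gauss_wave b (th - pi / 2).
have E := @RintegralB _ _ _ leb setT (fun t => - (4 * pi) * (t * gauss_wave b th t))
  (fun t => b * gauss_wave b (th - pi / 2) t) measurableT
  (integrable_EFinZ _ I1) (integrable_EFinZ _ I2).
have E1 := @RintegralZl _ _ _ leb setT (fun t => t * gauss_wave b th t)
  (- (4 * pi)) measurableT I1.
have E2 := @RintegralZl _ _ _ leb setT (gauss_wave b (th - pi / 2)) b measurableT I2.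
rewrite E E1 E2; lra.
Qed.

(** Differentiation under the integral and integration by parts give I'(b) = -(b / (4 pi)) I(b).
    Hence I(b) e^(b^2 / (8 pi)) is constant, and its value at 0 is a Gaussian integral. *)
Lemma gauss_fourier b th : \int[leb]_t gauss_wave b th t =
  cos th * (Num.sqrt 2)^-1 * expR (- (b ^+ 2 / (8 * pi))).
Proof.
have pi0 := @pi_gt0 R.
pose I b := \int[leb]_t gauss_wave b th t.
have dI (a : R) : is_derive a 1 I (- (a / (4 * pi)) * I a).
  have Ia : `](a - 1)%R, (a + 1)%R[%classic a.
    by rewrite /= in_itv /=; apply/andP; split; lra.
  have d1f c t : partial1of2 (fun b t => gauss_wave b th t) c t =
      - (t * gauss_wave c (th - pi / 2) t).
    rewrite partial1of2E.
    exact: (@derive_val _ _ _ _ _ _ _ (is_derive_gauss_wave_freq c th t)).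
  have H1 : forall c, `](a - 1)%R, (a + 1)%R[%classic c ->
      leb.-integrable setT (EFin \o (gauss_wave c th)).
    by move=> c _; exact: integrable_gauss_wave.
  have H2 : forall c t, `](a - 1)%R, (a + 1)%R[%classic c -> setT t ->
      derivable ((fun b t => gauss_wave b th t) ^~ t) c 1.
    move=> c t _ _.
    exact: (@ex_derive _ _ _ _ _ _ _ (is_derive_gauss_wave_freq c th t)).
  have H3 : forall t : R, 0 <= expR (- (pi * t ^+ 2)) by move=> t; exact: expR_ge0.
  have H4 := integrable_expR_gauss pi0.
  have H5 : forall c t, `](a - 1)%R, (a + 1)%R[%classic c -> setT t ->
      `|partial1of2 (fun b t => gauss_wave b th t) c t| <= expR (- (pi * t ^+ 2)).
    by move=> c t _ _; rewrite d1f normrN; exact: norm_mul_gauss_wave.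
  have dd := @derivable_under_integral R _ _ leb _ setT measurableT a _ _ Ia
    H1 H2 _ H3 H4 H5.
  have de := @differentiation_under_integral R _ _ leb _ setT measurableT a _ _ Ia
    H1 H2 _ H3 H4 H5.
  apply: DeriveDef => //; rewrite -derive1E [LHS]de.
  under eq_Rintegral do rewrite d1f -mulN1r.
  rewrite RintegralZl//; last exact: integrable_mul_gauss_wave.
  (* Two quarter turns give the phase th - pi, that is, the original wave with the opposite sign,
     which closes the equation for I. *)
  have := gauss_wave_parts a (th - pi / 2).
  under [X in _ = _ * X -> _]eq_Rintegral => t _.
    rewrite /gauss_wave addrA addrA cosBpihalf sinBpihalf mulrN -mulN1r.
    rewrite -/(gauss_wave a th t).
    over.
  rewrite RintegralZl//; last exact: integrable_gauss_wave.
  rewrite -/(I a) => E.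
  apply: (mulfI (_ : 4 * pi != 0)); first by rewrite gt_eqF// mulr_gt0.
  rewrite mulrCA E; move: (I a) => y; move: (pi) pi0 => q q0.
  by field; rewrite gt_eqF.
have dE (a : R) : is_derive a 1 (fun b : R => I b * expR (- (- (8 * pi)^-1 * b ^+ 2))) 0.
  have := is_deriveM (dI a) (is_derive_gauss (- (8 * pi)^-1) a).
  move/is_derive_eq; apply; rewrite /GRing.scale /=.
  move: (I a) (expR _) => y x; move: (pi) pi0 => q q0.
  by field; rewrite gt_eqF.
have := @is_derive_0_is_cst _ _ b 0 dE.
rewrite expr0n mulr0 oppr0 expR0 mulr1.
have -> : I 0 = cos th * (Num.sqrt 2)^-1.
  rewrite /I; transitivity (\int[leb]_t (cos th * expR (- (2 * pi * (t - 0) ^+ 2)))).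
    by apply: eq_Rintegral => t _; rewrite /gauss_wave mul0r add0r subr0 mulrC.
  have pp : 0 < 2 * pi :> R by rewrite mulr_gt0.
  rewrite RintegralZl//; last exact: integrable_gauss.
  rewrite Rintegral_gauss//; congr (_ * _).
  by rewrite invfM mulrCA divff ?mulr1 ?gt_eqF// sqrtrV.
move=> <-; rewrite -mulrA -expRD -[LHS]mulr1 -expR0; congr (_ * expR _).
by rewrite mulrC; lra.
Qed.

End gaussian_fourier.

(** * Shifted Gaussians as tempered distributions *)

Section gaussian_pairing.
Context {R : realType}.
Let leb := @lebesgue_measure R.
Implicit Types (z w : R * R) (u v : R -> R[i]).

Lemma ReD (x y : R[i]) : complex.Re (x + y) = complex.Re x + complex.Re y.
Proof. by case: x y => [? ?] []. Qed.

Lemma ImD (x y : R[i]) : complex.Im (x + y) = complex.Im x + complex.Im y.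
Proof. by case: x y => [? ?] []. Qed.

Lemma ReM (x y : R[i]) : complex.Re (x * y) =
  complex.Re x * complex.Re y - complex.Im x * complex.Im y.
Proof. by case: x y => [? ?] []. Qed.

Lemma ImM (x y : R[i]) : complex.Im (x * y) =
  complex.Re x * complex.Im y + complex.Im x * complex.Re y.
Proof. by case: x y => [? ?] []. Qed.

Lemma norm_Re_le (x : R[i]) : `|complex.Re x| <= normc x.
Proof.
by case: x => a b /=; rewrite -sqrtr_sqr ler_wsqrtr// lerDl sqr_ge0.
Qed.

Lemma norm_Im_le (x : R[i]) : `|complex.Im x| <= normc x.
Proof.
by case: x => a b /=; rewrite -sqrtr_sqr ler_wsqrtr// lerDr sqr_ge0.
Qed.

(** The function pi(z) h_0 itself; the sign of the frequency compensates the conjugation in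
    [gauss_shift]. *)
Definition gauss_kernel z : R -> R[i] := gauss_shift (z.1, - z.2).

(* u |-> \int u (pi(z) h_0), which represents the function pi(z) h_0. *)
Definition gauss_pairing z u : R[i] :=
  (\int[leb]_t complex.Re (u t * gauss_kernel z t)) +i*
  (\int[leb]_t complex.Im (u t * gauss_kernel z t)).

(** A class containing the Schwartz functions, on which the pairing is given by convergent
    integrals; it is used to treat differences of Schwartz functions by linearity. *)
Definition bounded_measurable u : Prop :=
  [/\ measurable_fun setT (fun t => complex.Re (u t)),
      measurable_fun setT (fun t => complex.Im (u t)) &
      exists C : R, forall t, normc (u t) <= C].

Lemma cder_measurable u v : cder u v ->
  measurable_fun setT (fun t => complex.Re (u t)) /\
  measurable_fun setT (fun t => complex.Im (u t)).
Proof.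
move=> uv; split; apply: continuous_measurable_fun => t;
  apply/differentiable_continuous/derivable1_diffP.
  exact: (@ex_derive _ _ _ _ _ _ _ (uv t).1).
exact: (@ex_derive _ _ _ _ _ _ _ (uv t).2).
Qed.

Lemma schwartz_normc_le u (C : R) : (schwartz_seminorm 0 0 u <= C%:E)%E ->
  forall t, normc (u t) <= C.
Proof.
move=> uC t; rewrite -lee_fin; apply: le_trans uC; apply: ereal_sup_ubound.
by exists t => //=; rewrite expr0 mul1r.
Qed.

Lemma schwartz_bounded_measurable u : schwartz u -> bounded_measurable u.
Proof.
move=> [su nu]; split.
- apply: continuous_measurable_fun => t.
  by apply/differentiable_continuous/derivable1_diffP; exact: (su 0%N t).1.
- apply: continuous_measurable_fun => t.
  by apply/differentiable_continuous/derivable1_diffP; exact: (su 0%N t).2.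
exists (fine (schwartz_seminorm 0 0 u)); apply: schwartz_normc_le.
rewrite fineK// fin_real// nu andbT.
apply: lt_le_trans (_ : 0 <= _)%E; first by rewrite ltNy0.
apply: le_trans (ereal_sup_ubound _); last by exists 0.
by rewrite lee_fin mulr_ge0 ?exprn_ge0 ?normc_ge0.
Qed.

Lemma measurable_gauss_kernel z :
  measurable_fun setT (fun t => complex.Re (gauss_kernel z t)) /\
  measurable_fun setT (fun t => complex.Im (gauss_kernel z t)).
Proof. exact: cder_measurable (cder_gauss_shift _). Qed.

Lemma bounded_measurableD (a : R[i]) u v :
  bounded_measurable u -> bounded_measurable v ->
  bounded_measurable (fun t => a * u t + v t).
Proof.
move=> [ru iu [C uC]] [rv iv [D vD]]; split.
- under eq_fun do rewrite ReD ReM.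
  by apply: measurable_funD => //; apply: measurable_funB; exact: measurable_funM.
- under eq_fun do rewrite ImD ImM.
  by apply: measurable_funD => //; apply: measurable_funD; exact: measurable_funM.
exists (normc a * C + D) => t; apply: le_trans (le_normcD _ _) _.
by rewrite normcM lerD// ler_wpM2l// normc_ge0.
Qed.

Let envelope z (t : R) : R := 2 `^ 4^-1 * expR (- (pi * (t - z.1) ^+ 2)).

Let integrable_envelope z : leb.-integrable setT (EFin \o envelope z).
Proof. by apply: integrable_EFinZ; apply: integrable_gauss; exact: pi_gt0. Qed.

Let Rintegral_envelope z : \int[leb]_t envelope z t = 2 `^ 4^-1.
Proof.
rewrite /envelope RintegralZl//; last by apply: integrable_gauss; exact: pi_gt0.
by rewrite Rintegral_gauss ?pi_gt0// divff ?sqrtr1 ?mulr1// gt_eqF// pi_gt0.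
Qed.

Let normc_kernel z t : normc (gauss_kernel z t) = envelope z t.
Proof. exact: normc_gauss_shift. Qed.

Lemma gauss_pairing_integrable z u : bounded_measurable u ->
  leb.-integrable setT (EFin \o (fun t => complex.Re (u t * gauss_kernel z t))) /\
  leb.-integrable setT (EFin \o (fun t => complex.Im (u t * gauss_kernel z t))).
Proof.
move=> [ru iu [C uC]]; have [rk ik] := measurable_gauss_kernel z.
have H t : normc (u t * gauss_kernel z t) <= C * envelope z t.
  rewrite normcM normc_kernel ler_wpM2r// mulr_ge0 ?powR_ge0 ?expR_ge0//.
have IC := integrable_EFinZ C (integrable_envelope z).
split; apply: (integrable_le_EFin _ _ IC).
- under eq_fun do rewrite ReM.
  by apply: measurable_funB; exact: measurable_funM.
- by move=> t; apply: le_trans (norm_Re_le _) _.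
- under eq_fun do rewrite ImM.
  by apply: measurable_funD; exact: measurable_funM.
- by move=> t; apply: le_trans (norm_Im_le _) _.
Qed.

Lemma gauss_pairing_linear z (a : R[i]) u v :
  bounded_measurable u -> bounded_measurable v ->
  gauss_pairing z (fun t => a * u t + v t) =
  a * gauss_pairing z u + gauss_pairing z v.
Proof.
move=> bu bv; have [ru iu] := gauss_pairing_integrable z bu.
have [rv iv] := gauss_pairing_integrable z bv.
rewrite /gauss_pairing; apply/eqP; rewrite eq_complex; apply/andP; split; apply/eqP.
  rewrite [RHS]ReD ReM /=.
  transitivity (\int[leb]_t ((complex.Re a * complex.Re (u t * gauss_kernel z t) -
      complex.Im a * complex.Im (u t * gauss_kernel z t)) +
      complex.Re (v t * gauss_kernel z t))).
    by apply: eq_Rintegral => t _; rewrite mulrDl ReD -mulrA (ReM a).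
  rewrite RintegralD//; last first.
    by apply: integrable_EFinB; exact: integrable_EFinZ.
  rewrite RintegralB//; [|exact: integrable_EFinZ..].
  by rewrite !RintegralZl.
rewrite [RHS]ImD ImM /=.
transitivity (\int[leb]_t ((complex.Re a * complex.Im (u t * gauss_kernel z t) +
    complex.Im a * complex.Re (u t * gauss_kernel z t)) +
    complex.Im (v t * gauss_kernel z t))).
  by apply: eq_Rintegral => t _; rewrite mulrDl ImD -mulrA (ImM a).
rewrite RintegralD//; last first.
  by apply: integrable_EFinD; exact: integrable_EFinZ.
rewrite RintegralD//; [|exact: integrable_EFinZ..].
by rewrite !RintegralZl.
Qed.

Lemma normc_gauss_pairing_le z u (C : R) : bounded_measurable u ->
  (forall t, normc (u t) <= C) ->
  normc (gauss_pairing z u) <= 2 * C * 2 `^ 4^-1.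
Proof.
move=> bu uC; have [ru iu] := gauss_pairing_integrable z bu.
have H t : normc (u t * gauss_kernel z t) <= C * envelope z t.
  rewrite normcM normc_kernel ler_wpM2r// mulr_ge0 ?powR_ge0 ?expR_ge0//.
have IC := integrable_EFinZ C (integrable_envelope z).
have bound (g : R -> R) : leb.-integrable setT (EFin \o g) ->
    (forall t, `|g t| <= C * envelope z t) ->
    `|\int[leb]_t g t| <= C * 2 `^ 4^-1.
  move=> Ig gC; apply: le_trans (le_normr_Rintegral _ _) _ => //.
  rewrite -(Rintegral_envelope z) -RintegralZl//.
  by apply: le_Rintegral => //; exact: integrable_norm.
apply: le_trans (normc_le_ReIm _) _; rewrite -mulrA mulr_natl mulr2n.
apply: lerD; apply: bound => // t.
- exact: le_trans (norm_Re_le _) (H t).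
- exact: le_trans (norm_Im_le _) (H t).
Qed.

Lemma gauss_pairing_tempered z : tempered_distribution (gauss_pairing z).
Proof.
split=> [a g h sg sh|g sg e e0].
  by apply: gauss_pairing_linear; exact: schwartz_bounded_measurable.
set q : R := 2 `^ 4^-1; have q0 : 0 < q by rewrite powR_gt0.
(* The supremum seminorm alone controls the pairing: q is the integral of h_0, and 2 comes from
   bounding real and imaginary parts separately. *)
exists 0%N, (e / (2 * q + 1)); split; first by rewrite divr_gt0//; lra.
move=> h sh /(_ 0%N 0%N (leqnn _) (leqnn _)) /ltW /schwartz_normc_le hg.
have bg := schwartz_bounded_measurable sg.
have bh := schwartz_bounded_measurable sh.
have -> : gauss_pairing z h - gauss_pairing z g =
    gauss_pairing z (fun t => (-1) * g t + h t).
  by rewrite gauss_pairing_linear// mulN1r addrC.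
apply: le_lt_trans (_ : 2 * (e / (2 * q + 1)) * q < e).
  apply: normc_gauss_pairing_le; first exact: bounded_measurableD.
  by move=> t; rewrite mulN1r addrC; exact: hg.
have -> : 2 * (e / (2 * q + 1)) * q = e * (2 * q / (2 * q + 1)) by ring.
rewrite gtr_pMr// ltr_pdivrMr; lra.
Qed.

(** The product of the two Gaussians is a Gaussian of rate 2 pi about the midpoint c, times sqrt 2
    e^(-pi (w_1 - z_1)^2 / 2); what remains is [gauss_fourier] at the frequency difference b. *)
Lemma stft_gauss_pairing z w : stft (@gaussian R) (gauss_pairing z) w =
  (expR (- (pi / 2 * ((w.1 - z.1) ^+ 2 + (w.2 - z.2) ^+ 2))))%:C *
  cis (pi * (z.2 - w.2) * (w.1 + z.1)).
Proof.
have pi0 := @pi_gt0 R.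
pose b : R := 2 * pi * (z.2 - w.2).
pose c : R := (w.1 + z.1) / 2.
pose D : R := Num.sqrt 2 * expR (- (pi / 2 * (w.1 - z.1) ^+ 2)).
have s2 : (2 `^ 4^-1 * 2 `^ 4^-1 = Num.sqrt 2 :> R).
  rewrite -powR12_sqrt// -powRD; last by rewrite pnatr_eq0 implybT.
  by congr (_ `^ _); field.
have E t : conjc (tf_shift w (@gaussian R) t) * gauss_kernel z t =
    (D * expR (- (2 * pi * (t - c) ^+ 2)))%:C * cis (b * t).
  have conjM (x y : R[i]) : conjc (x * y) = conjc x * conjc y by exact: rmorphM.
  rewrite /tf_shift conjM /gauss_kernel /gauss_shift [(_, _).1]/= [(_, _).2]/=.
  rewrite [X in X * _ * _]/=.
  have -> : cos (2 * pi * w.2 * t) -i* sin (2 * pi * w.2 * t) =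
      cis (- (2 * pi * w.2 * t)) by rewrite /cis cosN sinN.
  have -> : cexp (0 -i* (2 * pi * - z.2)) t = cis (2 * pi * z.2 * t).
    by rewrite /cexp /= mul0r expR0 mul1r; congr cis; ring.
  have -> : cis (b * t) = cis (- (2 * pi * w.2 * t)) * cis (2 * pi * z.2 * t).
    by rewrite -cisD; congr cis; rewrite /b; ring.
  rewrite /gaussian conjc_real.
  have -> : D * expR (- (2 * pi * (t - c) ^+ 2)) =
      (2 `^ 4^-1 * expR (- (pi * (t - w.1) ^+ 2))) *
      (2 `^ 4^-1 * expR (- (pi * (t - z.1) ^+ 2))).
    rewrite [RHS]mulrACA s2 -expRD /D -[LHS]mulrA -expRD; congr (_ * expR _).
    by rewrite /c; field.
  set g1 := 2 `^ 4^-1 * expR (- (pi * (t - w.1) ^+ 2)).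
  set g2 := 2 `^ 4^-1 * expR (- (pi * (t - z.1) ^+ 2)).
  have -> : (g1 * g2)%:C = g1%:C * g2%:C by exact: rmorphM.
  by move: (cis _) (cis _) (g1%:C) (g2%:C) => x1 x2 x3 x4; ring.
have W th t : D * expR (- (2 * pi * (t - c) ^+ 2)) * cos (b * t + th) =
    D * gauss_wave b (b * c + th) (t - c).
  rewrite /gauss_wave -mulrA; congr (_ * (_ * cos _)); ring.
have I th : \int[leb]_t (D * expR (- (2 * pi * (t - c) ^+ 2)) * cos (b * t + th)) =
    expR (- (pi / 2 * ((w.1 - z.1) ^+ 2 + (w.2 - z.2) ^+ 2))) * cos (b * c + th).
  under eq_Rintegral do rewrite W.
  have mW : measurable_fun setT (fun t => D * gauss_wave b (b * c + th) t).
    by apply: measurable_funM => //; exact: measurable_gauss_wave.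
  have -> := Rintegral_translation (- c) mW.
  rewrite RintegralZl//; last exact: integrable_gauss_wave.
  rewrite gauss_fourier /D.
  have -> : Num.sqrt 2 * expR (- (pi / 2 * (w.1 - z.1) ^+ 2)) *
      (cos (b * c + th) / Num.sqrt 2 * expR (- (b ^+ 2 / (8 * pi)))) =
    (Num.sqrt 2 / Num.sqrt 2) * (expR (- (pi / 2 * (w.1 - z.1) ^+ 2)) *
       expR (- (b ^+ 2 / (8 * pi)))) * cos (b * c + th).
    by move: (expR _) (expR _) (cos _) ((Num.sqrt 2)^-1) => *; ring.
  rewrite divff ?mul1r -?expRD; last by rewrite gt_eqF// sqrtr_gt0.
  congr (expR _ * _); rewrite /b; move: (pi) pi0 => q q0.
  by field; rewrite gt_eqF.
have bc : b * c = pi * (z.2 - w.2) * (w.1 + z.1) by rewrite /b /c; field.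
have I1 : \int[leb]_t complex.Re (conjc (tf_shift w (@gaussian R) t) * gauss_kernel z t) =
    expR (- (pi / 2 * ((w.1 - z.1) ^+ 2 + (w.2 - z.2) ^+ 2))) * cos (b * c).
  rewrite -[b * c]addr0 -I; apply: eq_Rintegral => t _.
  by rewrite E /= mul0r subr0 addr0.
have I2 : \int[leb]_t complex.Im (conjc (tf_shift w (@gaussian R) t) * gauss_kernel z t) =
    expR (- (pi / 2 * ((w.1 - z.1) ^+ 2 + (w.2 - z.2) ^+ 2))) * sin (b * c).
  rewrite -cosBpihalf -I; apply: eq_Rintegral => t _.
  by rewrite E /= mul0r addr0 cosBpihalf.
rewrite /stft /gauss_pairing I1 I2 bc /cis.
by apply/eqP; rewrite eq_complex /= !mul0r subr0 addr0 !eqxx.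
Qed.

Lemma normc_stft_gauss_pairing z w : normc (stft (@gaussian R) (gauss_pairing z) w) =
  expR (- (pi / 2 * edist w z ^+ 2)).
Proof.
rewrite stft_gauss_pairing normcM normc_cis mulr1 normc_real ger0_norm ?expR_ge0//.
by rewrite /edist sqr_sqrtr// addr_ge0// sqr_ge0.
Qed.

Lemma measurable_stft_gauss_pairing z :
  measurable_fun [set: R * R] (fun w => complex.Re (stft (@gaussian R) (gauss_pairing z) w)) /\
  measurable_fun [set: R * R] (fun w => complex.Im (stft (@gaussian R) (gauss_pairing z) w)).
Proof.
have m1 : measurable_fun [set: R * R] (fun w => w.1 - z.1) by exact: measurable_funB.
have m2 : measurable_fun [set: R * R] (fun w => w.2 - z.2) by exact: measurable_funB.
have mE : measurable_fun [set: R * R] (fun w =>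
    expR (- (pi / 2 * ((w.1 - z.1) ^+ 2 + (w.2 - z.2) ^+ 2)))).
  apply: measurableT_comp => //; apply: measurable_funN; apply: measurable_funM => //.
  by apply: measurable_funD; exact: measurable_funX.
have mA : measurable_fun [set: R * R] (fun w =>
    pi * (z.2 - w.2) * (w.1 + z.1)).
  apply: measurable_funM; last exact: measurable_funD.
  by apply: measurable_funM => //; exact: measurable_funB.
have mcos : measurable_fun [set: R] (@cos R).
  by apply: continuous_measurable_fun; exact: continuous_cos.
have msin : measurable_fun [set: R] (@sin R).
  by apply: continuous_measurable_fun; exact: continuous_sin.
split; under eq_fun do rewrite stft_gauss_pairing /= mul0r ?subr0 ?addr0.
  by apply: measurable_funM => //; exact: measurableT_comp mcos mA.
by apply: measurable_funM => //; exact: measurableT_comp msin mA.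
Qed.

End gaussian_pairing.

(** * Mass bounds from sampling inequalities *)

Section necessity.
Context {R : realType}.
Local Open Scope ereal_scope.
Let leb := @lebesgue_measure R.
Let leb2 := (leb \x leb)%E.

Definition gauss_bump (a : R) (z w : R * R) : R := expR (- (a * edist w z ^+ 2)).

Lemma gauss_bump_ge0 a z w : 0 <= (gauss_bump a z w)%:E.
Proof. by rewrite lee_fin expR_ge0. Qed.

Lemma measurable_gauss_bump a z : measurable_fun setT (fun w => (gauss_bump a z w)%:E).
Proof.
apply/measurable_EFinP; apply: measurableT_comp => //; apply: measurable_funN.
apply: measurable_funM => //; apply: measurable_funX.
by apply: measurable_edist; [exact: measurable_id|exact: measurable_cst].
Qed.

Lemma gauss_bump_integral (a : R) (z : R * R) : (0 < a)%R ->
  \int[leb2]_w (gauss_bump a z w)%:E = (pi / a)%:E.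
Proof.
move=> a0.
have G1 (x : R) : \int[leb]_t (expR (- (a * (t - x) ^+ 2)))%:E = (Num.sqrt (pi / a))%:E.
  have I := integrable_gauss x a0.
  have := Rintegral_gauss x a0; rewrite /Rintegral => <-.
  by rewrite fineK//; exact: (integrable_fin_num measurableT I).
have pa : (0 <= pi / a)%R by rewrite divr_ge0 ?pi_ge0// ltW.
transitivity (\int[leb]_x \int[leb]_y (gauss_bump a z (x, y))%:E).
  apply: (@fubini_tonelli1 _ _ _ _ R leb leb (fun w => (gauss_bump a z w)%:E)).
    exact: measurable_gauss_bump.
  by move=> w; exact: gauss_bump_ge0.
have E x y : (gauss_bump a z (x, y))%:E =
    (expR (- (a * (x - z.1) ^+ 2)))%:E * (expR (- (a * (y - z.2) ^+ 2)))%:E.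
  rewrite -EFinM -expRD /gauss_bump /edist sqr_sqrtr ?addr_ge0 ?sqr_ge0//=.
  by rewrite mulrDr opprD.
have mh (c : R) : measurable_fun setT (fun y : R => (expR (- (a * (y - c) ^+ 2)))%:E).
  apply/measurable_EFinP; apply: measurableT_comp => //.
  apply: measurable_funN; apply: measurable_funM => //; apply: measurable_funX.
  exact: measurable_funB.
have h0 (c : R) (y : R) : 0 <= (expR (- (a * (y - c) ^+ 2)))%:E.
  by rewrite lee_fin expR_ge0.
transitivity (\int[leb]_x ((expR (- (a * (x - z.1) ^+ 2)))%:E *
    (Num.sqrt (pi / a))%:E)).
  apply: eq_integral => x _; rewrite -(G1 z.2).
  under eq_integral do rewrite E.
  exact: (@ge0_integralZl _ _ _ leb _ measurableT _ (mh z.2) _ (fun y _ => h0 z.2 y) (h0 z.1 x)).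
have q0 : 0 <= (Num.sqrt (pi / a))%:E by rewrite lee_fin sqrtr_ge0.
rewrite (@ge0_integralZr _ _ _ leb _ measurableT _ (mh z.1) _ (fun y _ => h0 z.1 y) q0).
by rewrite G1 -EFinM -expr2 sqr_sqrtr.
Qed.

Lemma ball_bounds_of_gauss_bounds (mu : {measure set (R * R)%type -> \bar R})
    (a alpha beta : R) :
  (0 < a)%R -> (0 < alpha)%R ->
  (forall z, alpha%:E <= \int[mu]_w (gauss_bump a z w)%:E <= beta%:E) ->
  exists r m M : R, [/\ (0 < r)%R, (0 < m)%R, (0 < M)%R &
    forall z, m%:E <= mu (eball z r) <= M%:E].
Proof.
move=> a0 alpha0 H.
have Hl z : alpha%:E <= \int[mu]_w (gauss_bump a z w)%:E by have /andP[] := H z.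
have Hu z : \int[mu]_w (gauss_bump a z w)%:E <= beta%:E by have /andP[] := H z.
have beta0 : (0 < beta)%R.
  rewrite -lte_fin; apply: lt_le_trans (Hu (0, 0)%R).
  by apply: lt_le_trans (Hl (0, 0)%R); rewrite lte_fin.
have upper (r : R) z : (0 < r)%R ->
    mu (eball z r) <= (beta * expR (a * r ^+ 2))%:E.
  move=> r0; have mb := measurable_eball z r.
  have h1 : (expR (- (a * r ^+ 2)))%:E * mu (eball z r) <= beta%:E.
    apply: le_trans (Hu z).
    apply: (@le_trans _ _ (\int[mu]_(w in eball z r) (gauss_bump a z w)%:E)).
      rewrite -integral_cst//; apply: ge0_integral_mono.
        by move=> w _; rewrite lee_fin expR_ge0.
      move=> w zw; rewrite lee_fin ler_expR lerN2 ler_wpM2l ?(ltW a0)//.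
      rewrite eucl_distC; apply: lerXn2r; rewrite ?nnegrE ?eucl_dist_ge0 ?(ltW r0)//.
      exact: ltW.
    apply: ge0_subset_integral => //.
    - exact: measurable_gauss_bump.
    - by move=> w _; exact: gauss_bump_ge0.
  have e0 : 0 <= (expR (a * r ^+ 2))%:E by rewrite lee_fin expR_ge0.
  have := lee_wpmul2l e0 h1.
  by rewrite muleA -!EFinM -expRD subrr expR0 mul1e mulrC.
pose M1 := (beta * expR (a * 1 ^+ 2))%R.
have M10 : (0 < M1)%R by rewrite mulr_gt0// expR_gt0.
pose L := (M1 * (expR (a / 2) * (pi / (a / 4))))%R.
have L0 : (0 < L)%R by rewrite !mulr_gt0 ?expR_gt0 ?invr_gt0 ?pi_gt0// divr_gt0.
(* [ball_majorant] with unit balls: |u - w| < 1 gives |u - z|^2 <= 2 |w - z|^2 + 2, so halving the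
   rate to a/4 and paying e^(a/2) yields a majorant. *)
have tail z : \int[mu]_w (gauss_bump (a / 2) z w)%:E <= L%:E.
  have mK : measurable_fun setT (fun u => (expR (a / 2))%:E * (gauss_bump (a / 4) z u)%:E).
    by apply: measurable_funeM; exact: measurable_gauss_bump.
  have := @ball_majorant R mu 1 M1 (fun w => (gauss_bump (a / 2) z w)%:E)
    (fun u => (expR (a / 2))%:E * (gauss_bump (a / 4) z u)%:E) ltr01
    (fun z => upper 1%R z ltr01) (measurable_gauss_bump _ _) (gauss_bump_ge0 _ _) mK.
  rewrite expr1n mul1e => /(_ _ _)/le_trans; apply.
  - by move=> u; apply: mule_ge0; [rewrite lee_fin expR_ge0|exact: gauss_bump_ge0].
  - move=> w u wu; rewrite -EFinM lee_fin -expRD ler_expR.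
    have t1 : (edist u z <= edist w z + 1)%R.
      rewrite addrC; apply: le_trans (eucl_dist_triangle w _ _) _.
      by rewrite lerD2r eucl_distC ltW.
    have h0 := eucl_dist_ge0 u z; have h1 := eucl_dist_ge0 w z.
    have h2 : (edist u z ^+ 2 <= 2 * edist w z ^+ 2 + 2)%R.
      apply: (@le_trans _ _ ((edist w z + 1) ^+ 2)%R).
        by apply: lerXn2r; rewrite ?nnegrE// addr_ge0.
      have := sqr_ge0 (edist w z - 1)%R; lra.
    have : (0 <= a / 4 * (2 * edist w z ^+ 2 + 2 - edist u z ^+ 2))%R.
      by rewrite mulr_ge0 ?divr_ge0 ?(ltW a0)//; lra.
    lra.
  - have e0 : 0 <= (expR (a / 2))%:E by rewrite lee_fin expR_ge0.
    rewrite (@ge0_integralZl _ _ _ leb2 _ measurableT _ (measurable_gauss_bump _ _) _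
      (fun u _ => gauss_bump_ge0 _ _ u) e0).
    by rewrite gauss_bump_integral ?divr_gt0// -!EFinM.
(* Chosen so that e^(-a r^2 / 2) L <= alpha / 2, by x <= e^x and r <= r^2; the summand 1 ensures the
   latter. *)
pose r := (1 + 4 * L / (a * alpha))%R.
have r1 : (1 <= r)%R.
  by rewrite /r lerDl; apply: divr_ge0; apply: mulr_ge0 => //; exact: ltW.
have r0 : (0 < r)%R by apply: lt_le_trans r1.
have small : (expR (- (a / 2 * r ^+ 2)) * L <= alpha / 2)%R.
  rewrite expRN mulrC ler_pdivrMr ?expR_gt0//.
  have h : (a / 2 * r ^+ 2 <= expR (a / 2 * r ^+ 2))%R.
    by apply: le_trans (expR_ge1Dx _); rewrite lerDr.
  have h2 : (L <= alpha / 2 * (a / 2 * r ^+ 2))%R.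
    have -> : L = (alpha / 2 * (a / 2 * (4 * L / (a * alpha))))%R.
      by field; rewrite !gt_eqF.
    rewrite ler_wpM2l ?divr_ge0 ?(ltW alpha0)//.
    rewrite ler_wpM2l ?divr_ge0 ?(ltW a0)//.
    apply: (@le_trans _ _ r); first by rewrite /r lerDr.
    by rewrite expr2 ler_peMl// ltW.
  apply: le_trans h2 _; rewrite ler_wpM2l ?divr_ge0 ?(ltW alpha0)//.
exists r, (alpha / 2)%R, (beta * expR (a * r ^+ 2))%R; split => //.
- by rewrite divr_gt0.
- by rewrite mulr_gt0// expR_gt0.
move=> z; rewrite upper// andbT.
(* Outside the ball half of the exponent gives the small factor e^(-a r^2 / 2), and the other half
   remains an integrable bump. *)
have split_bump w : (gauss_bump a z w)%:E <= (\1_(eball z r) w)%:E +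
    (expR (- (a / 2 * r ^+ 2)))%:E * (gauss_bump (a / 2) z w)%:E.
  rewrite -EFinM -EFinD lee_fin indicE; have [wr|wr] := ltP (edist z w) r.
    rewrite mem_set//= ler_wpDr ?mulr_ge0 ?expR_ge0//.
    by rewrite -expR0 ler_expR oppr_le0 mulr_ge0 ?(ltW a0)// sqr_ge0.
  rewrite memNset; last by rewrite /eball /=; apply/negP; rewrite -leNgt.
  rewrite add0r -expRD ler_expR.
  have : (r ^+ 2 <= edist w z ^+ 2)%R.
    by rewrite eucl_distC; apply: lerXn2r; rewrite ?nnegrE ?eucl_dist_ge0 ?(ltW r0).
  move: (r ^+ 2)%R (edist w z ^+ 2)%R => x y xy.
  have : (0 <= a * (y - x))%R by rewrite mulr_ge0 ?(ltW a0)// subr_ge0.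
  lra.
have mI : measurable_fun setT (fun w : R * R => (\1_(eball z r) w : R)%:E).
  by apply/measurable_EFinP; apply: measurable_indic; exact: measurable_eball.
have mT : measurable_fun setT (fun w =>
    (expR (- (a / 2 * r ^+ 2)))%:E * (gauss_bump (a / 2) z w)%:E).
  by apply: measurable_funeM; exact: measurable_gauss_bump.
have : alpha%:E <= mu (eball z r) + (alpha / 2)%:E.
  apply: le_trans (Hl z) _.
  apply: (@le_trans _ _ (\int[mu]_w ((\1_(eball z r) w)%:E +
    (expR (- (a / 2 * r ^+ 2)))%:E * (gauss_bump (a / 2) z w)%:E))).
    by apply: ge0_integral_mono => w _; [exact: gauss_bump_ge0|exact: split_bump].
  have i0 w : setT w -> 0 <= (\1_(eball z r) w : R)%:E by rewrite lee_fin.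
  have t0 w : setT w -> 0 <= (expR (- (a / 2 * r ^+ 2)))%:E * (gauss_bump (a / 2) z w)%:E.
    by move=> _; apply: mule_ge0; [rewrite lee_fin expR_ge0|exact: gauss_bump_ge0].
  rewrite (ge0_integralD mu measurableT i0 mI t0 mT).
  rewrite integral_indic ?setIT//; last exact: measurable_eball.
  apply: leeD => //.
  have e0 : 0 <= (expR (- (a / 2 * r ^+ 2)))%:E by rewrite lee_fin expR_ge0.
  rewrite (@ge0_integralZl _ _ _ mu _ measurableT _ (measurable_gauss_bump _ _) _
    (fun u _ => gauss_bump_ge0 _ _ u) e0).
  by apply: le_trans (lee_wpmul2l e0 (tail z)) _; rewrite -EFinM lee_fin.
rewrite -leeBlDr// -EFinB; apply: le_trans; rewrite lee_fin; lra.
Qed.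

End necessity.

(** * Trajectory sets *)

Section trajectory_measurability.
Context {R : realType}.

(** Measurability refers to the product sigma-algebra; an open set is the union of the countably
    many balls with rational centres and radii 1/(k+1) that it contains. *)
Lemma open_measurable_plane (A : set (R * R)) : open A -> measurable A.
Proof.
move=> oA.
pose F (n : nat) : set (R * R) :=
  if unpickle n is Some (q1, q2, k) then
    let B := eball (ratr (q1 : rat), ratr (q2 : rat)) ((k : nat).+1%:R^-1) in
    if `[< B `<=` A >] then B else set0
  else set0.
have FE q1 q2 k : eball (ratr q1, ratr q2) k.+1%:R^-1 `<=` A ->
    F (pickle (q1, q2, k)) = eball (ratr q1, ratr q2) k.+1%:R^-1.
  by move=> BA; rewrite /F pickleK ifT//; exact/asboolP.
have mF n : measurable (F n).
  rewrite /F; case: unpickle => [[[q1 q2] k]|//] /=.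
  by case: ifP => // _; exact: measurable_eball.
suff -> : A = \bigcup_n F n by exact: bigcup_measurable.
apply/seteqP; split => [z Az|z [n _]]; last first.
  rewrite /F; case: unpickle => [[[q1 q2] k]|//] /=.
  by case: ifP => // /asboolP BA; exact: BA.
have /nbhs_ballP[e /= e0 eA] := open_nbhs_nbhs (conj oA Az).
(* A radius h with 2h < e: the rational centre has coordinates within h/2 of those of z, so its ball
   contains z and stays in the sup-norm ball of radius e. *)
pose k := Num.bound (2 / e).
have k0 : 0 < k.+1%:R :> R by rewrite ltr0n.
have ke : 2 * k.+1%:R^-1 < e.
  rewrite ltr_pdivrMr// mulrC -ltr_pdivrMr//.
  apply: (lt_trans (archi_boundP _)); first by rewrite divr_ge0// ltW.
  by rewrite ltr_nat.
set h : R := k.+1%:R^-1 in ke.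
have h0 : 0 < h by rewrite invr_gt0.
have near_rat (x : R) : exists q : rat, `|x - ratr q| < h / 2.
  have [|q] := @rat_in_itvoo R (x - h / 2) (x + h / 2); first by lra.
  rewrite in_itv /= => /andP[q1 q2]; exists q.
  by rewrite ltr_norml; apply/andP; split; lra.
have [q1 hq1] := near_rat z.1; have [q2 hq2] := near_rat z.2.
have dle (u v : R * R) : edist u v <= `|u.1 - v.1| + `|u.2 - v.2|.
  by rewrite eucl_dist_normc; exact: normc_le_ReIm.
have le1 (u v : R * R) : `|u.1 - v.1| <= edist u v.
  by rewrite eucl_dist_normc; exact: (norm_Re_le (_ +i* _)).
have le2 (u v : R * R) : `|u.2 - v.2| <= edist u v.
  by rewrite eucl_dist_normc; exact: (norm_Im_le (_ +i* _)).
refine (ex_intro2 _ _ (pickle (q1, q2, k)) I _); rewrite FE; last first.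
  move=> w; rewrite /eball /= => qw; apply: eA.
  have := le1 (ratr q1, ratr q2) w; have := le2 (ratr q1, ratr q2) w => /= a2 a1.
  split; rewrite /ball /=.
    have -> : z.1 - w.1 = (z.1 - ratr q1) + (ratr q1 - w.1) by ring.
    apply: le_lt_trans (ler_normD _ _) _; rewrite -/h in qw; lra.
  have -> : z.2 - w.2 = (z.2 - ratr q2) + (ratr q2 - w.2) by ring.
  apply: le_lt_trans (ler_normD _ _) _; rewrite -/h in qw; lra.
rewrite /eball /=; apply: le_lt_trans (dle _ _) _ => /=.
rewrite distrC (distrC (ratr q2)) -/h; lra.
Qed.

(** A curve is a countable union of compact arcs, the images of the segments [-n, n]. *)
Lemma trajectory_measurable (T : set (R * R)) : trajectory T -> measurable T.
Proof.
move=> [g [cg _ ->]].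
have -> : range g = \bigcup_n (g @` `[- n%:R, n%:R]%classic).
  apply/seteqP; split => [_ [t _ <-]|z [n _ [t _ <-]]]; last by exists t.
  exists (Num.bound `|t|) => //; exists t => //=; rewrite in_itv /= -ler_norml.
  by rewrite ltW// archi_boundP.
apply: bigcup_measurable => n _.
rewrite -(setCK (g @` _)); apply: measurableC; apply: open_measurable_plane.
rewrite openC; apply: compact_closed.
  exact: norm_hausdorff.
apply: continuous_compact; last exact: segment_compact.
exact: continuous_subspaceT.
Qed.

Lemma trajectory_set_measurable (Gamma : set (R * R)) :
  trajectory_set Gamma -> measurable Gamma.
Proof.
move=> [C [/countable_injP[f finj] tC ->]].
pose F n : set (R * R) := [set z | exists2 T, C T /\ f T = n & T z].
have -> : \bigcup_(T in C) T = \bigcup_n F n.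
  apply/seteqP; split => [z [T CT Tz]|z [n _ [T [CT _] Tz]]]; last by exists T.
  by exists (f T) => //; exists T.
apply: bigcup_measurable => n _.
have [[T [CT fT]]|noT] := pselect (exists T, C T /\ f T = n).
  have mT : measurable T by apply: trajectory_measurable; exact: tC.
  suff FT : F n = T by rewrite FT.
  apply/seteqP; split => [z [T' [CT' fT'] T'z]|z Tz]; last by exists T.
  by rewrite -(finj T' T) ?inE// fT fT'.
suff -> : F n = set0 by [].
by apply/seteqP; split => // z [T [CT fT] _]; apply: noT; exists T.
Qed.

(** The complement of Gamma is null for the restricted measure, and both measures agree on subsets
    of Gamma. *)
Lemma integral_hausdorff1_restr (Gamma : set (R * R)) (F : R * R -> \bar R) :
  measurable Gamma -> measurable_fun setT F -> (forall z, 0 <= F z)%E ->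
  (\int[@hausdorff1 R]_(z in Gamma) F z = \int[hausdorff1_restr Gamma]_z F z)%E.
Proof.
move=> mG mF F0.
rewrite (@ge0_negligible_integral _ _ _ (hausdorff1_restr Gamma) setT (~` Gamma))//.
- rewrite setTD setCK; apply: eq_measure_integral => A mA AG.
  by rewrite /= /hausdorff1_restr setIidl.
- exact: measurableC.
- by rewrite /= /hausdorff1_restr setICl; exact: (@measure0 _ _ _ (@hausdorff1 R)).
Qed.

(** By continuity at 0, phi <= phi(0) + 1 near 0, so balls of small radius d have mass at most pi
    (phi(0) + 1) d. *)
Lemma phi_regular_small_balls (phi : R -> R) (Gamma : set (R * R)) :
  phi x @[x --> within `[0, 1[ (nbhs (0 : R))] --> phi 0 -> 0 <= phi 0 ->
  phi_regular phi Gamma ->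
  forall e, 0 < e -> exists2 d, 0 < d &
    forall z, (hausdorff1_restr Gamma (eball z d) <= e%:E)%E.
Proof.
move=> /cvgrPdist_lt/(_ _ ltr01) + phi0 [_ reg] e e0.
rewrite near_withinE => /nbhs_ballP[del /= del0 hdel].
have pi0 := @pi_gt0 R.
have c0 : 0 < pi * (phi 0 + 1) by rewrite mulr_gt0//; lra.
pose d := Num.min (Num.min (del / 2) 2^-1) (e / (pi * (phi 0 + 1))).
have d0 : 0 < d by rewrite !lt_min invr_gt0 ltr0n (divr_gt0 e0 c0) divr_gt0.
have ddel : d < del by rewrite /d !gt_min; apply/orP; left; apply/orP; left; lra.
have d1 : d < 1 by rewrite /d !gt_min; apply/orP; left; apply/orP; right; lra.
have de : d <= e / (pi * (phi 0 + 1)) by rewrite /d ge_min lexx orbT.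
exists d => // z; apply: le_trans (reg z d _) _; first by rewrite d0 d1.
rewrite lee_fin.
have pd : phi d <= phi 0 + 1.
  have := hdel d; rewrite /ball /= sub0r normrN gtr0_norm// => /(_ ddel).
  rewrite in_itv /= (ltW d0) d1 => /(_ isT) /ltW; rewrite distrC => h.
  by have := le_trans (ler_norm _) h; lra.
apply: (@le_trans _ _ (pi * (phi 0 + 1) * d)).
  by rewrite ler_wpM2r ?(ltW d0)// ler_wpM2l// ltW.
by rewrite mulrC -ler_pdivlMr.
Qed.

End trajectory_measurability.

(** * Modulation norms as integrals *)

Section modulation_norms.
Context {R : realType}.

Lemma measurable_normc d (T : measurableType d) (g : T -> R[i]) :
  measurable_fun setT (fun t => complex.Re (g t)) ->
  measurable_fun setT (fun t => complex.Im (g t)) ->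
  measurable_fun setT (fun t => normc (g t)).
Proof.
move=> mr mi; have msqrt : measurable_fun [set: R] (@Num.sqrt R).
  by apply: continuous_measurable_fun; exact: sqrt_continuous.
rewrite (_ : (fun t => normc (g t)) =
    (fun t => Num.sqrt (complex.Re (g t) ^+ 2 + complex.Im (g t) ^+ 2))).
  apply: measurableT_comp msqrt _.
  by apply: measurable_funD; exact: measurable_funX.
by apply/funext => t; case: (g t).
Qed.

Lemma modulation_norm_powR (p : R) f : p != 0 ->
  (modulation_norm p f `^ p =
   \int[@lebesgue_measure R \x @lebesgue_measure R]_z
     (normc (stft (@gaussian R) f z) `^ p)%:E)%E.
Proof.
move=> p0; rewrite /modulation_norm powR_Lnorm//; apply: eq_integral => z _.
by rewrite /= ger0_norm ?normc_ge0.
Qed.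

Lemma powR_normc_stft_gauss_pairing (p : R) z w :
  normc (stft (@gaussian R) (gauss_pairing z) w) `^ p =
  gauss_bump (p * (pi / 2)) z w.
Proof.
rewrite normc_stft_gauss_pairing -expRM /gauss_bump; congr expR; ring.
Qed.

Lemma gauss_pairing_modulation_norm (p : R) z : 0 < p ->
  (modulation_norm p (gauss_pairing z) `^ p = (pi / (p * (pi / 2)))%:E)%E.
Proof.
move=> p0; rewrite modulation_norm_powR ?gt_eqF//.
under eq_integral do rewrite powR_normc_stft_gauss_pairing.
by apply: gauss_bump_integral; rewrite mulr_gt0// divr_gt0// pi_gt0.
Qed.

Lemma gauss_pairing_modulation_space (p : R) z : 0 < p ->
  modulation_space p (gauss_pairing z).
Proof.
move=> p0; have [mr mi] := measurable_stft_gauss_pairing z; split => //.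
- exact: gauss_pairing_tempered.
- apply: (@lty_poweRy _ _ p); first by rewrite gt_eqF.
  by rewrite gauss_pairing_modulation_norm// ltry.
Qed.

End modulation_norms.

Theorem corollary5 (R : realType) (phi : R -> R) (Gamma : set (R * R)) (p : R)
  (phi_ge0 : forall r, 0 <= r < 1 -> 0 <= phi r)
  (phi_cont : phi x @[x --> within `[0, 1[ (nbhs (0 : R))] --> phi 0)
  (Gamma_traj : trajectory_set Gamma)
  (Gamma_reg : phi_regular phi Gamma)
  (p_ge1 : 1 <= p) :
  gabor_sampling_trajectory p (@gaussian R) Gamma <->
  exists r m M : R, [/\ 0 < r, 0 < m, 0 < M &
    forall z : R * R,
      (m%:E <= hausdorff1 (Gamma `&` eball z r) <= M%:E)%E].
Proof.
have mG := trajectory_set_measurable Gamma_traj.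
have p0 : 0 < p by lra.
have pi0 := @pi_gt0 R.
have restrE z r : hausdorff1 (Gamma `&` eball z r) = hausdorff1_restr Gamma (eball z r).
  by rewrite setIC.
have mH (f : (R -> R[i]) -> R[i]) : modulation_space p f ->
    measurable_fun setT (fun z => normc (stft (@gaussian R) f z)).
  by move=> [_ mr mi _]; exact: measurable_normc.
have intE f : modulation_space p f ->
    (\int[@hausdorff1 R]_(z in Gamma) (normc (stft (@gaussian R) f z) `^ p)%:E =
     \int[hausdorff1_restr Gamma]_z (normc (stft (@gaussian R) f z) `^ p)%:E)%E.
  move=> Mf; apply: integral_hausdorff1_restr => //.
    apply/measurable_EFinP.
    exact: measurableT_comp (measurable_powR p) (mH f Mf).
  by move=> z; rewrite lee_fin powR_ge0.
split=> [[A [B [A0 B0 AB]]]|[r [m [M [r0 m0 M0 mM]]]]].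
  have a0 : 0 < p * (pi / 2) by rewrite mulr_gt0// divr_gt0.
  have q0 : 0 < pi / (p * (pi / 2)) by rewrite divr_gt0.
  (* The sampling inequalities are tested on [gauss_pairing z]; its norm is the same for all z, so
     the bounds are uniform in the centre. *)
  have := @ball_bounds_of_gauss_bounds R (hausdorff1_restr Gamma) (p * (pi / 2))
    (A * (pi / (p * (pi / 2)))) (B * (pi / (p * (pi / 2)))) a0 (mulr_gt0 A0 q0).
  case=> [z|r [m [M [r0 m0 M0 mM]]]].
    have Mz := gauss_pairing_modulation_space z p0.
    have := AB _ Mz; rewrite intE// gauss_pairing_modulation_norm// !EFinM.
    by under eq_integral do rewrite powR_normc_stft_gauss_pairing.
  by exists r, m, M; split => // z; rewrite restrE; exact: mM.
have mM' z : (m%:E <= hausdorff1_restr Gamma (eball z r) <= M%:E)%E.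
  by rewrite -restrE; exact: mM.
have phi00 : 0 <= phi 0 by apply: phi_ge0; rewrite lexx ltr01.
have [A [B [A0 B0 AB]]] := @sampling_measure_bounds R (hausdorff1_restr Gamma) p r m M
  p_ge1 r0 m0 mM' (phi_regular_small_balls phi_cont phi00 Gamma_reg).
exists A, B; split => // f Mf.
have [tf _ _ nf] := Mf.
rewrite intE// modulation_norm_powR ?gt_eqF//; apply: AB => //.
  exact: mH.
by rewrite -modulation_norm_powR ?gt_eqF//; exact: poweR_lty.
Qed.
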